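(* Let $s:\mathbb{C}\to\mathbb{P}^1$ be a meromorphic function with only one pole, of order $k\in\mathbb{N}^+$. Then there are two families of complete holomorphic vector fields on $\mathbb{C}^2$ of type $\mathbb{C}^*$, which are tangent to $\mathrm{graph}(s)$ and analytically equivalent, by a fiber-preserving automorphism of $\mathbb{C}^2$ that takes $\mathrm{graph}(s)$ into $\mathrm{graph}(1/z^k)$, to one of the polynomial vector fields below. That is, for every polynomial vector field $Y_0$ of the form (iii) or (iv) there is a complete holomorphic vector field on $\mathbb{C}^2$ of type $\mathbb{C}^*$, tangent to $\mathrm{graph}(s)$, which is sent to $Y_0$ by such an automorphism: (iii) $$Y_0=az\frac{\partial}{\partial z}+\left(A(z)w+\frac{-(ak+A(z))}{z^k}\right)\frac{\partial}{\partial w},$$ with $a\in\mathbb{C}$, $A(z)=-ak+A_0(z)$, $A_0\in z^k\cdot\mathbb{C}[z]$, $A\not\equiv0$; or (iv) $$Y_0=a\left(\frac{wz^k-1}{z^k}\right)\frac{\partial}{\partial w}+A\bigl(z^{m-nk}(wz^k-1)^n\bigr)\cdot\left[nz\frac{\partial}{\partial z}+\left(-mw+\frac{m-nk}{z^k}\right)\frac{\partial}{\partial w}\right],$$ with $a\in\mathbb{C}$, $m,n\in\mathbb{N}^+$, $\gcd(m,n)=1$, $m>nk$, and $A(y)=a/(m-nk)+A_0(y)$, $A_0\in y^k\cdot\mathbb{C}[y]$, $A\not\equiv0$ (evaluated at $y=z^{m-nk}(wz^k-1)^n$).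
   Context: $\mathbb{N}^+$ denotes the positive integers. $\mathrm{graph}(s)\subset\mathbb{C}^2$ is $\{(z,s(z)): s(z)\neq\infty\}$; in particular $\mathrm{graph}(1/z^k)=\{wz^k=1\}$. A vector field is tangent to a curve $C$ if $X(p)\in T_pC$ at each smooth point $p$ of $C$ ($X(p)=0$ allowed). A holomorphic vector field is complete if its solutions are defined for all complex times. A non-constant trajectory (image of a maximal solution) is of type $\mathbb{C}^*$ if it is isomorphic to $\mathbb{C}^*$ as a Riemann surface; a complete $X$ on $\mathbb{C}^2$ is of type $\mathbb{C}^*$ if all its trajectories through points outside some pluripolar set invariant by the flow are of type $\mathbb{C}^*$. An automorphism (biholomorphism) of $\mathbb{C}^2$ is fiber-preserving if it maps vertical lines $\{z=\text{const}\}$ to vertical lines. Two vector fields are analytically equivalent if one is the push-forward of the other under an analytic automorphism. *)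

(* Defs.v *)
From Stdlib Require Import Reals.
From Coquelicot Require Import Coquelicot.

Set Implicit Arguments.
Unset Strict Implicit.
Unset Printing Implicit Defensive.

Open Scope R_scope.

(* Derivatives are complex: the scalar ring is always [C_AbsRing]. *)
Definition C2 : NormedModule C_AbsRing :=
  prod_NormedModule C_AbsRing C_NormedModule C_NormedModule.

Definition holomorphic_at1 (V : NormedModule C_AbsRing) (f : C -> V) (p : C) :
    Prop :=
  locally (T := C_UniformSpace) p
    (fun z => ex_derive (K := C_AbsRing) (V := V) f z).

Definition holomorphic_at2 (V : NormedModule C_AbsRing) (f : C2 -> V)
    (p : C2) : Prop :=
  locally p (fun q => ex_filterdiff f (locally q)).

Definition holomorphic2 (V : NormedModule C_AbsRing) (f : C2 -> V) : Prop :=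
  forall p : C2, ex_filterdiff f (locally p).

(* The Riemann sphere: [None] is the point at infinity. *)
Definition P1 : Type := option C.

Definition regular_at (s : C -> P1) (p : C) : Prop :=
  exists h : C -> C, holomorphic_at1 (V := C_NormedModule) h p /\
    locally (T := C_UniformSpace) p (fun z => s z = Some (h z)).

(* Pole with principal part [c 1 / (z - p) + ... + c k / (z - p)^k]; its order
   is [k] when [0 < k]. *)
Definition pole_of_order (s : C -> P1) (p : C) (k : nat) : Prop :=
  s p = None /\
  exists (h : C -> C) (c : nat -> C),
    holomorphic_at1 (V := C_NormedModule) h p /\ c k <> RtoC 0 /\
    locally' (T := C_UniformSpace) p (fun z =>
      s z = Some (h z + sum_n_m (fun j => c j / (z - p) ^ j) 1 k)%C).

Definition meromorphic (s : C -> P1) : Prop :=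
  forall p : C,
    regular_at s p \/ exists k : nat, (0 < k)%nat /\ pole_of_order s p k.

Definition only_pole_of_order (s : C -> P1) (k : nat) : Prop :=
  exists p : C, pole_of_order s p k /\ forall q : C, s q = None -> q = p.

Definition graph (s : C -> P1) (p : C2) : Prop := s (fst p) = Some (snd p).

Definition inv_pow (k : nat) (z : C) : P1 :=
  if Ceq_dec z (RtoC 0) then None else Some (/ z ^ k)%C.

(* A point [p] of [S] is smooth when [S] is, near [p], the zero set of a
   holomorphic [f] whose differential [df] at [p] is non-zero; the tangent line
   of [S] at [p] is then the kernel of [df]. *)
Definition tangent_to (X : C2 -> C2) (S : C2 -> Prop) : Prop :=
  forall (p : C2) (f df : C2 -> C_NormedModule),
    S p ->
    holomorphic_at2 f p ->
    locally p (fun q => S q <-> f q = RtoC 0) ->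
    filterdiff f (locally p) df ->
    (exists v : C2, df v <> RtoC 0) ->
    df (X p) = RtoC 0.

Definition entire_solution (X : C2 -> C2) (phi : C -> C2) : Prop :=
  forall t : C, is_derive (K := C_AbsRing) (V := C2) phi t (X (phi t)).

Definition complete (X : C2 -> C2) : Prop :=
  forall p : C2, exists phi : C -> C2, phi (RtoC 0) = p /\ entire_solution X phi.

(* The image of [phi] is isomorphic to the Riemann surface C \ {0}: [psi] and
   [chi] are mutually inverse bijections, holomorphic for the complex structure
   on the image whose charts are the local inverses of [phi] (so [psi] is
   holomorphic when [psi o phi] is, and [chi] when it lifts locally through
   [phi] to a holomorphic [tau]).  Such a [phi] is never constant. *)
Definition trajectory_type_Cstar (phi : C -> C2) : Prop :=
  exists (psi : C2 -> C) (chi : C -> C2),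
    (forall t : C, psi (phi t) <> RtoC 0 /\ chi (psi (phi t)) = phi t) /\
    (forall x : C, x <> RtoC 0 ->
       (exists t : C, chi x = phi t) /\ psi (chi x) = x) /\
    (forall t : C,
       ex_derive (K := C_AbsRing) (V := C_NormedModule)
         (fun t' => psi (phi t')) t) /\
    (forall x : C, x <> RtoC 0 ->
       exists tau : C -> C,
         holomorphic_at1 (V := C_NormedModule) tau x /\
         locally (T := C_UniformSpace) x (fun y => chi y = phi (tau y))).

Definition d_x (h : C -> R) (z : C) : R :=
  Derive (fun x : R => h (x, snd z)) (fst z).
Definition d_y (h : C -> R) (z : C) : R :=
  Derive (fun y : R => h (fst z, y)) (snd z).

Definition C1_on (U : C -> Prop) (h : C -> R) : Prop :=
  forall z : C, U z ->
    ex_derive (fun x : R => h (x, snd z)) (fst z) /\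
    ex_derive (fun y : R => h (fst z, y)) (snd z) /\
    continuous (T := C_UniformSpace) (U := R_UniformSpace) (d_x h) z /\
    continuous (T := C_UniformSpace) (U := R_UniformSpace) (d_y h) z.

Definition harmonic_on (U : C -> Prop) (h : C -> R) : Prop :=
  C1_on U h /\ C1_on U (d_x h) /\ C1_on U (d_y h) /\
  forall z : C, U z -> d_x (d_x h) z + d_y (d_y h) z = 0.

Definition upper_semicontinuous (T : UniformSpace) (u : T -> Rbar) : Prop :=
  forall (p : T) (r : R), Rbar_lt (u p) r -> locally p (fun q => Rbar_lt (u q) r).

(* The constant -infinity counts as subharmonic. *)
Definition subharmonic (u : C -> Rbar) : Prop :=
  (forall z : C, u z <> p_infty) /\
  upper_semicontinuous (T := C_UniformSpace) u /\
  forall (c : C) (r : R) (h : C -> R),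
    0 < r ->
    continuous_on (T := C_UniformSpace) (U := R_UniformSpace)
      (fun z => Cmod (z - c) <= r) h ->
    harmonic_on (fun z => Cmod (z - c) < r) h ->
    (forall z : C, Cmod (z - c) = r -> Rbar_le (u z) (h z)) ->
    forall z : C, Cmod (z - c) <= r -> Rbar_le (u z) (h z).

Definition plurisubharmonic (u : C2 -> Rbar) : Prop :=
  (forall p : C2, u p <> p_infty) /\
  upper_semicontinuous u /\
  forall p v : C2, subharmonic (fun x : C => u (plus p (scal x v))).

Definition pluripolar (E : C2 -> Prop) : Prop :=
  exists u : C2 -> Rbar,
    plurisubharmonic u /\ (exists p : C2, u p <> m_infty) /\
    forall p : C2, E p -> u p = m_infty.

Definition flow_invariant (X : C2 -> C2) (E : C2 -> Prop) : Prop :=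
  forall phi : C -> C2, entire_solution X phi ->
    forall t t' : C, E (phi t) -> E (phi t').

(* Only used for complete fields, whose maximal solutions are the entire ones. *)
Definition type_Cstar (X : C2 -> C2) : Prop :=
  exists E : C2 -> Prop,
    pluripolar E /\ flow_invariant X E /\
    forall phi : C -> C2, entire_solution X phi ->
      forall t : C, ~ E (phi t) -> trajectory_type_Cstar phi.

Definition automorphism (F : C2 -> C2) : Prop :=
  holomorphic2 F /\
  exists G : C2 -> C2, holomorphic2 G /\
    (forall p : C2, G (F p) = p) /\ (forall p : C2, F (G p) = p).

Definition fiber_preserving (F : C2 -> C2) : Prop :=
  forall c : C, exists c' : C, forall q : C2,
    fst q = c' <-> exists p : C2, fst p = c /\ F p = q.

Definition pushes_forward (F X Y : C2 -> C2) : Prop :=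
  forall p : C2, exists dF : C2 -> C2,
    filterdiff F (locally p) dF /\ dF (X p) = Y (F p).

Definition polynomial1 (f : C -> C) : Prop :=
  exists (N : nat) (c : nat -> C),
    forall z : C, f z = sum_n (fun i => c i * z ^ i)%C N.

Definition polynomial2 (f : C2 -> C) : Prop :=
  exists (N : nat) (c : nat -> nat -> C), forall z w : C,
    f (z, w) = sum_n (fun i => sum_n (fun j => c i j * z ^ i * w ^ j)%C N) N.

Definition polynomial_field (Y : C2 -> C2) : Prop :=
  polynomial2 (fun p => fst (Y p)) /\ polynomial2 (fun p => snd (Y p)).

(* [f] belongs to the ideal z^k C[z] *)
Definition in_pow_ideal (k : nat) (f : C -> C) : Prop :=
  exists B : C -> C, polynomial1 B /\ forall z : C, f z = (z ^ k * B z)%C.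

(* In both families the formula is only required off z = 0, where it makes
   literal sense; polynomiality of [Y] determines its values on z = 0. *)

Definition family_iii (k : nat) (Y : C2 -> C2) : Prop :=
  polynomial_field Y /\
  exists (a : C) (A A0 : C -> C),
    in_pow_ideal k A0 /\
    (forall z : C, A z = - (a * INR k) + A0 z)%C /\
    (exists z : C, A z <> RtoC 0) /\
    forall z w : C, z <> RtoC 0 ->
      Y (z, w) = (a * z, A z * w + - (a * INR k + A z) / z ^ k)%C.

Definition family_iv (k : nat) (Y : C2 -> C2) : Prop :=
  polynomial_field Y /\
  exists (a : C) (m n : nat) (A A0 : C -> C),
    (0 < m)%nat /\ (0 < n)%nat /\ Nat.gcd m n = 1%nat /\ (n * k < m)%nat /\
    in_pow_ideal k A0 /\
    (forall y : C, A y = a / INR (m - n * k) + A0 y)%C /\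
    (exists y : C, A y <> RtoC 0) /\
    forall z w : C, z <> RtoC 0 ->
      let y := (z ^ (m - n * k) * (w * z ^ k - 1) ^ n)%C in
      Y (z, w) =
        (A y * (INR n * z),
         a * ((w * z ^ k - 1) / z ^ k) +
         A y * (- INR m * w + INR (m - n * k) / z ^ k))%C.

(* Main.v *)
Require Import Defs.
From Stdlib Require Import Reals Lra Lia Psatz ClassicalEpsilon.
From Coquelicot Require Import Coquelicot.

(* Write [u = z - p], where [p] is the pole, and [s = g / u^k] with [g] entire
   and [g(p) <> 0].  An entire nowhere zero [al] with the same [(k-1)]-jet as
   [1 / g] at [p] gives an entire [be] with [al g + be u^k = 1], so the
   automorphism [F(z, w) = (u, al w + be)] sends the graph of [s] to
   [w z^k = 1]; the field is the pull-back of [Y0] by [F].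

   In the coordinates [z] and [v = w z^k - 1] both families read
     [z' = z (p0 + n C(y))],  [v' = - l v C(y)],  [y = z^l v^n],
   with [gcd(l, n) = 1] and [C] in the ideal of [y^k].  Hence [y' = l p0 y] and
   the flow is explicit.  Off the zero set of a holomorphic function, which is
   pluripolar, a trajectory depends on the time through one exponential only.

   That the pull-back is holomorphic requires the derivatives of [al] and [be]
   to be holomorphic, which rests on Goursat's theorem and Cauchy's formula on a
   square.  The logarithm of the modulus of an entire function satisfies the
   maximum principle because adding [eps |x|^2] makes it strictly subharmonic
   where it is finite. *)

(** The straightening wants [al] nowhere zero, so that [F] is invertible on each vertical line, and
    [be = (1 - al g) / u^k] entire, so that [F] exists across the pole; hence the jet condition.

    The prescribed constant terms of [A] are those for which [C] vanishes at 0 to order [k]. This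
    has two effects. The division by [z^k] leaves no pole, and [C(y) / y] is a polynomial, so that
    [C(y0 exp(lam t))] with [lam = l p0] has, if [p0 <> 0], a primitive that depends on [t] through
    [exp(lam t)] alone, without a linear term that would destroy the periodicity in time.

    If [p0 <> 0] the period is that of [exp(p0 t)], and the axis [z = 0] is the exceptional set. If
    [p0 = 0] then [y] is a first integral, each trajectory has its own rate [c = C(y)], and
    coprimality of [l] and [n] makes [exp(c t)] a function of the point; the exceptional set is then
    [z v B(y) = 0] with [C(y) = y^k B(y)]. *)

Local Open Scope C_scope.

(** * Complex differentiation *)

(* The two normed modules on [C] have different uniform structures, but only the
   norm of the target enters differentiability. *)
Lemma filterdiff_C_target (U : NormedModule C_AbsRing) (F : (U -> Prop) -> Prop)
    (f l : U -> C) :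
  filterdiff (K := C_AbsRing) (V := C_NormedModule) f F l <->
  filterdiff (K := C_AbsRing) (V := AbsRing_NormedModule C_AbsRing) f F l.
Proof.
split; intros [[H1 H2 H3] H4]; split; try exact H4;
  split; [exact H1|exact H2|exact H3|exact H1|exact H2|exact H3].
Qed.

Definition cder (f : C -> C) (z l : C) : Prop :=
  is_derive (K := C_AbsRing) (V := C_NormedModule) f z l.

(** [filterdiff] quantifies over all limit points of the filter; [locally x] has [x] as its only
    one. *)
Lemma is_derive_eps {K : AbsRing} {V : NormedModule K} (f : K -> V) (x : K) (l : V) :
  is_derive f x l <->
  forall eps : posreal, locally x (fun y =>
    norm (minus (minus (f y) (f x)) (scal (minus y x) l)) <= eps * norm (minus y x)).
Proof.
split.
- intros [_ H] eps. apply (H x (fun P HP => HP) eps).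
- intros H. split; [apply is_linear_scal_l|].
  intros y Hy.
  rewrite <- (is_filter_lim_locally_unique (V := AbsRing_NormedModule K) x y Hy). exact H.
Qed.

Lemma cder_eps (f : C -> C) (z l : C) :
  cder f z l <->
  forall eps : R, 0 < eps -> exists d : R, 0 < d /\ forall y : C, Cmod (y - z) < d ->
    Cmod (f y - f z - (y - z) * l) <= eps * Cmod (y - z).
Proof.
unfold cder. rewrite (is_derive_eps (K := C_AbsRing) (V := C_NormedModule)). split.
- intros H eps He. destruct (H (mkposreal eps He)) as [d Hd].
  exists d. split; [apply cond_pos|]. intros y Hy. apply (Hd y Hy).
- intros H eps. destruct (H eps (cond_pos eps)) as [d [Hd H']].
  exists (mkposreal d Hd). intros y Hy. apply (H' y Hy).
Qed.

Lemma locally_C_eps (z : C) (P : C -> Prop) :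
  locally (T := C_UniformSpace) z P <->
  exists d : R, 0 < d /\ forall y : C, Cmod (y - z) < d -> P y.
Proof.
rewrite locally_C. split.
- intros [d Hd]. exists d. split; [apply cond_pos|]. intros y Hy. apply (Hd y Hy).
- intros [d [Hd H]]. exists (mkposreal d Hd). intros y Hy. apply (H y Hy).
Qed.

Lemma cder_eq (f : C -> C) (z l l' : C) : cder f z l -> l = l' -> cder f z l'.
Proof. now intros H <-. Qed.

Lemma cder_ext (f g : C -> C) (z l : C) :
  (forall z, f z = g z) -> cder f z l -> cder g z l.
Proof. intros H. apply is_derive_ext. exact H. Qed.

Lemma cder_ext_loc (f g : C -> C) (z l : C) :
  locally (T := C_UniformSpace) z (fun y => f y = g y) -> cder f z l -> cder g z l.
Proof.
intros H. apply is_derive_ext_loc. apply locally_C. exact H.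
Qed.

Lemma cder_mult (f g : C -> C) z a b :
  cder f z a -> cder g z b -> cder (fun z => f z * g z) z (a * g z + f z * b).
Proof.
intros H1 H2. apply filterdiff_C_target in H1, H2. apply filterdiff_C_target.
apply (is_derive_mult (K:=C_AbsRing) f g z a b H1 H2 Cmult_comm).
Qed.

Lemma cder_comp (f g : C -> C) z a b :
  cder f (g z) a -> cder g z b -> cder (fun z => f (g z)) z (b * a).
Proof.
intros H1 H2. apply filterdiff_C_target in H2.
apply (is_derive_comp (K:=C_AbsRing) (V:=C_NormedModule) f g z a b H1 H2).
Qed.

Lemma cder_id z : cder (fun z => z) z 1.
Proof. apply filterdiff_C_target, (is_derive_id (K:=C_AbsRing)). Qed.

Lemma cder_const (c : C) z : cder (fun _ => c) z 0.
Proof. apply (is_derive_const (K:=C_AbsRing) (V:=C_NormedModule)). Qed.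

Lemma cder_plus (f g : C -> C) z a b :
  cder f z a -> cder g z b -> cder (fun z => f z + g z) z (a + b).
Proof. apply (is_derive_plus (K:=C_AbsRing) (V:=C_NormedModule)). Qed.

Lemma cder_opp (f : C -> C) z a : cder f z a -> cder (fun z => - f z) z (- a).
Proof. apply (is_derive_opp (K:=C_AbsRing) (V:=C_NormedModule)). Qed.

Lemma cder_minus (f g : C -> C) z a b :
  cder f z a -> cder g z b -> cder (fun z => f z - g z) z (a - b).
Proof. apply (is_derive_minus (K:=C_AbsRing) (V:=C_NormedModule)). Qed.

Lemma cder_pow (f : C -> C) n z a :
  cder f z a -> cder (fun z => f z ^ n) z (RtoC (INR n) * f z ^ pred n * a).
Proof.
intros H. induction n.
- eapply cder_eq; [apply (cder_const 1)|]. simpl. ring.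
- eapply cder_eq; [apply (cder_mult f _ z _ _ H IHn)|].
  rewrite S_INR, RtoC_plus. destruct n; simpl; ring.
Qed.

Lemma cder_unique (f : C -> C) z a b : cder f z a -> cder f z b -> a = b.
Proof.
intros H1 H2. rewrite <- (is_C_derive_unique f z a H1). apply is_C_derive_unique, H2.
Qed.

Lemma continuous_C_eps (T : UniformSpace) (f : T -> C) (x : T) :
  continuous (U := C_UniformSpace) f x <->
  forall eps : R, 0 < eps -> locally x (fun y => Cmod (f y - f x) < eps).
Proof.
split.
- intros H eps He. apply (H (fun y => Cmod (y - f x) < eps)).
  apply locally_C_eps. now exists eps.
- intros H P HP. apply locally_C_eps in HP. destruct HP as [d [Hd HP]].
  unfold filtermap. apply filter_imp with (2 := H d Hd). intros y Hy. now apply HP.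
Qed.

Lemma cder_continuous (f : C -> C) z l :
  cder f z l -> continuous (T := C_UniformSpace) (U := C_UniformSpace) f z.
Proof.
intros H. assert (Hc : ex_derive (K:=C_AbsRing) (V:=C_NormedModule) f z) by (now exists l).
apply ex_derive_continuous in Hc. intros P HP. apply locally_C. apply Hc, HP.
Qed.

Lemma continuous_Cplus (T : UniformSpace) (f g : T -> C) (x : T) :
  continuous (U := C_UniformSpace) f x -> continuous (U := C_UniformSpace) g x ->
  continuous (U := C_UniformSpace) (fun y => f y + g y) x.
Proof.
apply (continuous_plus (K := C_AbsRing) (V := C_NormedModule)).
Qed.

Lemma continuous_Cmult (T : UniformSpace) (f g : T -> C) (x : T) :
  continuous (U := C_UniformSpace) f x -> continuous (U := C_UniformSpace) g x ->
  continuous (U := C_UniformSpace) (fun y => f y * g y) x.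
Proof.
intros Hf Hg P HP. apply locally_C in HP.
refine (continuous_mult (K := C_AbsRing) f g x _ _ P HP).
- intros Q HQ. apply Hf. apply locally_C. exact HQ.
- intros Q HQ. apply Hg. apply locally_C. exact HQ.
Qed.

Lemma continuous_Cconst (T : UniformSpace) (c : C) (x : T) :
  continuous (U := C_UniformSpace) (fun _ => c) x.
Proof. apply continuous_const. Qed.

Lemma Cmod_pos (z : C) : z <> 0 -> 0 < Cmod z.
Proof. apply Cmod_gt_0. Qed.

Lemma Cmod_minus_sym (z w : C) : Cmod (z - w) = Cmod (w - z).
Proof. rewrite <- Cmod_opp. f_equal. ring. Qed.

Lemma Cmod_triangle_inv (z w : C) : Cmod z - Cmod w <= Cmod (z - w).
Proof.
assert (H := Cmod_triangle (z - w) w). replace (z - w + w) with z in H by ring. lra.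
Qed.

Lemma cder_Cinv (z : C) : z <> 0 -> cder (fun z => / z) z (- / z ^ 2).
Proof.
intros Hz. apply cder_eps. intros eps He.
assert (Hm := Cmod_pos z Hz). set (m := Cmod z) in *.
(* The first bound gives [|y| >= m / 2], so the remainder [(y - z)^2 / (y z^2)] is at most
   [2 |y - z|^2 / m^3]; the second bound turns this into [eps |y - z|]. *)
exists (Rmin (m / 2) (eps * (m * m * m) / 2)).
split. { apply Rmin_case; [lra|]. apply Rdiv_lt_0_compat; [|lra]. repeat apply Rmult_lt_0_compat;
  lra. }
intros y Hy.
assert (H1 := Rlt_le_trans _ _ _ Hy (Rmin_l _ _)).
assert (H2 := Rlt_le_trans _ _ _ Hy (Rmin_r _ _)).
assert (H3 := Cmod_triangle_inv z y). fold m in H3. rewrite (Cmod_minus_sym z y) in H3.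
assert (Hy0 : y <> 0). { intros ->. rewrite Cmod_0 in H3. lra. }
replace (/ y - / z - (y - z) * - / z ^ 2) with ((y - z) * (y - z) * / (y * z * z)) by (field; auto).
rewrite !Cmod_mult, Cmod_inv by (repeat apply Cmult_neq_0; auto). rewrite !Cmod_mult. fold m.
set (u := Cmod (y - z)) in *. assert (0 <= u) by apply Cmod_ge_0.
set (q := Cmod y) in *.
assert (m / 2 <= q) by lra.
rewrite Rmult_assoc, Rmult_comm. apply Rmult_le_compat_r; [lra|].
apply Rmult_le_reg_r with (q * m * m)%R. { repeat apply Rmult_lt_0_compat; lra. }
rewrite Rmult_assoc, Rinv_l. 2:{ apply Rgt_not_eq. repeat apply Rmult_lt_0_compat; lra. }
assert (0 < m * m)%R by (apply Rmult_lt_0_compat; lra).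
assert (m * (m * m) / 2 <= q * m * m)%R by nra.
assert (eps * (m * (m*m) / 2) <= eps * (q * m * m))%R by (apply Rmult_le_compat_l; lra).
lra.
Qed.

Lemma cder_inv (f : C -> C) z a :
  cder f z a -> f z <> 0 -> cder (fun z => / f z) z (- a / f z ^ 2).
Proof.
intros H H0. eapply cder_eq; [apply (cder_comp (fun z => / z) f z _ _ (cder_Cinv (f z) H0) H)|].
field. exact H0.
Qed.

Lemma locally_R_eps (x : R) (P : R -> Prop) (d : R) :
  0 < d -> (forall y, Rabs (y - x) < d -> P y) -> locally x P.
Proof. intros Hd H. exists (mkposreal d Hd). intros y Hy. apply H, Hy. Qed.

Lemma norm_C_R (z : C) : norm (K := R_AbsRing) (V := C_R_NormedModule) z = Cmod z.
Proof.
unfold norm; simpl. unfold prod_norm, Cmod, norm; simpl. unfold abs; simpl.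
rewrite !Rmult_1_r. f_equal. rewrite <- !Rabs_mult. f_equal; apply Rabs_pos_eq; nra.
Qed.

Lemma scal_C_R (t : R) (z : C) : scal (K := R_Ring) (V := C_R_ModuleSpace) t z = (RtoC t * z).
Proof. destruct z as [x y]. unfold scal; simpl. unfold prod_scal, scal; simpl. unfold mult; simpl.
 unfold Cmult; simpl. f_equal; ring. Qed.

Lemma is_derive_R_C (f : R -> C) (t : R) (l : C) :
  is_derive (K := R_AbsRing) (V := C_R_NormedModule) f t l <->
  forall eps : R, 0 < eps -> locally t (fun y =>
    Cmod (f y - f t - RtoC (y - t) * l) <= eps * Rabs (y - t)).
Proof.
rewrite is_derive_eps. split.
- intros H eps He. generalize (H (mkposreal eps He)). apply filter_imp. intros y.
  rewrite norm_C_R, scal_C_R. auto.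
- intros H eps. generalize (H eps (cond_pos eps)). apply filter_imp. intros y.
  rewrite norm_C_R, scal_C_R. auto.
Qed.

Lemma cder_line (f : C -> C) (z v : C) (t : R) (l : C) :
  cder f (z + RtoC t * v) l ->
  is_derive (K := R_AbsRing) (V := C_R_NormedModule) (fun t : R => f (z + RtoC t * v)) t (l * v).
Proof.
intros H. rewrite cder_eps in H. apply is_derive_R_C. intros eps He.
assert (Hv := Cmod_ge_0 v).
destruct (H (eps / (Cmod v + 1))%R) as [d [Hd H']]. { apply Rdiv_lt_0_compat; lra. }
apply (locally_R_eps t _ (d / (Cmod v + 1))). { apply Rdiv_lt_0_compat; lra. }
intros y Hy.
assert (E : z + y * v - (z + t * v) = RtoC (y - t) * v) by (rewrite RtoC_minus; ring).
assert (Hm : (Cmod (RtoC (y - t) * v) <= Rabs (y - t) * (Cmod v + 1))%R).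
{ rewrite Cmod_mult, Cmod_R. apply Rmult_le_compat_l; [apply Rabs_pos|lra]. }
specialize (H' (z + y * v)). rewrite E in H'.
replace (f (z + y * v) - f (z + t * v) - RtoC (y - t) * (l * v)) with (f (z + y * v) - f (z + t * v) - RtoC (y - t) * v * l) by ring.
eapply Rle_trans; [apply H'|].
- eapply Rle_lt_trans; [exact Hm|].
  apply Rmult_lt_reg_r with (/ (Cmod v + 1))%R. { apply Rinv_0_lt_compat; lra. }
  rewrite Rmult_assoc, Rinv_r by lra. unfold Rdiv in Hy. lra.
- replace (eps * Rabs (y - t))%R with (eps / (Cmod v + 1) * (Rabs (y - t) * (Cmod v + 1)))%R by (field; lra).
  apply Rmult_le_compat_l; [|exact Hm]. apply Rlt_le, Rdiv_lt_0_compat; lra.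
Qed.

Ltac cder_step := match goal with
  | |- cder (fun z => z) _ _ => apply cder_id
  | |- cder (fun _ => ?c) _ _ => apply cder_const
  | |- cder (fun z => @?f z + @?g z) _ _ => apply (cder_plus f g)
  | |- cder (fun z => @?f z - @?g z) _ _ => apply (cder_minus f g)
  | |- cder (fun z => - @?f z) _ _ => apply (cder_opp f)
  | |- cder (fun z => @?f z * @?g z) _ _ => apply (cder_mult f g)
  | |- cder (fun z => @?f z ^ ?n) _ _ => apply (cder_pow f n)
  | |- cder (fun z => / @?f z) _ _ => apply (cder_inv f)
  | |- cder (fun z => @?f z / @?g z) _ _ => apply (cder_mult f (fun z => / g z))
  | H : forall z, cder ?f z _ |- cder ?f _ _ => apply H
  | H : forall z, cder ?f z _ |- cder (fun z => ?f (@?g z)) _ _ => apply (cder_comp f g); [apply H|]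
  end.
Ltac cder_auto := repeat cder_step.

(** * Integrals over rectangles and Goursat's theorem *)

Lemma nested_intervals (u v : nat -> R) :
  (forall n, u n <= u (S n)) -> (forall n, v (S n) <= v n) -> (forall n, u n <= v n) ->
  exists x, forall n, u n <= x <= v n.
Proof.
intros Hu Hv Huv.
assert (Hu' : forall n m, (n <= m)%nat -> u n <= u m).
{ intros n m H. induction H; [lra|]. eapply Rle_trans; [exact IHle|apply Hu]. }
assert (Hv' : forall n m, (n <= m)%nat -> v m <= v n).
{ intros n m H. induction H; [lra|]. eapply Rle_trans; [apply Hv|exact IHle]. }
destruct (completeness (fun r => exists n, r = u n)) as [x [Hx1 Hx2]].
- exists (v O). intros r [n ->]. eapply Rle_trans; [apply Huv|]. apply Hv'. lia.
- exists (u O). now exists O.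
- exists x. intros n. split; [apply Hx1; now exists n|].
  apply Hx2. intros r [m ->].
  apply Rle_trans with (u (max n m)); [apply Hu'; lia|].
  eapply Rle_trans; [apply Huv|]. apply Hv'. lia.
Qed.

Lemma halving_small (w d : R) : 0 < d -> exists n, (w / 2 ^ n < d)%R.
Proof.
intros Hd. destruct (INR_unbounded (w / d)) as [n Hn]. exists n.
assert (H2 : INR n <= 2 ^ n).
{ clear. induction n; [simpl; lra|]. rewrite S_INR. simpl.
  assert (1 <= 2 ^ n)%R by (apply pow_R1_Rle; lra). lra. }
assert (0 < 2 ^ n)%R by (apply pow_lt; lra).
apply Rmult_lt_reg_r with (2 ^ n)%R; [lra|].
unfold Rdiv. rewrite Rmult_assoc, Rinv_l by lra.
apply Rmult_lt_reg_r with (/ d)%R; [now apply Rinv_0_lt_compat|].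
replace (d * 2 ^ n * / d)%R with (2 ^ n)%R by (field; lra). unfold Rdiv in Hn. lra.
Qed.

(** Compactness in the form used for Goursat's theorem, for boundedness and for the existence of
    maxima. If [P] failed on the rectangle it would fail on one quarter, and so on; the nested bad
    rectangles shrink to a point, where the local hypothesis contradicts them. *)
Lemma rectangle_bisection (P : R -> R -> R -> R -> Prop) (a b c d : R) :
  a <= b -> c <= d ->
  (forall a b c d, a <= b -> c <= d ->
    P a ((a + b) / 2)%R c ((c + d) / 2)%R -> P ((a + b) / 2)%R b c ((c + d) / 2)%R ->
    P a ((a + b) / 2)%R ((c + d) / 2)%R d -> P ((a + b) / 2)%R b ((c + d) / 2)%R d ->
    P a b c d) ->
  (forall x y, a <= x <= b -> c <= y <= d -> exists e, 0 < e /\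
    forall a' b' c' d', a' <= x <= b' -> c' <= y <= d' ->
      b' - a' < e -> d' - c' < e -> P a' b' c' d') ->
  P a b c d.
Proof.
intros Hab Hcd Hsplit Hloc.
apply NNPP. intros HP.
pose (Q := fun q : R * R * R * R => let '(a, b, c, d) := q in P a b c d).
(* The fourth quarter is chosen untested: when the other three satisfy [P], the splitting hypothesis
   forces it to fail. *)
pose (step := fun q : R * R * R * R => let '(a, b, c, d) := q in
  let m := ((a + b) / 2)%R in let n := ((c + d) / 2)%R in
  if excluded_middle_informative (P a m c n) then
  if excluded_middle_informative (P m b c n) then
  if excluded_middle_informative (P a m n d) then (m, b, n, d)
  else (a, m, n, d) else (m, b, c, n) else (a, m, c, n)).
pose (sq := fix sq n := match n with O => (a, b, c, d) | S n => step (sq n) end).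
pose (la := fun n => fst (fst (fst (sq n)))).
pose (lb := fun n => snd (fst (fst (sq n)))).
pose (lc := fun n => snd (fst (sq n))).
pose (ld := fun n => snd (sq n)).
assert (Hsq : forall n, sq n = (la n, lb n, lc n, ld n)).
{ intros n. unfold la, lb, lc, ld. now destruct (sq n) as [[[? ?] ?] ?]. }
assert (Hinv : forall n, la n <= lb n /\ lc n <= ld n /\ ~ P (la n) (lb n) (lc n) (ld n) /\
  (lb n - la n = (b - a) / 2 ^ n)%R /\ (ld n - lc n = (d - c) / 2 ^ n)%R /\
  la n <= la (S n) /\ lb (S n) <= lb n /\ lc n <= lc (S n) /\ ld (S n) <= ld n).
{ assert (Hstep : forall n, la n <= lb n -> lc n <= ld n -> ~ P (la n) (lb n) (lc n) (ld n) ->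
    ~ P (la (S n)) (lb (S n)) (lc (S n)) (ld (S n)) /\
    (lb (S n) - la (S n) = (lb n - la n) / 2)%R /\ (ld (S n) - lc (S n) = (ld n - lc n) / 2)%R /\
    la n <= la (S n) /\ lb (S n) <= lb n /\ lc n <= lc (S n) /\ ld (S n) <= ld n).
  { intros n H1 H2 H3.
    assert (E : sq (S n) = step (la n, lb n, lc n, ld n)) by (rewrite <- Hsq; reflexivity).
    rewrite Hsq in E. unfold step in E.
    repeat destruct excluded_middle_informative; injection E as -> -> -> ->;
      (split; [auto|repeat split; lra]). }
  assert (H0 : forall n, la n <= lb n /\ lc n <= ld n /\ ~ P (la n) (lb n) (lc n) (ld n) /\
    (lb n - la n = (b - a) / 2 ^ n)%R /\ (ld n - lc n = (d - c) / 2 ^ n)%R).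
  { induction n as [|n IH].
    - unfold la, lb, lc, ld; simpl. repeat split; auto; field.
    - destruct IH as (H1 & H2 & H3 & H4 & H5).
      destruct (Hstep n H1 H2 H3) as (G1 & G2 & G3 & _).
      assert (0 < 2 ^ n)%R by (apply pow_lt; lra).
      repeat split; try lra; auto.
      + rewrite G2, H4. simpl. field. lra.
      + rewrite G3, H5. simpl. field. lra. }
  intros n. destruct (H0 n) as (H1 & H2 & H3 & H4 & H5).
  destruct (Hstep n H1 H2 H3) as (G1 & G2 & G3 & G4 & G5 & G6 & G7). tauto. }
destruct (nested_intervals la lb) as [x Hx]; try (intros n; apply Hinv).
destruct (nested_intervals lc ld) as [y Hy]; try (intros n; apply Hinv).
destruct (Hloc x y (Hx O) (Hy O)) as [e [He H]].
destruct (halving_small (Rmax (b - a) (d - c)) e He) as [n Hn].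
destruct (Hinv n) as (_ & _ & HnP & H4 & H5 & _).
assert (H2n : (0 < / 2 ^ n)%R) by (apply Rinv_0_lt_compat, pow_lt; lra).
apply HnP, H; [apply Hx|apply Hy|rewrite H4|rewrite H5];
  (eapply Rle_lt_trans; [|exact Hn]); apply Rmult_le_compat_r; try lra;
  [apply Rmax_l|apply Rmax_r].
Qed.

Notation CInt := (RInt (V := C_R_CompleteNormedModule)).
Notation Ccont f z := (continuous (T := C_UniformSpace) (U := C_UniformSpace) f z).
Notation RCcont f t := (continuous (T := R_UniformSpace) (U := C_UniformSpace) f t).

Lemma CInt_ex (f : R -> C) (a b : R) :
  a <= b -> (forall t, a <= t <= b -> RCcont f t) -> ex_RInt (V := C_R_CompleteNormedModule) f a b.
Proof.
intros Hab H. apply (ex_RInt_continuous (V := C_R_CompleteNormedModule)).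
rewrite Rmin_left, Rmax_right by lra. exact H.
Qed.

Lemma CInt_correct (f : R -> C) (a b : R) :
  a <= b -> (forall t, a <= t <= b -> RCcont f t) ->
  is_RInt (V := C_R_CompleteNormedModule) f a b (CInt f a b).
Proof. intros Hab H. apply (RInt_correct (V := C_R_CompleteNormedModule)), CInt_ex; auto. Qed.

Lemma CInt_plus (f g : R -> C) (a b : R) :
  a <= b -> (forall t, a <= t <= b -> RCcont f t) -> (forall t, a <= t <= b -> RCcont g t) ->
  CInt (fun t => f t + g t) a b = CInt f a b + CInt g a b.
Proof.
intros. apply (is_RInt_unique (V := C_R_CompleteNormedModule)).
apply (is_RInt_plus (V := C_R_CompleteNormedModule)); apply CInt_correct; auto.
Qed.

(** The integral lives in a real normed module, whose linearity covers real factors only; a complex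
    factor is treated through real and imaginary parts. *)
Lemma CInt_scal (k : C) (f : R -> C) (a b : R) :
  a <= b -> (forall t, a <= t <= b -> RCcont f t) ->
  CInt (fun t => k * f t) a b = k * CInt f a b.
Proof.
intros Hab Hf. apply (is_RInt_unique (V := C_R_CompleteNormedModule)).
assert (H := CInt_correct f a b Hab Hf). set (I := CInt f a b) in *.
assert (H1 := is_RInt_fct_extend_fst (U := R_NormedModule) (V := R_NormedModule) f a b I H).
assert (H2 := is_RInt_fct_extend_snd (U := R_NormedModule) (V := R_NormedModule) f a b I H).
apply (is_RInt_fct_extend_pair (U := R_NormedModule) (V := R_NormedModule)).
- refine (is_RInt_minus (V := R_NormedModule) _ _ a b _ _ _ _);
  apply (is_RInt_scal (V := R_NormedModule)); assumption.
- refine (is_RInt_plus (V := R_NormedModule) _ _ a b _ _ _ _);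
  apply (is_RInt_scal (V := R_NormedModule)); assumption.
Qed.

Lemma CInt_Chasles (f : R -> C) (a b c : R) :
  a <= b <= c -> (forall t, a <= t <= c -> RCcont f t) ->
  CInt f a c = CInt f a b + CInt f b c.
Proof.
intros Hab Hf. apply (is_RInt_unique (V := C_R_CompleteNormedModule)).
apply (is_RInt_Chasles (V := C_R_CompleteNormedModule)) with b;
  apply CInt_correct; try lra; intros; apply Hf; lra.
Qed.

Lemma CInt_bound (f : R -> C) (a b M : R) :
  a <= b -> (forall t, a <= t <= b -> RCcont f t) ->
  (forall t, a <= t <= b -> Cmod (f t) <= M) -> (Cmod (CInt f a b) <= (b - a) * M)%R.
Proof.
intros Hab Hf HM. rewrite <- norm_C_R.
apply (norm_RInt_le_const (V := C_R_NormedModule)) with f; auto.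
- intros t Ht. rewrite norm_C_R. auto.
- apply CInt_correct; auto.
Qed.

Lemma CInt_prim (K f : R -> C) (a b : R) :
  a <= b -> (forall t, a <= t <= b -> RCcont f t) ->
  (forall t, a <= t <= b -> is_derive (K := R_AbsRing) (V := C_R_NormedModule) K t (f t)) ->
  CInt f a b = K b - K a.
Proof.
intros Hab Hf HK. apply (is_RInt_unique (V := C_R_CompleteNormedModule)).
apply (is_RInt_derive (V := C_R_CompleteNormedModule)); rewrite Rmin_left, Rmax_right by lra; auto.
Qed.

Lemma CInt_ext (f g : R -> C) (a b : R) :
  a <= b -> (forall t, a <= t <= b -> f t = g t) -> CInt f a b = CInt g a b.
Proof.
intros Hab H. apply (RInt_ext (V := C_R_CompleteNormedModule)).
rewrite Rmin_left, Rmax_right by lra. intros; apply H; lra.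
Qed.

(** The contour integral of [f dz] along the boundary, counterclockwise: [dz] is [dx] on the
    horizontal sides and [i dy] on the vertical ones. *)
Definition bint (f : C -> C) (a b c d : R) : C :=
  CInt (fun x => f (x, c)) a b - CInt (fun x => f (x, d)) a b +
  Ci * (CInt (fun y => f (b, y)) c d - CInt (fun y => f (a, y)) c d).

Definition on_sides (a b c d : R) (z : C) : Prop :=
  (a <= fst z <= b /\ (snd z = c \/ snd z = d)) \/
  (c <= snd z <= d /\ (fst z = a \/ fst z = b)).

(** Continuity is confined to the boundary because the Cauchy kernels have their pole inside. *)
Definition cont_on_sides (f : C -> C) (a b c d : R) : Prop :=
  forall z : C, on_sides a b c d z -> Ccont f z.

Lemma cont_h (f : C -> C) (x y : R) : Ccont f (x, y) -> RCcont (fun x => f (x, y)) x.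
Proof.
intros H. apply (continuous_comp_2 (U := R_UniformSpace) (V := R_UniformSpace) (W := R_UniformSpace)
  (X := C_UniformSpace) (fun x => x) (fun _ => y) (fun x y => f (x, y)) x).
- apply continuous_id.
- apply continuous_const.
- apply continuous_ext with f; [|exact H]. now intros [? ?].
Qed.

Lemma cont_v (f : C -> C) (x y : R) : Ccont f (x, y) -> RCcont (fun y => f (x, y)) y.
Proof.
intros H. apply (continuous_comp_2 (U := R_UniformSpace) (V := R_UniformSpace) (W := R_UniformSpace)
  (X := C_UniformSpace) (fun _ => x) (fun y => y) (fun x y => f (x, y)) y).
- apply continuous_const.
- apply continuous_id.
- apply continuous_ext with f; [|exact H]. now intros [? ?].
Qed.

Lemma cont_on_sides_all (f : C -> C) (a b c d : R) :
  (forall z, Ccont f z) -> cont_on_sides f a b c d.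
Proof. intros H z _. apply H. Qed.

Lemma sides_RC (f : C -> C) (a b c d : R) :
  cont_on_sides f a b c d ->
  (forall x, a <= x <= b -> RCcont (fun x => f (x, c)) x) /\
  (forall x, a <= x <= b -> RCcont (fun x => f (x, d)) x) /\
  (forall y, c <= y <= d -> RCcont (fun y => f (a, y)) y) /\
  (forall y, c <= y <= d -> RCcont (fun y => f (b, y)) y).
Proof.
intros H. repeat split; intros t Ht;
  [apply cont_h|apply cont_h|apply cont_v|apply cont_v]; apply H; unfold on_sides; simpl; tauto.
Qed.

Lemma bint_plus (f g : C -> C) (a b c d : R) :
  a <= b -> c <= d -> cont_on_sides f a b c d -> cont_on_sides g a b c d ->
  bint (fun z => f z + g z) a b c d = bint f a b c d + bint g a b c d.
Proof.
intros Hab Hcd Hf Hg. apply sides_RC in Hf, Hg.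
destruct Hf as (F1 & F2 & F3 & F4), Hg as (G1 & G2 & G3 & G4). unfold bint.
rewrite (CInt_plus (fun x => f (x, c)) (fun x => g (x, c))), (CInt_plus (fun x => f (x,
  d)) (fun x => g (x, d))),
  (CInt_plus (fun y => f (a, y)) (fun y => g (a, y))), (CInt_plus (fun y => f (b,
    y)) (fun y => g (b, y))) by assumption.
ring.
Qed.

Lemma bint_scal (k : C) (f : C -> C) (a b c d : R) :
  a <= b -> c <= d -> cont_on_sides f a b c d ->
  bint (fun z => k * f z) a b c d = k * bint f a b c d.
Proof.
intros Hab Hcd Hf. apply sides_RC in Hf. destruct Hf as (F1 & F2 & F3 & F4). unfold bint.
rewrite (CInt_scal k (fun x => f (x, c))), (CInt_scal k (fun x => f (x, d))),
  (CInt_scal k (fun y => f (a, y))), (CInt_scal k (fun y => f (b, y))) by assumption.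
ring.
Qed.

Lemma bint_ext (f g : C -> C) (a b c d : R) :
  a <= b -> c <= d -> (forall z, on_sides a b c d z -> f z = g z) ->
  bint f a b c d = bint g a b c d.
Proof.
intros Hab Hcd H. unfold bint.
rewrite (CInt_ext (fun x => f (x, c)) (fun x => g (x, c))), (CInt_ext (fun x => f (x,
  d)) (fun x => g (x, d))),
  (CInt_ext (fun y => f (a, y)) (fun y => g (a, y))), (CInt_ext (fun y => f (b,
    y)) (fun y => g (b, y)));
  auto; intros t Ht; apply H; unfold on_sides; simpl; tauto.
Qed.

Lemma bint_split_x (f : C -> C) (a m b c d : R) :
  (forall z, Ccont f z) -> a <= m <= b -> bint f a b c d = bint f a m c d + bint f m b c d.
Proof.
intros Hf Hm. unfold bint.
rewrite (CInt_Chasles (fun x => f (x, c)) a m b), (CInt_Chasles (fun x => f (x, d)) a m b); auto;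
  try (intros; now apply cont_h). ring.
Qed.

Lemma bint_split_y (f : C -> C) (a b c m d : R) :
  (forall z, Ccont f z) -> c <= m <= d -> bint f a b c d = bint f a b c m + bint f a b m d.
Proof.
intros Hf Hm. unfold bint.
rewrite (CInt_Chasles (fun y => f (b, y)) c m d), (CInt_Chasles (fun y => f (a, y)) c m d); auto;
  try (intros; now apply cont_v). ring.
Qed.

Lemma bint_bound (f : C -> C) (a b c d M : R) :
  a <= b -> c <= d -> (forall z, Ccont f z) ->
  (forall x y, a <= x <= b -> c <= y <= d -> Cmod (f (x, y)) <= M) ->
  Cmod (bint f a b c d) <= 2 * ((b - a) + (d - c)) * M.
Proof.
intros Hab Hcd Hf HM. unfold bint.
assert (H1 := CInt_bound (fun x => f (x, c)) a b M Hab ltac:(intros;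
  now apply cont_h) ltac:(intros; apply HM; lra)).
assert (H2 := CInt_bound (fun x => f (x, d)) a b M Hab ltac:(intros;
  now apply cont_h) ltac:(intros; apply HM; lra)).
assert (H3 := CInt_bound (fun y => f (b, y)) c d M Hcd ltac:(intros;
  now apply cont_v) ltac:(intros; apply HM; lra)).
assert (H4 := CInt_bound (fun y => f (a, y)) c d M Hcd ltac:(intros;
  now apply cont_v) ltac:(intros; apply HM; lra)).
eapply Rle_trans; [apply Cmod_triangle|].
rewrite Cmod_mult. replace (Cmod Ci) with 1%R.
2:{ unfold Cmod, Ci. simpl. replace (0 * (0 * 1) + 1 * (1 * 1))%R with 1%R by ring.
now rewrite sqrt_1. }
assert (G1 := Cmod_triangle (CInt (fun x => f (x, c)) a b) (- CInt (fun x => f (x, d)) a b)).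
assert (G2 := Cmod_triangle (CInt (fun y => f (b, y)) c d) (- CInt (fun y => f (a, y)) c d)).
rewrite Cmod_opp in G1, G2. unfold Cminus. lra.
Qed.

Lemma C_xy (x y : R) : ((x, y) : C) = RtoC x + RtoC y * Ci.
Proof. unfold Cplus, Cmult, RtoC, Ci; simpl. f_equal; ring. Qed.

Lemma Cmod_Ci : Cmod Ci = 1%R.
Proof.
unfold Cmod, Ci. simpl. replace (0 * (0 * 1) + 1 * (1 * 1))%R with 1%R by ring. apply sqrt_1.
Qed.

Lemma cder_h (f : C -> C) (x y : R) (l : C) : cder f (x, y) l ->
  is_derive (K := R_AbsRing) (V := C_R_NormedModule) (fun x => f (x, y)) x l.
Proof.
intros H. apply (is_derive_ext (V := C_R_NormedModule) (fun t => f (RtoC y * Ci + RtoC t * 1))).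
- intros t. transitivity (f (RtoC t + RtoC y * Ci)); [f_equal; ring|]. now rewrite <- C_xy.
- replace l with (l * 1) by ring. apply cder_line.
  replace (y * Ci + x * 1) with (RtoC x + RtoC y * Ci) by ring. now rewrite <- C_xy.
Qed.

Lemma cder_v (f : C -> C) (x y : R) (l : C) : cder f (x, y) l ->
  is_derive (K := R_AbsRing) (V := C_R_NormedModule) (fun y => f (x, y)) y (Ci * l).
Proof.
intros H. apply (is_derive_ext (V := C_R_NormedModule) (fun t => f (RtoC x + RtoC t * Ci))).
- intros t. now rewrite <- C_xy.
- replace (Ci * l) with (l * Ci) by ring. apply cder_line. now rewrite <- C_xy.
Qed.

Lemma bint_prim (K f : C -> C) (a b c d : R) :
  a <= b -> c <= d -> (forall z, Ccont f z) -> (forall z, cder K z (f z)) ->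
  bint f a b c d = 0.
Proof.
intros Hab Hcd Hf HK.
assert (Hh : forall y, CInt (fun x => f (x, y)) a b = K (b, y) - K (a, y)).
{ intros y. apply (CInt_prim (fun x => K (x, y))); auto.
  - intros; now apply cont_h.
  - intros t _. apply (cder_h K), HK. }
assert (Hv : forall x, CInt (fun y => Ci * f (x, y)) c d = K (x, d) - K (x, c)).
{ intros x. apply (CInt_prim (fun y => K (x, y))); auto.
  - intros; apply continuous_Cmult; [apply continuous_Cconst|now apply cont_v].
  - intros t _. apply (cder_v K), HK. }
unfold bint. rewrite !Hh.
assert (E : forall x, Ci * CInt (fun y => f (x, y)) c d = K (x, d) - K (x, c)).
{ intros x. rewrite <- Hv. symmetry. apply CInt_scal; auto. intros; now apply cont_v. }
transitivity (K (b, c) - K (a, c) - (K (b, d) - K (a, d)) +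
  (Ci * CInt (fun y => f (b, y)) c d - Ci * CInt (fun y => f (a, y)) c d)); [ring|].
rewrite !E. ring.
Qed.

Lemma Cmod_le_Rabs_plus (z : C) : Cmod z <= Rabs (fst z) + Rabs (snd z).
Proof.
destruct z as [x y]. rewrite C_xy at 1.
eapply Rle_trans; [apply Cmod_triangle|]. rewrite Cmod_mult, !Cmod_R, Cmod_Ci. simpl. lra.
Qed.

Lemma goursat (f : C -> C) (a b c d : R) :
  a <= b -> c <= d -> (forall z, Ccont f z) ->
  (forall x y, a <= x <= b -> c <= y <= d -> exists l, cder f (x, y) l) ->
  bint f a b c d = 0.
Proof.
intros Hab Hcd Hf Hd.
(* The bound is quadratic in the half-perimeter, which halves in each quarter, so the bounds of the
   four quarters add up to that of the whole. On a small rectangle the affine part of [f] has a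
   primitive and integrates to 0, and the rest is at most [eps / 2] times the half-perimeter. *)
assert (Heps : forall eps, 0 < eps ->
  Cmod (bint f a b c d) <= eps * ((b - a) + (d - c)) * ((b - a) + (d - c))).
{ intros eps He.
  apply (rectangle_bisection (fun a b c d => a <= b -> c <= d ->
    Cmod (bint f a b c d) <= eps * ((b - a) + (d - c)) * ((b - a) + (d - c)))%R a b c d); auto.
  - clear - Hf He. intros a b c d Hab Hcd H1 H2 H3 H4 _ _.
    set (m := ((a + b) / 2)%R) in *. set (n := ((c + d) / 2)%R) in *.
    assert (Hm : a <= m <= b) by (unfold m; lra). assert (Hn : c <= n <= d) by (unfold n; lra).
    specialize (H1 ltac:(lra) ltac:(lra)). specialize (H2 ltac:(lra) ltac:(lra)).
    specialize (H3 ltac:(lra) ltac:(lra)). specialize (H4 ltac:(lra) ltac:(lra)).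
    rewrite (bint_split_x f a m b c d Hf Hm), (bint_split_y f a m c n d Hf Hn),
      (bint_split_y f m b c n d Hf Hn).
    assert (T1 := Cmod_triangle (bint f a m c n + bint f a m n d) (bint f m b c n + bint f m b n d)).
    assert (T2 := Cmod_triangle (bint f a m c n) (bint f a m n d)).
    assert (T3 := Cmod_triangle (bint f m b c n) (bint f m b n d)).
    replace (m - a)%R with ((b - a) / 2)%R in * by (unfold m; lra).
    replace (b - m)%R with ((b - a) / 2)%R in * by (unfold m; lra).
    replace (n - c)%R with ((d - c) / 2)%R in * by (unfold n; lra).
    replace (d - n)%R with ((d - c) / 2)%R in * by (unfold n; lra).
    lra.
  - intros x y Hx Hy. destruct (Hd x y Hx Hy) as [l Hl].
    rewrite cder_eps in Hl. destruct (Hl (eps / 2)%R) as [e [He' H]]; [lra|].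
    exists (e / 2)%R. split; [lra|]. intros a' b' c' d' Hx' Hy' H1 H2 Hab' Hcd'.
    set (u := (x, y) : C) in *.
    assert (Hlin : forall z, Ccont (fun z => f u + (z - u) * l) z).
    { intros z. eapply cder_continuous.
      apply cder_plus; [apply cder_const|]. apply cder_mult; [|apply cder_const].
      apply cder_minus; [apply cder_id|apply cder_const]. }
    assert (Hg : forall z, Ccont (fun z => f z + (-1) * (f u + (z - u) * l)) z).
    { intros z. apply continuous_Cplus; [apply Hf|].
      apply continuous_Cmult; [apply continuous_Cconst|apply Hlin]. }
    rewrite (bint_ext f (fun z => (f z + (-1) * (f u + (z - u) * l)) + (f u + (z - u) * l))); auto;
      [|intros; ring].
    rewrite bint_plus; auto using cont_on_sides_all.
    rewrite (bint_prim (fun z => f u * z + (z - u) * (z - u) * (l / 2)) (fun z => f u + (z - u) * l)); auto.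
    2:{ intros z. eapply cder_eq.
      - cder_auto.
      - field. }
    rewrite Cplus_0_r.
    eapply Rle_trans; [apply (bint_bound _ _ _ _ _ (eps / 2 * ((b' - a') + (d' - c')))%R); auto|].
    + intros x' y' Hx'' Hy''.
      assert (Hd' : Cmod ((x', y') - u) <= (b' - a') + (d' - c')).
      { eapply Rle_trans; [apply Cmod_le_Rabs_plus|]. simpl.
        apply Rplus_le_compat; apply Rabs_le; lra. }
      replace (f (x', y') + -1 * (f u + ((x', y') - u) * l)) with (f (x', y') - f u - ((x',
        y') - u) * l) by ring.
      eapply Rle_trans; [apply H; lra|]. apply Rmult_le_compat_l; [lra|exact Hd'].
    + lra. }
set (S := ((b - a) + (d - c))%R) in *. assert (0 <= S) by (unfold S; lra).
destruct (Req_dec (Cmod (bint f a b c d)) 0) as [E|E]; [now apply Cmod_eq_0|exfalso].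
assert (HI := Cmod_ge_0 (bint f a b c d)). set (I := Cmod (bint f a b c d)) in *.
assert (0 < S * S + 1)%R by nra.
(* With this [eps] the bound reads [I <= I - I / (S^2 + 1)]; the added 1 keeps the divisor positive
   for a degenerate rectangle. *)
specialize (Heps (I / (S * S + 1))%R ltac:(apply Rdiv_lt_0_compat; lra)).
replace (I / (S * S + 1) * S * S)%R with (I - I / (S * S + 1))%R in Heps by (field; lra).
assert (0 < I / (S * S + 1))%R by (apply Rdiv_lt_0_compat; lra). lra.
Qed.


(** * Cauchy's formula and the derivative of an entire function *)

Lemma rectangle_bounded (f : C -> C) (a b c d : R) :
  a <= b -> c <= d -> (forall z, Ccont f z) ->
  exists M, 0 < M /\ forall x y, a <= x <= b -> c <= y <= d -> Cmod (f (x, y)) <= M.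
Proof.
intros Hab Hcd Hf.
apply (rectangle_bisection (fun a b c d => exists M, 0 < M /\ forall x y, a <= x <= b ->
  c <= y <= d ->
  Cmod (f (x, y)) <= M)); auto.
- clear. intros a b c d Hab Hcd [M1 [P1 H1]] [M2 [P2 H2]] [M3 [P3 H3]] [M4 [P4 H4]].
  exists (M1 + M2 + M3 + M4)%R. split; [lra|]. intros x y Hx Hy.
  destruct (Rle_dec x ((a + b) / 2)); destruct (Rle_dec y ((c + d) / 2)).
  + specialize (H1 x y). lra.
  + specialize (H3 x y). lra.
  + specialize (H2 x y). lra.
  + specialize (H4 x y). lra.
- intros x y Hx Hy. assert (H := Hf (x, y)). rewrite continuous_C_eps in H.
  specialize (H 1%R ltac:(lra)). apply locally_C_eps in H. destruct H as [e [He H]].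
  exists (e / 2)%R. split; [lra|]. intros a' b' c' d' Hx' Hy' H1 H2.
  exists (Cmod (f (x, y)) + 1)%R. assert (H0 := Cmod_ge_0 (f (x, y))). split; [lra|].
  intros x' y' Hx'' Hy''. specialize (H (x', y')).
  assert (H3 := Cmod_triangle_inv (f (x', y')) (f (x, y))).
  cut (Cmod (f (x', y') - f (x, y)) < 1)%R; [lra|]. apply H.
  eapply Rle_lt_trans; [apply Cmod_le_Rabs_plus|]. simpl.
  assert (Rabs (x' + - x) < e / 2)%R by (apply Rabs_def1; lra).
  assert (Rabs (y' + - y) < e / 2)%R by (apply Rabs_def1; lra). lra.
Qed.

(** A square of side [2 e] is cut out around the exceptional point. The four surrounding rectangles
    avoid the point and contribute 0; the square contributes at most its perimeter [8 e] times a
    bound of [g], which tends to 0 with [e]. *)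
Lemma goursat_removable (g : C -> C) (a b c d px py : R) :
  a < px < b -> c < py < d -> (forall z, Ccont g z) ->
  (forall z, z <> (px, py) -> exists l, cder g z l) ->
  bint g a b c d = 0.
Proof.
intros Hx Hy Hg Hd.
destruct (rectangle_bounded g a b c d) as [M [HM Hb]]; [lra|lra|auto|].
assert (H : forall e, 0 < e -> e < px - a -> e < b - px -> e < py - c -> e < d - py ->
  Cmod (bint g a b c d) <= 8 * e * M).
{ intros e He H1 H2 H3 H4.
  rewrite (bint_split_x g a (px - e) b c d), (bint_split_x g (px - e) (px + e) b c d); auto;
    try lra.
  rewrite (bint_split_y g (px - e) (px + e) c (py - e) d),
    (bint_split_y g (px - e) (px + e) (py - e) (py + e) d); auto; try lra.
  assert (Hgo : forall a b c d, a <= b -> c <= d -> (forall x y, a <= x <= b -> c <= y <= d ->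
    ((x, y) : C) <> (px, py)) ->
    bint g a b c d = 0).
  { intros a' b' c' d' Hab Hcd Hn. apply goursat; auto. }
  rewrite (Hgo a (px - e)%R c d), (Hgo (px + e)%R b c d), (Hgo (px - e)%R (px + e)%R c (py - e)%R),
    (Hgo (px - e)%R (px + e)%R (py + e)%R d); try lra; try (intros x y Hx' Hy' E; injection E; lra).
  replace (0 + (0 + (bint g (px - e) (px + e) (py - e) (py + e) + 0) + 0)) with (bint g (px - e) (px + e) (py - e) (py + e)) by ring.
  eapply Rle_trans; [apply (bint_bound g _ _ _ _ M); try lra; auto|].
  - intros x y Hx' Hy'. apply Hb; lra.
  - apply Req_le. ring. }
destruct (Req_dec (Cmod (bint g a b c d)) 0) as [E|E]; [now apply Cmod_eq_0|exfalso].
assert (HI := Cmod_ge_0 (bint g a b c d)). set (I := Cmod (bint g a b c d)) in *.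
set (m := Rmin (Rmin (px - a) (b - px)) (Rmin (py - c) (d - py))).
assert (Hm : 0 < m /\ m <= px - a /\ m <= b - px /\ m <= py - c /\ m <= d - py).
{ unfold m. assert (A1 := Rmin_l (Rmin (px - a) (b - px)) (Rmin (py - c) (d - py))).
  assert (A2 := Rmin_r (Rmin (px - a) (b - px)) (Rmin (py - c) (d - py))).
  assert (A3 := Rmin_l (px - a) (b - px)). assert (A4 := Rmin_r (px - a) (b - px)).
  assert (A5 := Rmin_l (py - c) (d - py)). assert (A6 := Rmin_r (py - c) (d - py)).
  split; [|lra]. repeat apply Rmin_glb_lt; lra. }
set (e := Rmin (m / 2) (I / (16 * M))).
assert (He : 0 < e). { apply Rmin_glb_lt; [lra|]. apply Rdiv_lt_0_compat; lra. }
assert (He1 : e <= m / 2) by apply Rmin_l. assert (He2 : e <= I / (16 * M)) by apply Rmin_r.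
specialize (H e He ltac:(lra) ltac:(lra) ltac:(lra) ltac:(lra)).
assert (8 * e * M <= I / 2)%R.
{ replace (I / 2)%R with (8 * (I / (16 * M)) * M)%R by (field; lra).
  apply Rmult_le_compat_r; lra. }
lra.
Qed.

(** Differentiation under the integral sign. The remainder bound, quadratic and uniform in [t], can
    be integrated directly, so no convergence theorem is called for. *)
Lemma CInt_param (k : R -> C -> C) (k' : R -> C) (a b : R) (z : C) (r M : R) :
  a <= b -> 0 < r -> 0 < M ->
  (forall y, Cmod (y - z) < r -> forall t, a <= t <= b -> RCcont (fun t => k t y) t) ->
  (forall t, a <= t <= b -> RCcont k' t) ->
  (forall t y, a <= t <= b -> Cmod (y - z) < r ->
    Cmod (k t y - k t z - (y - z) * k' t) <= M * (Cmod (y - z) * Cmod (y - z))) ->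
  cder (fun y => CInt (fun t => k t y) a b) z (CInt k' a b).
Proof.
intros Hab Hr HM Hk Hk' Hest. apply cder_eps. intros eps He.
assert (Hz : Cmod (z - z) < r) by (replace (z - z) with (RtoC 0) by ring; rewrite Cmod_0; lra).
set (K := ((b - a) * M + 1)%R). assert (HK : 0 < K) by (unfold K; nra).
exists (Rmin r (eps / K)). split. { apply Rmin_glb_lt; [lra|]. apply Rdiv_lt_0_compat; lra. }
intros y Hy. assert (H1 := Rlt_le_trans _ _ _ Hy (Rmin_l _ _)).
assert (H2 := Rlt_le_trans _ _ _ Hy (Rmin_r _ _)).
assert (Hc : forall t, a <= t <= b -> RCcont (fun t => -1 * k t z + -(y - z) * k' t) t).
{ intros t Ht. apply continuous_Cplus; apply continuous_Cmult;
  [apply continuous_Cconst|apply Hk|apply continuous_Cconst|apply Hk']; auto. }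
replace (CInt (fun t => k t y) a b - CInt (fun t => k t z) a b - (y - z) * CInt k' a b) with
  (CInt (fun t => k t y) a b + (-1 * CInt (fun t => k t z) a b + -(y - z) * CInt k' a b)) by ring.
rewrite <- !CInt_scal by auto.
rewrite <- CInt_plus; auto.
2:{ intros; apply continuous_Cmult; [apply continuous_Cconst|apply Hk]; auto. }
2:{ intros; apply continuous_Cmult; [apply continuous_Cconst|apply Hk']; auto. }
rewrite <- CInt_plus; auto.
eapply Rle_trans; [apply (CInt_bound _ a b (M * (Cmod (y - z) * Cmod (y - z))))|]; auto.
- intros t Ht. apply continuous_Cplus; auto.
- intros t Ht. eapply Rle_trans; [|apply (Hest t y Ht H1)]. apply Req_le. f_equal. ring.
- set (u := Cmod (y - z)) in *. assert (0 <= u) by apply Cmod_ge_0.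
  replace ((b - a) * (M * (u * u)))%R with ((b - a) * M * u * u)%R by ring.
  apply Rmult_le_compat_r; [lra|].
  assert (K * u <= eps)%R.
  { apply Rmult_le_reg_r with (/ K)%R; [now apply Rinv_0_lt_compat|].
    replace (K * u * / K)%R with u by (field; lra). apply Rlt_le, H2. }
  unfold K in *. nra.
Qed.

Lemma bint_param (k : C -> C -> C) (k' : C -> C) (a b c d : R) (z : C) (r M : R) :
  a <= b -> c <= d -> 0 < r -> 0 < M ->
  (forall y, Cmod (y - z) < r -> cont_on_sides (fun u => k u y) a b c d) ->
  cont_on_sides k' a b c d ->
  (forall u y, on_sides a b c d u -> Cmod (y - z) < r ->
    Cmod (k u y - k u z - (y - z) * k' u) <= M * (Cmod (y - z) * Cmod (y - z))) ->
  cder (fun y => bint (fun u => k u y) a b c d) z (bint k' a b c d).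
Proof.
intros Hab Hcd Hr HM Hk Hk' Hest.
assert (S1 := fun y Hy => sides_RC _ _ _ _ _ (Hk y Hy)). assert (S2 := sides_RC _ _ _ _ _ Hk').
destruct S2 as (S2 & S3 & S4 & S5).
unfold bint. eapply cder_eq.
- apply cder_plus; [apply cder_minus|apply cder_mult; [apply cder_const|apply cder_minus]].
  + apply (CInt_param (fun t y => k (t, c) y) (fun t => k' (t, c)) a b z r M); auto.
    * intros y Hy; apply (S1 y Hy).
    * intros t y Ht Hy; apply Hest; auto; unfold on_sides; simpl; tauto.
  + apply (CInt_param (fun t y => k (t, d) y) (fun t => k' (t, d)) a b z r M); auto.
    * intros y Hy; apply (S1 y Hy).
    * intros t y Ht Hy; apply Hest; auto; unfold on_sides; simpl; tauto.
  + apply (CInt_param (fun t y => k (b, t) y) (fun t => k' (b, t)) c d z r M); auto.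
    * intros y Hy; apply (S1 y Hy).
    * intros t y Ht Hy; apply Hest; auto; unfold on_sides; simpl; tauto.
  + apply (CInt_param (fun t y => k (a, t) y) (fun t => k' (a, t)) c d z r M); auto.
    * intros y Hy; apply (S1 y Hy).
    * intros t y Ht Hy; apply Hest; auto; unfold on_sides; simpl; tauto.
- unfold bint. ring.
Qed.

Definition unit_square (f : C -> C) (z : C) : C :=
  bint f (fst z - 1) (fst z + 1) (snd z - 1) (snd z + 1).

Definition on_unit_square (z u : C) : Prop :=
  on_sides (fst z - 1) (fst z + 1) (snd z - 1) (snd z + 1) u.

Lemma on_unit_square_dist (z u : C) : on_unit_square z u -> 1 <= Cmod (u - z).
Proof.
intros H. assert (H1 := Rmax_Cmod (u - z)).
assert (H2 := Rmax_l (Rabs (fst (u - z)%C)) (Rabs (snd (u - z)%C))).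
assert (H3 := Rmax_r (Rabs (fst (u - z)%C)) (Rabs (snd (u - z)%C))).
assert (H4 := Rle_abs (fst (u - z)%C)). assert (H5 := Rle_abs (snd (u - z)%C)).
assert (H6 := Rle_abs (- fst (u - z)%C)). assert (H7 := Rle_abs (- snd (u - z)%C)).
rewrite Rabs_Ropp in H6, H7. destruct z as [x y], u as [x' y'].
unfold on_unit_square, on_sides in H. simpl in *. lra.
Qed.

(** The sides are at distance at least 1 from the centre [z0], hence at least 1/2 from [z] and 1/4
    from [y]. The inverses 2 and 4 are the bounds of the kernels below. *)
Lemma sides_far (z0 z y u : C) : on_unit_square z0 u -> Cmod (z - z0) < / 2 ->
  Cmod (y - z) < / 4 -> / 2 <= Cmod (u - z) /\ / 4 <= Cmod (u - y) /\ u - z <> 0 /\ u - y <> 0.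
Proof.
intros Hu Hz Hy. assert (H := on_unit_square_dist z0 u Hu).
assert (H1 := Cmod_triangle_inv (u - z0) (z - z0)).
replace (u - z0 - (z - z0)) with (u - z) in H1 by ring.
assert (H2 := Cmod_triangle_inv (u - z) (y - z)).
replace (u - z - (y - z)) with (u - y) in H2 by ring.
repeat split; try lra; intros E; rewrite E, Cmod_0 in *; lra.
Qed.

Lemma Cmod_inv_le (z : C) (r : R) : 0 < r -> r <= Cmod z -> Cmod (/ z) <= / r.
Proof.
intros Hr Hz. rewrite Cmod_inv by (intros ->; rewrite Cmod_0 in Hz; lra).
apply Rinv_le_contravar; lra.
Qed.

(** The factor [1 / (2 pi i)] is left out: dividing by the transform of the constant 1 replaces it,
    and then only the non-vanishing of that transform matters. *)
Definition cauchy_transform (j : nat) (f : C -> C) (z0 z : C) : C :=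
  unit_square (fun u => f u * (/ (u - z)) ^ j) z0.

Lemma cont_kernel (j : nat) (f : C -> C) (z u : C) :
  Ccont f u -> u - z <> 0 -> Ccont (fun u => f u * (/ (u - z)) ^ j) u.
Proof.
intros Hf H. apply continuous_Cmult; [exact Hf|].
eapply cder_continuous. cder_auto. exact H.
Qed.

Lemma cauchy_transform_der (j : nat) (f : C -> C) (z0 z : C) :
  (j = 1 \/ j = 2)%nat -> (forall z, Ccont f z) -> Cmod (z - z0) < / 2 ->
  cder (cauchy_transform j f z0) z (INR j * cauchy_transform (S j) f z0 z).
Proof.
intros Hj Hf Hz.
destruct (rectangle_bounded f (fst z0 - 1) (fst z0 + 1) (snd z0 - 1) (snd z0 + 1)) as [M [HM Hb]]; [lra|lra|auto|].
assert (Hz0 : Cmod (z - z) < / 4) by (replace (z - z) with (RtoC 0) by ring; rewrite Cmod_0; lra).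
assert (HM' : forall u, on_unit_square z0 u -> Cmod (f u) <= M).
{ intros [x y] Hu. unfold on_unit_square, on_sides in Hu. simpl in Hu. apply Hb; lra. }
eapply cder_eq.
- apply (bint_param (fun u y => f u * (/ (u - y)) ^ j) (fun u => INR j * (f u * (/ (u - z)) ^ S j))
    (fst z0 - 1) (fst z0 + 1) (snd z0 - 1) (snd z0 + 1) z (/ 4) (M * 128)); try lra.
  + intros y Hy u Hu. apply cont_kernel; [apply Hf|]. apply (sides_far z0 z y u); auto.
  + intros u Hu. apply continuous_Cmult; [apply continuous_Cconst|].
    apply cont_kernel; [apply Hf|]. apply (sides_far z0 z z u); auto.
  + intros u y Hu Hy. destruct (sides_far z0 z y u Hu Hz Hy) as (H1 & H2 & H3 & H4).
    apply Cmod_inv_le in H1; [|lra]. apply Cmod_inv_le in H2; [|lra].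
    rewrite Rinv_inv in H1, H2.
    assert (HfM := HM' u Hu).
    (* With [A = 1 / (u - z)] and [B = 1 / (u - y)], of modulus at most 2 and 4, the Taylor
       remainder of the kernel is [(y - z)^2] times [A^2 B] for [j = 1] and [A^2 B (B + 2 A)] for
       [j = 2]. The bounds are 16 and 128. *)
    assert (E : exists q, f u * (/ (u - y)) ^ j - f u * (/ (u - z)) ^ j - (y - z) * (INR j * (f u * (/ (u - z)) ^ S j)) =
      f u * q * ((y - z) * (y - z)) /\ Cmod q <= 128).
    { set (A := / (u - z)) in *. set (B := / (u - y)) in *.
      assert (HA := Cmod_ge_0 A). assert (HB := Cmod_ge_0 B).
      destruct Hj as [-> | ->].
      - exists (A * A * B). split. { simpl. unfold A, B. field. auto. }
        rewrite !Cmod_mult. apply Rle_trans with (2 * 2 * 4)%R; [|lra].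
        repeat apply Rmult_le_compat; auto; try lra. apply Rmult_le_pos; auto.
      - exists (A * A * B * (B + 2 * A)). split. { unfold INR. rewrite RtoC_plus. simpl.
        unfold A, B. field. auto. }
        rewrite !Cmod_mult. apply Rle_trans with (2 * 2 * 4 * 8)%R; [|lra].
        assert (Cmod (B + 2 * A) <= 8).
        { eapply Rle_trans; [apply Cmod_triangle|].
          rewrite Cmod_mult, Cmod_R, Rabs_pos_eq by lra. lra. }
        assert (0 <= Cmod (B + 2 * A)) by apply Cmod_ge_0.
        repeat apply Rmult_le_compat; auto; try lra; repeat apply Rmult_le_pos; auto. }
    destruct E as [q [E Hq]]. rewrite E, !Cmod_mult.
    apply Rmult_le_compat_r; [apply Rmult_le_pos; apply Cmod_ge_0|].
    apply Rmult_le_compat; auto using Cmod_ge_0.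
- unfold cauchy_transform, unit_square. rewrite bint_scal; [reflexivity|lra|lra|].
  intros u Hu. apply cont_kernel; [apply Hf|]. apply (sides_far z0 z z u); auto.
Qed.

(** The difference quotient of [f] at [z], completed by the derivative, is continuous everywhere and
    differentiable off [z]. Its boundary integral therefore vanishes, and expanding it gives the
    formula. *)
Lemma cauchy_formula (f : C -> C) (z0 z : C) :
  (forall z, exists l, cder f z l) -> Cmod (z - z0) < / 2 ->
  cauchy_transform 1 f z0 z = f z * cauchy_transform 1 (fun _ => 1) z0 z.
Proof.
intros Hd Hz.
destruct (Hd z) as [l Hl].
assert (Hf : forall z, Ccont f z) by (intros u; destruct (Hd u) as [m Hm];
  now apply cder_continuous in Hm).
pose (g := fun u => if Ceq_dec u z then l else (f u - f z) / (u - z)).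
assert (Hne : forall u, u <> z ->
  locally (T := C_UniformSpace) u (fun v => (f v - f z) / (v - z) = g v)).
{ intros u Hu. apply locally_C_eps. exists (Cmod (u - z)).
  assert (u - z <> 0) by (now apply Cminus_eq_contra). split; [now apply Cmod_pos|].
  intros y Hy. unfold g. destruct (Ceq_dec y z) as [->|_]; [|reflexivity].
  rewrite Cmod_minus_sym in Hy. lra. }
assert (Hgd : forall u, u <> z -> exists m, cder g u m).
{ intros u Hu. destruct (Hd u) as [m Hm]. eexists. eapply cder_ext_loc; [apply (Hne u Hu)|].
  cder_auto; [exact Hm|now apply Cminus_eq_contra]. }
assert (Hgc : forall u, Ccont g u).
{ intros u. destruct (Ceq_dec u z) as [->|Hu].
  - apply continuous_C_eps. intros eps He. apply locally_C_eps.
    rewrite cder_eps in Hl. destruct (Hl (eps / 2)%R ltac:(lra)) as [d [Hd' H]].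
    exists d. split; [exact Hd'|]. intros y Hy. unfold g.
    destruct (Ceq_dec z z) as [_|n]; [|now destruct n].
    destruct (Ceq_dec y z) as [->|Hyz].
    + replace (l - l) with (RtoC 0) by ring. now rewrite Cmod_0.
    + assert (Hyz' : y - z <> 0) by (now apply Cminus_eq_contra).
      replace ((f y - f z) / (y - z) - l) with ((f y - f z - (y - z) * l) * / (y - z)) by (field;
        exact Hyz').
      rewrite Cmod_mult, Cmod_inv by exact Hyz'.
      assert (Hp := Cmod_pos _ Hyz'). specialize (H y Hy).
      apply Rmult_lt_reg_r with (Cmod (y - z)); [exact Hp|].
      rewrite Rmult_assoc, Rinv_l by lra. nra.
  - destruct (Hgd u Hu) as [m Hm]. now apply cder_continuous in Hm. }
assert (Hz2 := Rmax_Cmod (z - z0)).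
assert (Hx : Rabs (fst (z - z0)) < / 2) by (eapply Rle_lt_trans; [eapply Rle_trans;
  [apply Rmax_l|exact Hz2]|exact Hz]).
assert (Hy : Rabs (snd (z - z0)) < / 2) by (eapply Rle_lt_trans; [eapply Rle_trans;
  [apply Rmax_r|exact Hz2]|exact Hz]).
apply Rabs_def2 in Hx, Hy.
assert (H0 : unit_square g z0 = 0).
{ apply (goursat_removable g _ _ _ _ (fst z) (snd z)); auto.
  - destruct z, z0; simpl in *; lra.
  - destruct z, z0; simpl in *; lra.
  - intros u Hu. apply Hgd. intros ->. apply Hu. now destruct z. }
assert (Hz1 : Cmod (z - z) < / 4) by (replace (z - z) with (RtoC 0) by ring; rewrite Cmod_0; lra).
unfold unit_square in H0.
rewrite (bint_ext g (fun u => f u * (/ (u - z)) ^ 1 + (- f z) * (1 * (/ (u - z)) ^ 1))) in H0;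
  try lra.
2:{ intros u Hu. destruct (sides_far z0 z z u Hu Hz Hz1) as (_ & _ & H3 & _). unfold g.
  destruct (Ceq_dec u z) as [->|_]; [exfalso; apply H3; ring|]. simpl. field. exact H3. }
rewrite bint_plus, bint_scal in H0; try lra.
- unfold cauchy_transform, unit_square.
  set (P := bint (fun u => f u * (/ (u - z)) ^ 1) _ _ _ _) in *.
  set (Q := bint (fun u => 1 * (/ (u - z)) ^ 1) _ _ _ _) in *.
  transitivity (P + (- f z) * Q + f z * Q); [ring|]. rewrite H0. ring.
- intros u Hu. apply (cont_kernel 1 (fun _ => 1)); [apply continuous_Cconst|].
  apply (sides_far z0 z z u); auto.
- intros u Hu. apply (cont_kernel 1 f); [apply Hf|]. apply (sides_far z0 z z u); auto.
- intros u Hu. apply continuous_Cmult; [apply continuous_Cconst|].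
  apply (cont_kernel 1 (fun _ => 1)); [apply continuous_Cconst|]. apply (sides_far z0 z z u); auto.
Qed.

Lemma CInt_Im_ge (f : R -> C) (a b m : R) :
  a <= b -> (forall t, a <= t <= b -> RCcont f t) ->
  (forall t, a <= t <= b -> m <= snd (f t)) -> (b - a) * m <= snd (CInt f a b).
Proof.
intros Hab Hf Hm.
assert (H := CInt_correct f a b Hab Hf).
apply (is_RInt_fct_extend_snd (U := R_NormedModule) (V := R_NormedModule)) in H.
refine (is_RInt_le (fun _ => m) (fun t => snd (f t)) a b _ _ Hab _ H _).
- apply (is_RInt_const (V := R_NormedModule)).
- intros; apply Hm; lra.
Qed.

(** On each side the integrand, including the direction of [dz], has imaginary part [1 / (1 + t^2)],
    where [t] in [[-1, 1]] is measured from the midpoint. Each side of length 2 thus contributes at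
    least 1, and the imaginary part of the integral is at least 4 (its value is [2 pi]). *)
Lemma winding_nonzero (z0 : C) : cauchy_transform 1 (fun _ => 1) z0 z0 <> 0.
Proof.
set (k := fun u => 1 * (/ (u - z0)) ^ 1).
assert (Hz : Cmod (z0 - z0) < / 2) by (replace (z0 - z0) with (RtoC 0) by ring; rewrite Cmod_0;
  lra).
assert (Hz' : Cmod (z0 - z0) < / 4) by (replace (z0 - z0) with (RtoC 0) by ring; rewrite Cmod_0;
  lra).
assert (Hs : cont_on_sides k (fst z0 - 1) (fst z0 + 1) (snd z0 - 1) (snd z0 + 1)).
{ intros u Hu. apply (cont_kernel 1 (fun _ => 1)); [apply continuous_Cconst|].
  apply (sides_far z0 z0 z0 u); auto. }
apply sides_RC in Hs. destruct Hs as (S1 & S2 & S3 & S4).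
change (bint k (fst z0 - 1) (fst z0 + 1) (snd z0 - 1) (snd z0 + 1) <> 0).
destruct z0 as [x0 y0]. simpl fst in *. simpl snd in *.
replace (bint k (x0 - 1) (x0 + 1) (y0 - 1) (y0 + 1)) with
  (CInt (fun x => k (x, y0 - 1)%R) (x0 - 1) (x0 + 1) + CInt (fun x => -1 * k (x,
    y0 + 1)%R) (x0 - 1) (x0 + 1) +
   CInt (fun y => Ci * k (x0 + 1, y)%R) (y0 - 1) (y0 + 1) + CInt (fun y => - Ci * k (x0 - 1,
     y)%R) (y0 - 1) (y0 + 1)).
2:{ rewrite !CInt_scal by (assumption || lra). unfold bint. ring. }
assert (B1 := CInt_Im_ge (fun x => k (x, y0 - 1)%R) (x0 - 1) (x0 + 1) (/ 2) ltac:(lra) S1).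
assert (B2 := CInt_Im_ge (fun x => -1 * k (x, y0 + 1)%R) (x0 - 1) (x0 + 1) (/ 2) ltac:(lra)
  ltac:(intros; apply continuous_Cmult; [apply continuous_Cconst|now apply S2])).
assert (B3 := CInt_Im_ge (fun y => Ci * k (x0 + 1, y)%R) (y0 - 1) (y0 + 1) (/ 2) ltac:(lra)
  ltac:(intros; apply continuous_Cmult; [apply continuous_Cconst|now apply S4])).
assert (B4 := CInt_Im_ge (fun y => - Ci * k (x0 - 1, y)%R) (y0 - 1) (y0 + 1) (/ 2) ltac:(lra)
  ltac:(intros; apply continuous_Cmult; [apply continuous_Cconst|now apply S3])).
assert (Hhalf : forall t, -1 <= t <= 1 -> / 2 <= / (1 + t * t)).
{ intros t Ht. apply Rinv_le_contravar; nra. }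
assert (Hden : forall p q : R, (1 + (p - q) * (p - q) <> 0)%R).
{ intros p q E. assert (G := Rle_0_sqr (p - q)). unfold Rsqr in G. lra. }
assert (E1 : forall t, snd (k (t, y0 - 1)%R) = (/ (1 + (t - x0) * (t - x0)))%R).
{ intros t. unfold k. simpl. specialize (Hden t x0). field; repeat split; intros E; apply Hden;
  rewrite <- E; ring. }
assert (E2 : forall t, snd (-1 * k (t, y0 + 1)%R) = (/ (1 + (t - x0) * (t - x0)))%R).
{ intros t. unfold k. simpl. specialize (Hden t x0). field; repeat split; intros E; apply Hden;
  rewrite <- E; ring. }
assert (E3 : forall t, snd (Ci * k (x0 + 1, t)%R) = (/ (1 + (t - y0) * (t - y0)))%R).
{ intros t. unfold k. simpl. specialize (Hden t y0). field; repeat split; intros E; apply Hden;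
  rewrite <- E; ring. }
assert (E4 : forall t, snd (- Ci * k (x0 - 1, t)%R) = (/ (1 + (t - y0) * (t - y0)))%R).
{ intros t. unfold k. simpl. specialize (Hden t y0). field; repeat split; intros E; apply Hden;
  rewrite <- E; ring. }
specialize (B1 ltac:(intros t Ht; cbv beta; rewrite E1; apply Hhalf; lra)).
specialize (B2 ltac:(intros t Ht; cbv beta; rewrite E2; apply Hhalf; lra)).
specialize (B3 ltac:(intros t Ht; cbv beta; rewrite E3; apply Hhalf; lra)).
specialize (B4 ltac:(intros t Ht; cbv beta; rewrite E4; apply Hhalf; lra)).
revert B1 B2 B3 B4. generalize (CInt (fun x => k (x, y0 - 1)%R) (x0 - 1) (x0 + 1))
  (CInt (fun x => -1 * k (x, y0 + 1)%R) (x0 - 1) (x0 + 1))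
  (CInt (fun y => Ci * k (x0 + 1, y)%R) (y0 - 1) (y0 + 1))
  (CInt (fun y => - Ci * k (x0 - 1, y)%R) (y0 - 1) (y0 + 1)).
intros I1 I2 I3 I4 B1 B2 B3 B4 H. apply (f_equal snd) in H. simpl in H. lra.
Qed.

(** Near [z0], Cauchy's formula writes [f = T / W] with two Cauchy transforms that can be
    differentiated twice under the integral sign. The quotient rule expresses [f'] through functions
    differentiable at [z0]. *)
Lemma holomorphic_derivative (f f' : C -> C) :
  (forall z, cder f z (f' z)) -> forall z, exists l, cder f' z l.
Proof.
intros Hf z0.
set (T := cauchy_transform 1 f z0). set (W := cauchy_transform 1 (fun _ => 1) z0).
set (T' := fun z => INR 1 * cauchy_transform 2 f z0 z).
set (W' := fun z => INR 1 * cauchy_transform 2 (fun _ => 1) z0 z).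
assert (Hc : forall z, Ccont f z) by (intros u; eapply cder_continuous, Hf).
assert (Hc1 : forall z, Ccont (fun _ => RtoC 1) z) by (intros u; apply continuous_Cconst).
assert (HT : forall z, Cmod (z - z0) < / 2 -> cder T z (T' z)) by (intros z Hz;
  apply cauchy_transform_der; auto).
assert (HW : forall z, Cmod (z - z0) < / 2 -> cder W z (W' z)) by (intros z Hz;
  apply cauchy_transform_der; auto).
assert (Hz0 : Cmod (z0 - z0) < / 2) by (replace (z0 - z0) with (RtoC 0) by ring; rewrite Cmod_0;
  lra).
assert (HT2 : exists l, cder T' z0 l).
{ eexists. apply cder_mult; [apply cder_const|]. apply cauchy_transform_der; auto. }
assert (HW2 : exists l, cder W' z0 l).
{ eexists. apply cder_mult; [apply cder_const|]. apply cauchy_transform_der; auto. }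
assert (HW0 : W z0 <> 0) by apply winding_nonzero.
assert (Hnear : exists d, 0 < d /\ d <= / 2 /\ forall z, Cmod (z - z0) < d -> W z <> 0).
{ assert (H := cder_continuous _ _ _ (HW z0 Hz0)). rewrite continuous_C_eps in H.
  specialize (H (Cmod (W z0)) (Cmod_pos _ HW0)). apply locally_C_eps in H. destruct H as [d [Hd H]].
  exists (Rmin d (/ 2)). split; [apply Rmin_glb_lt; lra|]. split; [apply Rmin_r|].
  intros z Hz E. assert (Hz' := Rlt_le_trans _ _ _ Hz (Rmin_l _ _)). specialize (H z Hz').
  rewrite E in H. replace (0 - W z0) with (- W z0) in H by ring. rewrite Cmod_opp in H. lra. }
destruct Hnear as (d & Hd & Hd2 & HWn).
destruct HT2 as [l1 H1]. destruct HW2 as [l2 H2].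
eexists.
apply (cder_ext_loc (fun z => T' z * / W z + T z * (- W' z * / W z ^ 2))).
- apply locally_C_eps. exists d. split; [exact Hd|]. intros z Hz.
  apply (cder_unique f z); [|apply Hf].
  apply (cder_ext_loc (fun z => T z * / W z)).
  + apply locally_C_eps. exists (d - Cmod (z - z0))%R. split; [lra|]. intros y Hy.
    assert (Hy0 : Cmod (y - z0) < d).
    { replace (y - z0) with (y - z + (z - z0)) by ring. eapply Rle_lt_trans;
      [apply Cmod_triangle|]. lra. }
    unfold T, W. rewrite cauchy_formula; [|intros u; exists (f' u); apply Hf|lra].
    field. exact (HWn y Hy0).
  + apply (cder_mult T (fun z => / W z)); [apply HT; lra|].
    eapply cder_eq; [apply (cder_inv W); [apply HW; lra|exact (HWn z Hz)]|reflexivity].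
- assert (HTz := HT z0 Hz0). assert (HWz := HW z0 Hz0).
  clearbody T W T' W'.
  apply (cder_plus (fun z => T' z * / W z) (fun z => T z * (- W' z * / W z ^ 2))).
  + apply (cder_mult T' (fun z => / W z)); [exact H1|exact (cder_inv W _ _ HWz HW0)].
  + apply (cder_mult T (fun z => - W' z * / W z ^ 2)); [exact HTz|].
    apply (cder_mult (fun z => - W' z) (fun z => / W z ^ 2)); [exact (cder_opp W' _ _ H2)|].
    exact (cder_inv (fun z => W z ^ 2) _ _ (cder_pow W 2 _ _ HWz) (Cpow_nz _ 2 HW0)).
Qed.

(** * Entire functions, exponential and logarithm *)

Definition entire (f : C -> C) : Prop := forall z : C, exists l : C, cder f z l.

Lemma entire_cder (f : C -> C) : entire f -> forall z, cder f z (C_derive f z).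
Proof.
intros H z. destruct (H z) as [l Hl]. now rewrite (is_C_derive_unique f z l Hl).
Qed.

Lemma entire_derive (f : C -> C) : entire f -> entire (C_derive f).
Proof. intros H z. apply (holomorphic_derivative f). now apply entire_cder. Qed.

Lemma entire_continuous (f : C -> C) : entire f -> forall z, Ccont f z.
Proof. intros H z. destruct (H z) as [l Hl]. now apply cder_continuous in Hl. Qed.

Lemma mean_value_bound (f f' : C -> C) (p z : C) (M : R) :
  (forall z, cder f z (f' z)) -> (forall z, Ccont f' z) ->
  (forall t : R, 0 <= t <= 1 -> Cmod (f' (p + RtoC t * (z - p))) <= M) ->
  Cmod (f z - f p) <= M * Cmod (z - p).
Proof.
intros Hf Hc HM.
assert (Hcl : forall t, RCcont (fun t => f' (p + RtoC t * (z - p)) * (z - p)) t).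
{ intros t. apply continuous_Cmult; [|apply continuous_Cconst].
  apply (continuous_comp (U := R_UniformSpace) (V := C_UniformSpace) (W := C_UniformSpace)
    (fun t : R => p + RtoC t * (z - p)) f'); [|apply Hc].
  apply (ex_derive_continuous (V := C_R_NormedModule)).
  eexists. apply (cder_line (fun u => u) p (z - p) t). apply cder_id. }
assert (E : CInt (fun t => f' (p + RtoC t * (z - p)) * (z - p)) 0 1 =
  f (p + 1 * (z - p)) - f (p + 0 * (z - p))).
{ apply (CInt_prim (fun t => f (p + RtoC t * (z - p)))); [lra|auto|].
  intros t _. apply cder_line, Hf. }
replace (p + 1 * (z - p)) with z in E by ring. replace (p + 0 * (z - p)) with p in E by ring.
rewrite <- E.
eapply Rle_trans; [apply (CInt_bound _ 0 1 (M * Cmod (z - p))); [lra|auto|]|lra].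
intros t Ht. rewrite Cmod_mult. apply Rmult_le_compat_r; [apply Cmod_ge_0|auto].
Qed.

Lemma cder_zero_const (f : C -> C) : (forall z, cder f z 0) -> forall z w, f z = f w.
Proof.
intros H z w.
assert (E : Cmod (f z - f w) <= 0 * Cmod (z - w)).
{ apply mean_value_bound with (fun _ => RtoC 0); auto; [intros; apply continuous_Cconst|].
  intros. rewrite Cmod_0. lra. }
assert (Cmod (f z - f w) = 0%R) by (assert (G := Cmod_ge_0 (f z - f w)); lra).
apply Cmod_eq_0 in H0. replace (f z) with (f z - f w + f w) by ring. rewrite H0. ring.
Qed.

(** The only delicate point is differentiability of the quotient at [p], where its derivative has to
    be half of the second derivative of [f]; the existence of the latter is what Cauchy's formula
    supplied. *)
Lemma entire_division (f : C -> C) (p : C) :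
  entire f -> f p = 0 -> exists q, entire q /\ forall z, f z = (z - p) * q z.
Proof.
intros Hf Hp.
set (f' := C_derive f). assert (Hf' : forall z, cder f z (f' z)) by now apply entire_cder.
destruct (entire_derive f Hf p) as [m Hm]. fold f' in Hm.
assert (Hc : forall z, Ccont f' z) by now apply entire_continuous, entire_derive.
exists (fun z => if Ceq_dec z p then f' p else f z / (z - p)). split.
2:{ intros z. destruct (Ceq_dec z p) as [->|Hz]; [rewrite Hp; ring|].
  field. now apply Cminus_eq_contra. }
intros z. destruct (Ceq_dec z p) as [->|Hz].
- exists (m / 2). apply cder_eps. intros eps He.
  rewrite cder_eps in Hm. destruct (Hm eps He) as [d [Hd H]].
  exists d. split; [exact Hd|]. intros y Hy.
  destruct (Ceq_dec p p) as [_|n]; [|now destruct n].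
  destruct (Ceq_dec y p) as [->|Hyp].
  { replace (f' p - f' p - (p - p) * (m / 2)) with (RtoC 0) by ring. rewrite Cmod_0.
    apply Rmult_le_pos; [lra|apply Cmod_ge_0]. }
  assert (Hyp' : y - p <> 0) by now apply Cminus_eq_contra.
  (* [f] minus its second Taylor polynomial has derivative [o(u - p)], so by the mean value bound it
     is [o((y - p)^2)]; dividing by [y - p] gives the estimate wanted. *)
  assert (B : Cmod ((f y - f' p * (y - p) - (y - p) * (y - p) * (m / 2)) -
    (f p - f' p * (p - p) - (p - p) * (p - p) * (m / 2))) <= eps * Cmod (y - p) * Cmod (y - p)).
  { apply (mean_value_bound (fun u => f u - f' p * (u - p) - (u - p) * (u - p) * (m / 2))
      (fun u => f' u - f' p - (u - p) * m)).
    - intros u. eapply cder_eq; [cder_auto|]. field.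
    - intros u. apply (continuous_Cplus _ (fun u => f' u - f' p) (fun u => - ((u - p) * m))).
      + apply (continuous_Cplus _ f' (fun u => - f' p)); [apply Hc|apply continuous_Cconst].
      + eapply cder_continuous. cder_auto.
    - intros t Ht.
      assert (Cmod (p + t * (y - p) - p) <= Cmod (y - p)).
      { replace (p + t * (y - p) - p) with (t * (y - p)) by ring.
        rewrite Cmod_mult, Cmod_R, Rabs_pos_eq by lra. assert (G := Cmod_ge_0 (y - p)). nra. }
      eapply Rle_trans; [apply H; lra|]. apply Rmult_le_compat_l; lra. }
  rewrite Hp in B.
  replace (f y / (y - p) - f' p - (y - p) * (m / 2)) with
    ((f y - f' p * (y - p) - (y - p) * (y - p) * (m / 2) - (0 - f' p * (p - p) - (p - p) * (p - p) * (m / 2))) * / (y - p))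
    by (field; exact Hyp').
  assert (G := Cmod_pos _ Hyp').
  rewrite Cmod_mult, Cmod_inv by exact Hyp'.
  apply Rmult_le_reg_r with (Cmod (y - p)); [exact G|].
  rewrite Rmult_assoc, Rinv_l by lra. lra.
- assert (Hz' : z - p <> 0) by now apply Cminus_eq_contra.
  eexists. apply (cder_ext_loc (fun z => f z / (z - p))).
  + apply locally_C_eps. exists (Cmod (z - p)). split; [now apply Cmod_pos|].
    intros y Hy. destruct (Ceq_dec y p) as [->|_]; [|reflexivity].
    rewrite Cmod_minus_sym in Hy. lra.
  + cder_auto. exact Hz'.
Qed.

Definition Cexp (z : C) : C := (exp (fst z) * cos (snd z), exp (fst z) * sin (snd z))%R.

Lemma Cexp_plus (z w : C) : Cexp (z + w) = Cexp z * Cexp w.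
Proof.
unfold Cexp, Cmult; simpl. rewrite exp_plus, cos_plus, sin_plus. f_equal; ring.
Qed.

Lemma Cexp_0 : Cexp 0 = 1.
Proof. unfold Cexp, RtoC; simpl. rewrite exp_0, cos_0, sin_0. f_equal; ring. Qed.

Lemma Cexp_opp_r (z : C) : Cexp z * Cexp (- z) = 1.
Proof. rewrite <- Cexp_plus, Cplus_opp_r. apply Cexp_0. Qed.

Lemma Cexp_neq_0 (z : C) : Cexp z <> 0.
Proof.
intros H. assert (E := Cexp_opp_r z). rewrite H, Cmult_0_l in E.
apply (f_equal fst) in E. simpl in E. lra.
Qed.

Lemma Cexp_opp (z : C) : Cexp (- z) = / Cexp z.
Proof.
assert (E := Cexp_opp_r z). assert (H := Cexp_neq_0 z).
transitivity (Cexp z * Cexp (- z) * / Cexp z); [field; exact H|]. rewrite E. ring.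
Qed.

Lemma Cexp_pow (z : C) (n : nat) : Cexp z ^ n = Cexp (RtoC (INR n) * z).
Proof.
induction n.
- simpl. rewrite Cmult_0_l. symmetry. apply Cexp_0.
- rewrite S_INR, RtoC_plus, Cpow_S, IHn, <- Cexp_plus. f_equal. ring.
Qed.

Lemma R_derive_eps (f : R -> R) (x l : R) : derivable_pt_lim f x l ->
  forall eps, 0 < eps -> exists d, 0 < d /\ forall h, Rabs h < d ->
    (Rabs (f (x + h) - f x - h * l) <= eps * Rabs h)%R.
Proof.
intros H eps He. destruct (H eps He) as [d Hd]. exists d. split; [apply cond_pos|].
intros h Hh. destruct (Req_dec h 0) as [->|Hh0].
- replace (f (x + 0) - f x - 0 * l)%R with 0%R by (rewrite Rplus_0_r; ring). rewrite Rabs_R0. lra.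
- specialize (Hd h Hh0 Hh).
  replace (f (x + h) - f x - h * l)%R with (((f (x + h) - f x) / h - l) * h)%R by (field; auto).
  rewrite Rabs_mult. apply Rmult_le_compat_r; [apply Rabs_pos|lra].
Qed.

Lemma cder_Cexp_0 : cder Cexp 0 1.
Proof.
apply cder_eps. intros eps0 He0.
(* Real and imaginary parts split into four errors, of total at most [6 eps |z|]. The cap at 1
   serves the bounds [|exp x - 1| <= eps] and [|1 + x| <= 2]. *)
set (eps := (Rmin 1 eps0 / 8)%R).
assert (He : 0 < eps /\ eps <= 1 /\ 8 * eps <= eps0).
{ unfold eps. assert (A := Rmin_l 1 eps0). assert (B := Rmin_r 1 eps0).
  assert (0 < Rmin 1 eps0)%R by (apply Rmin_glb_lt; lra). lra. }
destruct He as (He & He1 & He2).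
destruct (R_derive_eps exp 0 1 derivable_pt_lim_exp_0 eps He) as (d1 & Hd1 & H1).
assert (Hs := derivable_pt_lim_sin 0). rewrite cos_0 in Hs.
assert (Hc := derivable_pt_lim_cos 0). rewrite sin_0 in Hc.
destruct (R_derive_eps _ _ _ Hs eps He) as (d2 & Hd2 & H2).
destruct (R_derive_eps _ _ _ Hc eps He) as (d3 & Hd3 & H3).
set (d := Rmin (Rmin d1 d2) (Rmin d3 (eps / 2))).
assert (Hd : 0 < d /\ d <= d1 /\ d <= d2 /\ d <= d3 /\ d <= eps / 2).
{ unfold d. assert (A1 := Rmin_l (Rmin d1 d2) (Rmin d3 (eps / 2))).
  assert (A2 := Rmin_r (Rmin d1 d2) (Rmin d3 (eps / 2))).
  assert (A3 := Rmin_l d1 d2). assert (A4 := Rmin_r d1 d2). assert (A5 := Rmin_l d3 (eps / 2)).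
  assert (A6 := Rmin_r d3 (eps / 2)).
  split; [repeat apply Rmin_glb_lt; lra|lra]. }
exists d. split; [lra|]. intros [x y] Hxy.
assert (E0 : forall u : C, u - 0 = u) by (intros; ring).
rewrite Cexp_0, E0 in *. clear E0.
assert (HM := Rmax_Cmod (x, y)). simpl in HM.
assert (Hx := Rle_trans _ _ _ (Rmax_l _ _) HM). assert (Hy := Rle_trans _ _ _ (Rmax_r _ _) HM).
set (r := Cmod (x, y)) in *.
specialize (H1 x ltac:(lra)). specialize (H2 y ltac:(lra)). specialize (H3 y ltac:(lra)).
rewrite Rplus_0_l in H1, H2, H3. rewrite exp_0 in H1. rewrite sin_0 in H2. rewrite cos_0 in H3.
assert (Ax := Rabs_pos x). assert (Ay := Rabs_pos y).
assert (B1 : Rabs (exp x - 1) <= eps).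
{ replace (exp x - 1)%R with ((exp x - 1 - x * 1) + x)%R by ring.
  eapply Rle_trans; [apply Rabs_triang|]. nra. }
assert (B2 : Rabs (sin y) <= 2 * Rabs y).
{ replace (sin y) with ((sin y - 0 - y * 1) + y)%R by ring.
  eapply Rle_trans; [apply Rabs_triang|]. nra. }
assert (B3 : Rabs (cos y) <= 1) by (apply Rabs_le; destruct (COS_bound y); lra).
assert (B4 : Rabs (1 + x) <= 2).
{ eapply Rle_trans; [apply Rabs_triang|]. rewrite Rabs_R1. lra. }
replace (Cexp (x, y) - 1 - (x, y) * 1) with
  (((exp x - 1 - x * 1) * cos y + (1 + x) * (cos y - 1 - y * - 0),
    (exp x - 1) * sin y + (sin y - 0 - y * 1))%R : C).
2:{ unfold Cexp; simpl. unfold Cminus, Cplus, Copp, Cmult, RtoC; simpl. f_equal; ring. }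
eapply Rle_trans; [apply Cmod_le_Rabs_plus|]. simpl.
assert (C1 := Rabs_triang ((exp x - 1 - x * 1) * cos y) ((1 + x) * (cos y - 1 - y * - 0))).
assert (C2 := Rabs_triang ((exp x - 1) * sin y) (sin y - 0 - y * 1)).
rewrite !Rabs_mult in C1. rewrite Rabs_mult in C2.
assert (D1 : Rabs (exp x - 1 - x * 1) * Rabs (cos y) <= eps * Rabs x * 1).
{ apply Rmult_le_compat; auto using Rabs_pos. }
assert (D2 : Rabs (1 + x) * Rabs (cos y - 1 - y * - 0) <= 2 * (eps * Rabs y)).
{ apply Rmult_le_compat; auto using Rabs_pos. }
assert (D3 : Rabs (exp x - 1) * Rabs (sin y) <= eps * (2 * Rabs y)).
{ apply Rmult_le_compat; auto using Rabs_pos. }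
assert (eps * Rabs x <= eps * r)%R by (apply Rmult_le_compat_l; lra).
assert (eps * Rabs y <= eps * r)%R by (apply Rmult_le_compat_l; lra).
assert (8 * eps * r <= eps0 * r)%R by (apply Rmult_le_compat_r; lra).
assert (0 <= eps * r)%R by (apply Rmult_le_pos; lra).
lra.
Qed.

Lemma cder_Cexp (z : C) : cder Cexp z (Cexp z).
Proof.
apply (cder_ext (fun w => Cexp z * Cexp (w - z))).
- intros w. rewrite <- Cexp_plus. f_equal. ring.
- eapply cder_eq.
  + apply (cder_mult (fun _ => Cexp z) (fun w => Cexp (w - z))); [apply cder_const|].
    apply (cder_comp Cexp (fun w => w - z)).
    * replace (z - z) with (RtoC 0) by ring. apply cder_Cexp_0.
    * cder_auto.
  + ring.
Qed.

(** The principal logarithm, correct on the right half-plane only, where the argument is the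
    arctangent of the slope. Other points are first rotated into this half-plane. *)
Definition Clog0 (z : C) : C := (ln (Cmod z), atan (snd z / fst z)).

Lemma Cexp_Clog0 (z : C) : 0 < fst z -> Cexp (Clog0 z) = z.
Proof.
destruct z as [x y]. simpl. intros Hx.
assert (Hm : 0 < Cmod (x, y)). { apply Cmod_pos. intros E. injection E. lra. }
unfold Cexp, Clog0; simpl. rewrite exp_ln by exact Hm. rewrite cos_atan, sin_atan.
assert (E : Cmod (x, y) = (x * sqrt (1 + Rsqr (y / x)))%R).
{ rewrite <- (sqrt_Rsqr x) at 2 by lra. rewrite <- sqrt_mult; [|apply Rle_0_sqr|].
  - unfold Cmod; simpl. f_equal. unfold Rsqr. field. lra.
  - assert (G := Rle_0_sqr (y / x)). lra. }
assert (Hs : 0 < sqrt (1 + Rsqr (y / x))). { apply sqrt_lt_R0. assert (G := Rle_0_sqr (y / x)).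
lra. }
rewrite E. f_equal; field; lra.
Qed.

Lemma continuous_Clog0 (z : C) : 0 < fst z -> Ccont Clog0 z.
Proof.
intros Hx.
assert (Hm : 0 < Cmod z). { apply Cmod_pos. intros E. subst z. simpl in Hx. lra. }
apply (continuous_comp_2 (U := C_UniformSpace) (V := R_UniformSpace) (W := R_UniformSpace) (X := C_UniformSpace)
  (fun z => ln (Cmod z)) (fun z => atan (snd z / fst z)) (fun a b => (a, b) : C)).
- apply (continuous_comp (U := C_UniformSpace) (V := R_UniformSpace) (W := R_UniformSpace) Cmod ln).
  + apply (filterlim_norm (K := C_AbsRing) (V := C_NormedModule)).
  + apply continuity_pt_filterlim, derivable_continuous_pt. eexists. now apply derivable_pt_lim_ln.
- apply (continuous_comp (U := C_UniformSpace) (V := R_UniformSpace) (W := R_UniformSpace) (fun z => snd z / fst z)%R atan).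
  + apply (continuous_mult (U := C_UniformSpace) (K := R_AbsRing) (fun z : C => snd z) (fun z : C => / fst z)%R).
    * apply (continuous_snd (U := R_UniformSpace) (V := R_UniformSpace)).
    * apply (continuous_comp (U := C_UniformSpace) (V := R_UniformSpace) (W := R_UniformSpace) fst Rinv).
      -- apply (continuous_fst (U := R_UniformSpace) (V := R_UniformSpace)).
      -- apply continuous_Rinv. lra.
  + apply continuity_pt_filterlim, derivable_continuous_pt. eexists. apply derivable_pt_lim_atan.
- apply continuous_ext with (fun u : C => u); [now intros [? ?]|]. apply continuous_id.
Qed.

Lemma cder_Clog0 (z : C) : 0 < fst z -> cder Clog0 z (/ z).
Proof.
intros Hx.
assert (Hz : z <> 0). { intros ->. simpl in Hx. lra. }
assert (Hm := Cmod_pos z Hz).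
apply cder_eps. intros eps He.
assert (Hexp := cder_Cexp_0). rewrite cder_eps in Hexp.
(* With [h = log y - log z] one has [y - z = z (exp h - 1)]. The bound 1/2 yields
   [|h| <= 2 |exp h - 1|], and the second bound compensates this 2 and the factor [|z|]. *)
set (e1 := Rmin (1 / 2) (eps * Cmod z / 2)).
assert (He1 : 0 < e1). { apply Rmin_glb_lt; [lra|]. apply Rdiv_lt_0_compat; [|lra]. nra. }
assert (He1a : e1 <= 1 / 2) by apply Rmin_l. assert (He1b : e1 <= eps * Cmod z / 2) by apply Rmin_r.
destruct (Hexp e1 He1) as (d & Hd & H).
assert (Hc := continuous_Clog0 z Hx). rewrite continuous_C_eps in Hc.
specialize (Hc d Hd). apply locally_C_eps in Hc. destruct Hc as (r & Hr & Hc).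
exists (Rmin r (fst z)). split; [now apply Rmin_glb_lt|]. intros y Hy.
assert (Hy1 := Rlt_le_trans _ _ _ Hy (Rmin_l _ _)).
assert (Hy2 := Rlt_le_trans _ _ _ Hy (Rmin_r _ _)).
assert (Hyx : 0 < fst y).
{ assert (G := Rle_trans _ _ _ (Rmax_l _ _) (Rmax_Cmod (y - z))). simpl in G.
  assert (G2 := Rle_lt_trans _ _ _ G Hy2). apply Rabs_def2 in G2. lra. }
set (h := Clog0 y - Clog0 z). specialize (Hc y Hy1). fold h in Hc.
specialize (H h). replace (h - 0) with h in H by ring. specialize (H Hc). rewrite Cexp_0 in H.
replace (h * 1) with h in H by ring.
assert (E : y - z = z * (Cexp h - 1)).
{ replace y with (Cexp (Clog0 z + h)) at 1.
  - rewrite Cexp_plus, (Cexp_Clog0 z Hx). ring.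
  - unfold h. replace (Clog0 z + (Clog0 y - Clog0 z)) with (Clog0 y) by ring.
    now apply Cexp_Clog0. }
assert (E2 : h - (y - z) * / z = - (Cexp h - 1 - h)). { rewrite E. field. exact Hz. }
rewrite E2, Cmod_opp.
assert (Hh : Cmod h <= 2 * Cmod (Cexp h - 1)).
{ assert (G := Cmod_triangle (Cexp h - 1) (- (Cexp h - 1 - h))). rewrite Cmod_opp in G.
  replace (Cexp h - 1 + - (Cexp h - 1 - h)) with h in G by ring.
  assert (G2 := Cmod_ge_0 h). nra. }
eapply Rle_trans; [exact H|]. rewrite E, Cmod_mult.
assert (G2 := Cmod_ge_0 h). assert (G3 := Cmod_ge_0 (Cexp h - 1)).
apply Rle_trans with (e1 * (2 * Cmod (Cexp h - 1)))%R; [apply Rmult_le_compat_l; lra|].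
replace (eps * (Cmod z * Cmod (Cexp h - 1)))%R with (eps * Cmod z / 2 * (2 * Cmod (Cexp h - 1)))%R by field.
apply Rmult_le_compat_r; lra.
Qed.

Lemma Cexp_surjective (z : C) : z <> 0 -> exists t, Cexp t = z.
Proof.
intros Hz.
assert (Hi : Cexp (0, PI / 2)%R = Ci). { unfold Cexp, Ci; simpl. rewrite exp_0, cos_PI2, sin_PI2.
f_equal; ring. }
assert (Hpi : Cexp (0, PI)%R = -1). { unfold Cexp; simpl. rewrite exp_0, cos_PI, sin_PI.
unfold RtoC. f_equal; ring. }
assert (Hi2 : Ci * Ci = -1). { unfold Ci, Cmult, RtoC; simpl. f_equal; ring. }
destruct (Rtotal_order (fst z) 0) as [H|[H|H]].
- exists (Clog0 (- z) + (0, PI)%R). rewrite Cexp_plus, Hpi, Cexp_Clog0; [ring|]. destruct z;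
  simpl in *; lra.
- destruct (Rtotal_order (snd z) 0) as [G|[G|G]].
  + exists (Clog0 (Ci * z) + (0, PI / 2)%R + (0, PI)%R).
    rewrite !Cexp_plus, Hpi, Hi, Cexp_Clog0; [|destruct z; simpl in *; lra].
    transitivity (Ci * Ci * (-1) * z); [ring|]. rewrite Hi2. ring.
  + exfalso. apply Hz. destruct z; simpl in *; subst. reflexivity.
  + exists (Clog0 (- Ci * z) + (0, PI / 2)%R).
    rewrite !Cexp_plus, Hi, Cexp_Clog0; [|destruct z; simpl in *; lra].
    transitivity (- (Ci * Ci) * z); [ring|]. rewrite Hi2. ring.
- exists (Clog0 z). now apply Cexp_Clog0.
Qed.

(** On the disc [|y - x| < |x|] the quotient [y / x] lies in the right half-plane, where the
    principal logarithm is holomorphic; a logarithm of [x] is added. *)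
Lemma local_log (x : C) : x <> 0 -> exists L : C -> C,
  holomorphic_at1 (V := C_NormedModule) L x /\
  locally (T := C_UniformSpace) x (fun y => Cexp (L y) = y).
Proof.
intros Hx. destruct (Cexp_surjective x Hx) as [t Ht].
exists (fun y => t + Clog0 (y / x)).
assert (Hm := Cmod_pos x Hx).
assert (Hpos : forall y, Cmod (y - x) < Cmod x -> 0 < fst (y / x)).
{ intros y Hy. assert (G : Cmod (y / x - 1) < 1).
  { replace (y / x - 1) with ((y - x) * / x) by (field; exact Hx).
    rewrite Cmod_mult, Cmod_inv by exact Hx. apply Rmult_lt_reg_r with (Cmod x); [exact Hm|].
    rewrite Rmult_assoc, Rinv_l by lra. lra. }
  assert (G1 := Rle_trans _ _ _ (Rmax_l _ _) (Rmax_Cmod (y / x - 1))).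
  assert (G2 := Rle_lt_trans _ _ _ G1 G). destruct (y / x) as [p q].
  simpl in G2 |- *. apply Rabs_def2 in G2. lra. }
split; apply locally_C_eps; exists (Cmod x); split; try exact Hm; intros y Hy.
- eexists. apply (cder_plus (fun _ => t) (fun y => Clog0 (y / x))); [apply cder_const|].
  apply (cder_comp Clog0 (fun y => y / x)); [apply cder_Clog0; auto|].
  apply (cder_mult (fun y => y) (fun _ => / x)); [apply cder_id|apply cder_const].
- rewrite Cexp_plus, Ht, Cexp_Clog0 by auto. field. exact Hx.
Qed.

(** * Normalizing the jet of the numerator at the pole *)

Lemma entire_const (c : C) : entire (fun _ => c).
Proof. intros z. eexists. apply cder_const. Qed.
Lemma entire_id : entire (fun z => z).
Proof. intros z. eexists. apply cder_id. Qed.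
Lemma entire_plus (f g : C -> C) : entire f -> entire g -> entire (fun z => f z + g z).
Proof. intros Hf Hg z. destruct (Hf z), (Hg z). eexists. apply cder_plus; eassumption. Qed.
Lemma entire_mult (f g : C -> C) : entire f -> entire g -> entire (fun z => f z * g z).
Proof. intros Hf Hg z. destruct (Hf z), (Hg z). eexists. apply cder_mult; eassumption. Qed.
Lemma entire_pow (f : C -> C) n : entire f -> entire (fun z => f z ^ n).
Proof. intros Hf z. destruct (Hf z). eexists. apply cder_pow; eassumption. Qed.
Lemma entire_comp (f g : C -> C) : entire f -> entire g -> entire (fun z => f (g z)).
Proof. intros Hf Hg z. destruct (Hg z) as [l H]. destruct (Hf (g z)) as [m H'].
 eexists. apply (cder_comp f g); eassumption. Qed.
Lemma entire_inv (f : C -> C) : entire f -> (forall z, f z <> 0) -> entire (fun z => / f z).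
Proof. intros Hf H0 z. destruct (Hf z). eexists. apply cder_inv; eauto. Qed.
Lemma entire_Cexp : entire Cexp.
Proof. intros z. eexists. apply cder_Cexp. Qed.
Lemma entire_ext (f g : C -> C) : (forall z, f z = g z) -> entire f -> entire g.
Proof. intros H Hf z. destruct (Hf z) as [l Hl]. exists l. now apply (cder_ext f). Qed.
Lemma entire_minus_const (p : C) : entire (fun z => z - p).
Proof. apply (entire_plus (fun z => z) (fun _ => - p)); [apply entire_id|apply entire_const]. Qed.

(* Induction on [k]: if [al g = 1 - be u^k] with [u = z - p], multiplying [al]
   by [exp (be(p) u^k)] raises the order of contact of [al g] with [1]. *)
Lemma jet_normalization (g : C -> C) (p : C) (k : nat) :
  entire g -> g p <> 0 ->
  exists al be : C -> C, entire al /\ entire be /\ (forall z, al z <> 0) /\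
    forall z, al z * g z + be z * (z - p) ^ S k = 1.
Proof.
intros Hg Hp. induction k as [|k (al & be & Hal & Hbe & Hal0 & E)].
- destruct (entire_division (fun z => 1 + - / g p * g z) p) as (q & Hq & Eq).
  + apply (entire_plus (fun _ => 1)); [apply entire_const|].
    apply (entire_mult (fun _ => - / g p)); [apply entire_const|exact Hg].
  + field. exact Hp.
  + exists (fun _ => / g p), q. repeat split; auto using entire_const.
    * intros _ H. apply (f_equal (fun x => x * g p)) in H.
      rewrite Cinv_l, Cmult_0_l in H by exact Hp.
      injection H. lra.
    * intros z. replace (q z * (z - p) ^ 1) with ((z - p) * q z) by (simpl; ring). rewrite <- Eq.
      ring.
- destruct (entire_division (fun x => 1 + - Cexp (be p * x)) 0) as (r & Hr & Er).
  { apply (entire_plus (fun _ => 1)); [apply entire_const|].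
    apply (entire_ext (fun x => (-1) * Cexp (be p * x))); [intros; ring|].
    apply (entire_mult (fun _ => -1)); [apply entire_const|].
    apply (entire_comp Cexp (fun x => be p * x)); [apply entire_Cexp|].
    apply (entire_mult (fun _ => be p)); [apply entire_const|apply entire_id]. }
  { replace (be p * 0) with (RtoC 0) by ring. rewrite Cexp_0. ring. }
  assert (Hr0 : r 0 = - be p).
  { assert (D : cder (fun x => 1 + - Cexp (be p * x)) 0 (- be p)).
    { eapply cder_eq.
      - apply (cder_plus (fun _ => 1) (fun x => - Cexp (be p * x))); [apply cder_const|].
        apply (cder_opp (fun x => Cexp (be p * x))).
        apply (cder_comp Cexp (fun x => be p * x)); [apply cder_Cexp|].
        apply (cder_mult (fun _ => be p) (fun x => x)); [apply cder_const|apply cder_id].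
      - replace (be p * 0) with (RtoC 0) by ring. rewrite Cexp_0. ring. }
    destruct (Hr 0) as [l Hl].
    rewrite (cder_unique _ 0 _ _ D (cder_ext (fun x => (x - 0) * r x) _ 0 _ (fun x => eq_sym (Er x))
      (cder_mult (fun x => x - 0) r 0 _ _ (cder_minus (fun x => x) (fun _ => 0) 0 _ _ (cder_id 0) (cder_const 0 0)) Hl))).
    ring. }
  set (e := fun z => Cexp (be p * (z - p) ^ S k)).
  assert (He : entire e).
  { apply (entire_comp Cexp); [apply entire_Cexp|].
    apply (entire_mult (fun _ => be p)); [apply entire_const|].
    apply entire_pow, entire_minus_const. }
  (* Since [1 - exp(be(p) x) = x r(x)], the new defect is [1 - e al g = (1 - e) + e be u^(k+1) =
     u^(k+1) (r(u^(k+1)) + e be)]. The bracket is 0 at [p] because [r(0) = - be(p)] and [e(p) = 1],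
     so one more factor [u] comes out. *)
  destruct (entire_division (fun z => r ((z - p) ^ S k) + e z * be z) p) as (q & Hq & Eq).
  { apply entire_plus.
    - apply (entire_comp r); [exact Hr|]. apply entire_pow, entire_minus_const.
    - apply entire_mult; assumption. }
  { unfold e. replace (p - p) with (RtoC 0) by ring.
    replace (0 ^ S k) with (RtoC 0) by (simpl; ring). replace (be p * 0) with (RtoC 0) by ring.
    rewrite Cexp_0, Hr0. ring. }
  exists (fun z => e z * al z), q. repeat split.
  + apply entire_mult; assumption.
  + exact Hq.
  + intros z. apply Cmult_neq_0; [apply Cexp_neq_0|apply Hal0].
  + intros z. replace (q z * (z - p) ^ S (S k)) with ((z - p) ^ S k * ((z - p) * q z)) by (simpl;
    ring).
    rewrite <- Eq.
    assert (E1 := Er ((z - p) ^ S k)). fold (e z) in E1.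
    transitivity (e z * (al z * g z + be z * (z - p) ^ S k) + ((z - p) ^ S k - 0) * r ((z - p) ^ S k)); [ring|].
    rewrite E, <- E1. ring.
Qed.

(** Horner's scheme, adding one coefficient at each step. The value at 0 is the leading coefficient
    [c k], which becomes the non-zero value of the numerator at the pole. *)
Lemma principal_part_poly (c : nat -> C) (k : nat) :
  exists R : C -> C, entire R /\ ((0 < k)%nat -> R 0 = c k) /\
    forall u : C, u <> 0 -> sum_n_m (fun j => c j / u ^ j) 1 k * u ^ k = R u.
Proof.
induction k as [|k (R & HR & _ & E)].
- exists (fun _ => 0). repeat split; [apply entire_const|lia|].
  intros u Hu. rewrite sum_n_m_zero by lia. apply Cmult_0_l.
- exists (fun u => u * R u + c (S k)). split; [|split].
  + apply (entire_plus (fun u => u * R u)); [|apply entire_const].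
    apply (entire_mult (fun u => u)); [apply entire_id|exact HR].
  + intros _. ring.
  + intros u Hu. rewrite sum_n_Sm by lia. rewrite <- (E u Hu).
    change (plus ?a ?b) with (a + b). rewrite Cmult_plus_distr_r. rewrite !Cpow_S.
    field. split; [now apply Cpow_nz|exact Hu].
Qed.

Lemma pole_numerator (s : C -> P1) (p : C) (k : nat) :
  (0 < k)%nat -> meromorphic s -> pole_of_order s p k -> (forall q, s q = None -> q = p) ->
  exists g : C -> C, entire g /\ g p <> 0 /\
    forall z, z <> p -> s z = Some (g z / (z - p) ^ k).
Proof.
intros Hk Hm (Hp & h & c & Hh & Hc & Hs) Honly.
destruct (principal_part_poly c k) as (R & HR & HR0 & ER). specialize (HR0 Hk).
(* The value [c k] at the pole is the limit of [(z - p)^k s(z)]. *)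
exists (fun z => match s z with Some w => w * (z - p) ^ k | None => c k end).
split; [|split].
- intros z. destruct (Ceq_dec z p) as [->|Hz].
  + apply locally_singleton in Hh as Hh0. destruct Hh0 as [l Hl].
    destruct (entire_comp R (fun z => z - p) HR (entire_minus_const p) p) as [m Hm'].
    eexists. apply (cder_ext_loc (fun z => h z * (z - p) ^ k + R (z - p))).
    * unfold locally' in Hs. unfold within in Hs. apply filter_imp with (2 := Hs).
      intros y Hy. destruct (Ceq_dec y p) as [->|Hyp].
      -- rewrite Hp. replace (p - p) with (RtoC 0) by ring. rewrite HR0.
         destruct k; [lia|]. simpl. ring.
      -- rewrite (Hy Hyp). rewrite <- ER by now apply Cminus_eq_contra. ring.
    * apply (cder_plus (fun z => h z * (z - p) ^ k) (fun z => R (z - p))); [|exact Hm'].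
      apply (cder_mult h (fun z => (z - p) ^ k)); [exact Hl|].
      apply (cder_pow (fun z => z - p)). apply (cder_minus (fun z => z) (fun _ => p));
        [apply cder_id|apply cder_const].
  + destruct (Hm z) as [(f & Hf & Ef)|(j & Hj & Hpole)].
    2:{ exfalso. apply Hz, Honly. apply Hpole. }
    apply locally_singleton in Hf. destruct Hf as [l Hl].
    eexists. apply (cder_ext_loc (fun z => f z * (z - p) ^ k)).
    * apply filter_imp with (2 := Ef). intros y ->. reflexivity.
    * apply (cder_mult f (fun z => (z - p) ^ k)); [exact Hl|].
      apply (cder_pow (fun z => z - p)). apply (cder_minus (fun z => z) (fun _ => p));
        [apply cder_id|apply cder_const].
- rewrite Hp. exact Hc.
- intros z Hz. destruct (s z) as [w|] eqn:E.
  + f_equal. field. now apply Cpow_nz, Cminus_eq_contra.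
  + exfalso. now apply Hz, Honly.
Qed.

(** * Holomorphic functions of two variables *)

Notation fdiff f p l := (filterdiff (K := C_AbsRing) (U := C2) (V := C_NormedModule) f (locally p) l).
Notation hol2 f := (holomorphic2 (V := C_NormedModule) f).

Lemma is_linear_fst2 : is_linear (K := C_AbsRing) (U := C2) (V := C_NormedModule) (fun q => fst q).
Proof. apply is_linear_fst. Qed.
Lemma is_linear_snd2 : is_linear (K := C_AbsRing) (U := C2) (V := C_NormedModule) (fun q => snd q).
Proof. apply is_linear_snd. Qed.

Lemma fdiff_mult (f g : C2 -> C) p lf lg : fdiff f p lf -> fdiff g p lg ->
  fdiff (fun q => f q * g q) p (fun q => lf q * g p + f p * lg q).
Proof.
intros H1 H2. apply filterdiff_C_target in H1, H2. apply filterdiff_C_target.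
apply (filterdiff_mult_fct (K:=C_AbsRing) f g p lf lg Cmult_comm H1 H2).
Qed.

Lemma fdiff_plus (f g : C2 -> C) p lf lg : fdiff f p lf -> fdiff g p lg ->
  fdiff (fun q => f q + g q) p (fun q => lf q + lg q).
Proof. intros H1 H2. apply (filterdiff_plus_fct (K:=C_AbsRing) (V := C_NormedModule) f g lf lg H1 H2). Qed.

Lemma fdiff_comp (f : C -> C) (g : C2 -> C) p l lg : cder f (g p) l -> fdiff g p lg ->
  fdiff (fun q => f (g q)) p (fun q => lg q * l).
Proof.
intros H1 H2. apply filterdiff_C_target in H2.
refine (filterdiff_comp' (K := C_AbsRing) (U := C2) (V := AbsRing_NormedModule C_AbsRing) (W := C_NormedModule)
  g f p lg (fun y => y * l) H2 H1).
Qed.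

Lemma hol2_const (c : C) : hol2 (fun _ => c).
Proof. intros p. exists (fun _ => zero). apply filterdiff_const. Qed.
Lemma hol2_fst : hol2 (fun p => fst p).
Proof. intros p. exists (fun p => fst p). apply (filterdiff_linear _ is_linear_fst2). Qed.
Lemma hol2_snd : hol2 (fun p => snd p).
Proof. intros p. exists (fun p => snd p). apply (filterdiff_linear _ is_linear_snd2). Qed.
Lemma hol2_plus (f g : C2 -> C) : hol2 f -> hol2 g -> hol2 (fun p => f p + g p).
Proof. intros Hf Hg p. destruct (Hf p) as [lf H1], (Hg p) as [lg H2]. eexists. apply fdiff_plus;
  eassumption. Qed.
Lemma hol2_mult (f g : C2 -> C) : hol2 f -> hol2 g -> hol2 (fun p => f p * g p).
Proof. intros Hf Hg p. destruct (Hf p) as [lf H1], (Hg p) as [lg H2]. eexists. apply fdiff_mult;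
  eassumption. Qed.
Lemma hol2_comp1 (f : C -> C) (g : C2 -> C) : entire f -> hol2 g -> hol2 (fun p => f (g p)).
Proof. intros Hf Hg p. destruct (Hg p) as [lg H2]. destruct (Hf (g p)) as [l Hl]. eexists.
eapply fdiff_comp; eassumption. Qed.
Lemma hol2_pow (f : C2 -> C) n : hol2 f -> hol2 (fun p => f p ^ n).
Proof. intros H. apply (hol2_comp1 (fun z => z ^ n)); [|exact H]. apply entire_pow, entire_id. Qed.
Lemma hol2_opp (f : C2 -> C) : hol2 f -> hol2 (fun p => - f p).
Proof.
intros H. apply (hol2_comp1 (fun z => - z)); [|exact H].
intros z. eexists. apply (cder_opp (fun z => z)), cder_id.
Qed.
Lemma hol2_minus (f g : C2 -> C) : hol2 f -> hol2 g -> hol2 (fun p => f p - g p).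
Proof. intros Hf Hg. apply hol2_plus; [exact Hf|]. now apply hol2_opp. Qed.

Lemma norm_C2_le (a b : C) : norm (K := C_AbsRing) (V := C2) (a, b) <= Cmod a + Cmod b.
Proof.
change (sqrt (Cmod a ^ 2 + Cmod b ^ 2) <= Cmod a + Cmod b)%R.
assert (Ha := Cmod_ge_0 a). assert (Hb := Cmod_ge_0 b).
rewrite <- (sqrt_Rsqr (Cmod a + Cmod b)) by lra. apply sqrt_le_1_alt. unfold Rsqr. nra.
Qed.

Lemma filterdiff_pair (U : NormedModule C_AbsRing) (F : (U -> Prop) ->
  Prop) (HF : Filter F) (f g lf lg : U -> C) :
  filterdiff (K := C_AbsRing) (V := C_NormedModule) f F lf ->
  filterdiff (K := C_AbsRing) (V := C_NormedModule) g F lg ->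
  filterdiff (K := C_AbsRing) (V := C2) (fun q => (f q, g q)) F (fun q => (lf q, lg q)).
Proof.
intros [[A1 A2 (M1 & PM1 & A3)] A4] [[B1 B2 (M2 & PM2 & B3)] B4]. split.
- split.
  + intros x y. rewrite A1, B1. reflexivity.
  + intros k x. rewrite A2, B2. reflexivity.
  + exists (M1 + M2)%R. split; [lra|]. intros x. eapply Rle_trans; [apply norm_C2_le|].
    assert (A3' : Cmod (lf x) <= M1 * norm x) by exact (A3 x).
    assert (B3' : Cmod (lg x) <= M2 * norm x) by exact (B3 x). lra.
- intros x Hx eps.
  assert (He : 0 < eps / 2) by (destruct eps; simpl; lra).
  generalize (filter_and _ _ (A4 x Hx (mkposreal _ He)) (B4 x Hx (mkposreal _ He))).
  apply filter_imp. intros y [G1 G2].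
  assert (G1' : Cmod (f y - f x - lf (minus y x)) <= eps / 2 * norm (minus y x)) by exact G1.
  assert (G2' : Cmod (g y - g x - lg (minus y x)) <= eps / 2 * norm (minus y x)) by exact G2.
  eapply Rle_trans; [apply (norm_C2_le (f y - f x - lf (minus y x)) (g y - g x - lg (minus y x)))|]. lra.
Qed.

Lemma hol2_pair (f g : C2 -> C) : hol2 f -> hol2 g -> holomorphic2 (V := C2) (fun p => (f p, g p)).
Proof.
intros Hf Hg p. destruct (Hf p) as [lf H1], (Hg p) as [lg H2].
eexists. apply filterdiff_pair; [apply filter_filter|eassumption|eassumption].
Qed.

Notation is_derive2 phi t l := (is_derive (K := C_AbsRing) (V := C2) phi t l).

Lemma is_derive2_pair (f g : C -> C) t a b : cder f t a -> cder g t b ->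
  is_derive2 (fun t => (f t, g t)) t (a, b).
Proof.
intros H1 H2. apply (filterdiff_pair (AbsRing_NormedModule C_AbsRing) _ (@filter_filter _ _ (locally_filter (T := AbsRing_UniformSpace C_AbsRing) t)) f g); assumption.
Qed.

Lemma fdiff_curve (W : NormedModule C_AbsRing) (f : C2 -> W) (phi : C -> C2) t lf d :
  filterdiff f (locally (phi t)) lf -> is_derive2 phi t d ->
  is_derive (K := C_AbsRing) (V := W) (fun t => f (phi t)) t (lf d).
Proof.
intros H1 H2.
assert (H := filterdiff_comp' (K := C_AbsRing) (U := AbsRing_NormedModule C_AbsRing) phi f t _ lf H2 H1).
apply filterdiff_ext_lin with (1 := H). intros y. apply linear_scal. apply H1.
Qed.

Lemma is_derive2_fst (phi : C -> C2) t d : is_derive2 phi t d ->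
  cder (fun t => fst (phi t)) t (fst d).
Proof.
intros H. apply (fdiff_curve C_NormedModule (fun p : C2 => fst p) phi t (fun p => fst p));
  [|exact H].
apply (filterdiff_linear _ is_linear_fst2).
Qed.
Lemma is_derive2_snd (phi : C -> C2) t d : is_derive2 phi t d ->
  cder (fun t => snd (phi t)) t (snd d).
Proof.
intros H. apply (fdiff_curve C_NormedModule (fun p : C2 => snd p) phi t (fun p => snd p));
  [|exact H].
apply (filterdiff_linear _ is_linear_snd2).
Qed.

Lemma hol2_line (H : C2 -> C) (p v : C2) : hol2 H -> entire (fun x => H (plus p (scal x v))).
Proof.
intros HH t. destruct (HH (plus p (scal t v))) as [l Hl].
eexists. apply (fdiff_curve C_NormedModule H (fun x => plus p (scal x v)) t l v Hl).
apply (is_derive_ext (K := C_AbsRing) (V := C2) (fun x => (fst p + x * fst v,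
  snd p + x * snd v))); [reflexivity|].
destruct p as [p1 p2], v as [v1 v2].
apply is_derive2_pair.
- eapply cder_eq; [apply (cder_plus (fun _ => p1) (fun x => x * v1)); [apply cder_const|]|].
  + apply (cder_mult (fun x => x) (fun _ => v1)); [apply cder_id|apply cder_const].
  + simpl. ring.
- eapply cder_eq; [apply (cder_plus (fun _ => p2) (fun x => x * v2)); [apply cder_const|]|].
  + apply (cder_mult (fun x => x) (fun _ => v2)); [apply cder_id|apply cder_const].
  + simpl. ring.
Qed.

(** * Pluripolarity of zero sets *)

(** If [l > 0], then [f'] increases through [x0] at rate at least [l / 2]: it is positive just to
    the right of [x0] when [f'(x0) >= 0], and negative just to the left otherwise. In both cases [f]
    exceeds [f(x0)]. *)
Lemma second_derivative_test (f f' : R -> R) (x0 d l : R) :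
  0 < d -> (forall x, Rabs (x - x0) < d -> is_derive f x (f' x)) ->
  (forall x, Rabs (x - x0) < d -> f x <= f x0) -> is_derive f' x0 l -> l <= 0.
Proof.
intros Hd Hf Hmax Hl. destruct (Rle_dec l 0) as [|Hl0]; [assumption|exfalso].
apply is_derive_Reals in Hl.
destruct (R_derive_eps f' x0 l Hl (l / 2)%R ltac:(lra)) as (e & He & H).
set (m := (Rmin d e / 2)%R).
assert (Hm : 0 < m /\ m < d /\ m < e).
{ unfold m. assert (A := Rmin_l d e). assert (B := Rmin_r d e).
  assert (0 < Rmin d e)%R by (apply Rmin_glb_lt; lra). lra. }
assert (Hf' : forall x, Rabs (x - x0) < d -> derivable_pt_lim f x (f' x)) by (intros;
  now apply is_derive_Reals, Hf).
destruct (Rle_dec 0 (f' x0)) as [Ha|Ha].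
- destruct (MVT_cor2 f f' x0 (x0 + m)%R ltac:(lra)) as (c & E & Hc).
  + intros c Hc. apply Hf'. apply Rabs_def1; lra.
  + assert (G := Hmax (x0 + m)%R ltac:(apply Rabs_def1; lra)).
    specialize (H (c - x0)%R ltac:(apply Rabs_def1; lra)).
    rewrite (Rabs_pos_eq (c - x0)) in H by lra. replace (x0 + (c - x0))%R with c in H by ring.
    apply Rabs_le_between in H.
    assert (0 < l * (c - x0))%R by (apply Rmult_lt_0_compat; lra).
    assert (0 < f' c * (x0 + m - x0))%R by (apply Rmult_lt_0_compat; lra). lra.
- destruct (MVT_cor2 f f' (x0 - m)%R x0 ltac:(lra)) as (c & E & Hc).
  + intros c Hc. apply Hf'. apply Rabs_def1; lra.
  + assert (G := Hmax (x0 - m)%R ltac:(apply Rabs_def1; lra)).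
    specialize (H (c - x0)%R ltac:(apply Rabs_def1; lra)).
    rewrite (Rabs_left1 (c - x0)) in H by lra. replace (x0 + (c - x0))%R with c in H by ring.
    apply Rabs_le_between in H.
    assert (0 < l * (x0 - c))%R by (apply Rmult_lt_0_compat; lra).
    assert (0 < (- f' c) * (x0 - (x0 - m)))%R by (apply Rmult_lt_0_compat; lra). lra.
Qed.

(* Compactness by bisection: were no maximum attained, every small square would
   be dominated by a single value of [N], hence so would the whole of [K]. *)
Lemma usc_attains_max (K : C -> Prop) (N : C -> R) (z0 : C) (a b c d : R) :
  K z0 -> (forall z, K z -> a <= fst z <= b /\ c <= snd z <= d) ->
  (forall z, ~ K z -> locally (T := C_UniformSpace) z (fun y => ~ K y)) ->
  (forall z M, K z -> N z < M -> locally (T := C_UniformSpace) z (fun y => K y -> N y < M)) ->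
  exists m, K m /\ forall y, K y -> N y <= N m.
Proof.
intros Hz0 HK Hcl Husc. apply NNPP. intros Hno.
assert (Hbig : forall z, K z -> exists m, K m /\ N z < N m).
{ intros z Hz. apply NNPP. intros Hn. apply Hno. exists z. split; [exact Hz|].
  intros y Hy. apply Rnot_lt_le. intros G. apply Hn. now exists y. }
assert (HP : exists m, K m /\ forall x y, a <= x <= b -> c <= y <= d -> K (x, y) -> N (x, y) < N m).
{ assert (Hab := HK z0 Hz0).
  apply (rectangle_bisection (fun a b c d => exists m, K m /\
    forall x y, a <= x <= b -> c <= y <= d -> K (x, y) -> N (x, y) < N m)); try lra.
  - clear. intros a b c d Hab Hcd (m1 & K1 & H1) (m2 & K2 & H2) (m3 & K3 & H3) (m4 & K4 & H4).
    assert (Hmax : forall u v, K u -> K v -> exists w, K w /\ N u <= N w /\ N v <= N w).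
    { intros u v Hu Hv. destruct (Rle_dec (N u) (N v)); [exists v|exists u]; repeat split; auto;
      lra. }
    destruct (Hmax m1 m2 K1 K2) as (w1 & Kw1 & A1 & A2).
    destruct (Hmax m3 m4 K3 K4) as (w2 & Kw2 & A3 & A4).
    destruct (Hmax w1 w2 Kw1 Kw2) as (w & Kw & A5 & A6).
    exists w. split; [exact Kw|]. intros x y Hx Hy Hxy.
    destruct (Rle_dec x ((a + b) / 2)); destruct (Rle_dec y ((c + d) / 2)).
    + specialize (H1 x y ltac:(lra) ltac:(lra) Hxy). lra.
    + specialize (H3 x y ltac:(lra) ltac:(lra) Hxy). lra.
    + specialize (H2 x y ltac:(lra) ltac:(lra) Hxy). lra.
    + specialize (H4 x y ltac:(lra) ltac:(lra) Hxy). lra.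
  - intros x y Hx Hy.
    assert (Hloc : exists m, K m /\ locally (T := C_UniformSpace) (x, y) (fun v => K v ->
      N v < N m)).
    { destruct (classic (K (x, y))) as [Hk|Hk].
      - destruct (Hbig _ Hk) as (m & Km & Hm). exists m. split; [exact Km|]. now apply Husc.
      - exists z0. split; [exact Hz0|]. apply filter_imp with (2 := Hcl _ Hk). intros v Hv Kv.
        now destruct Hv. }
    destruct Hloc as (m & Km & [e He]). exists e. split; [apply cond_pos|].
    intros a' b' c' d' Hx' Hy' H1 H2. exists m. split; [exact Km|]. intros x' y' Hx'' Hy'' Hk.
    apply He; [|exact Hk]. split; simpl; apply Rabs_def1; simpl; unfold minus, plus, opp; simpl;
      lra. }
destruct HP as (m & Km & Hm). assert (Hab := HK m Km).
specialize (Hm (fst m) (snd m) ltac:(lra) ltac:(lra)). destruct m as [m1 m2]. simpl in Hm.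
specialize (Hm Km). lra.
Qed.

Lemma is_derive_Re (G : R -> C) (t : R) (l : C) :
  is_derive (K := R_AbsRing) (V := C_R_NormedModule) G t l ->
    is_derive (fun t => fst (G t)) t (fst l).
Proof.
intros HG.
apply (filterdiff_comp' (K := R_AbsRing) (V := C_R_NormedModule) (W := R_NormedModule) G (fun z => fst z) t _ (fun z => fst z) HG).
apply filterdiff_linear, (is_linear_fst (K := R_AbsRing) (U := R_NormedModule) (V := R_NormedModule)).
Qed.

Lemma is_derive_Im (G : R -> C) (t : R) (l : C) :
  is_derive (K := R_AbsRing) (V := C_R_NormedModule) G t l ->
    is_derive (fun t => snd (G t)) t (snd l).
Proof.
intros HG.
apply (filterdiff_comp' (K := R_AbsRing) (V := C_R_NormedModule) (W := R_NormedModule) G (fun z => snd z) t _ (fun z => snd z) HG).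
apply filterdiff_linear, (is_linear_snd (K := R_AbsRing) (U := R_NormedModule) (V := R_NormedModule)).
Qed.

(** This is the real part of the derivative of [log G], computed from [u^2 + v^2] so that no branch
    of the logarithm has to be chosen. *)
Lemma is_derive_ln_Cmod (G : R -> C) (t : R) (l : C) :
  is_derive (K := R_AbsRing) (V := C_R_NormedModule) G t l -> G t <> 0 ->
  is_derive (fun t => ln (Cmod (G t))) t (fst (l / G t)).
Proof.
intros HG H0.
assert (H1 := is_derive_Re G t l HG). assert (H2 := is_derive_Im G t l HG).
assert (Hq : 0 < fst (G t) ^ 2 + snd (G t) ^ 2).
{ apply Cmod_pos in H0. unfold Cmod in H0.
  apply Rnot_le_lt. intros Hle. rewrite sqrt_neg_0 in H0 by exact Hle. lra. }
unfold Cmod. set (u := fun t => fst (G t)) in *. set (v := fun t => snd (G t)) in *.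
apply (is_derive_ext (fun t => ln (sqrt (u t ^ 2 + v t ^ 2))%R)); [reflexivity|].
change (0 < u t ^ 2 + v t ^ 2)%R in Hq.
assert (Hs : 0 < sqrt (u t ^ 2 + v t ^ 2)) by now apply sqrt_lt_R0.
auto_derive.
- repeat split; try (eexists; eassumption); simpl in *; try rewrite !Rmult_1_r in *; auto; lra.
- assert (E1 : Derive (fun x : R => u x) t = fst l) by (apply is_derive_unique, H1).
  assert (E2 : Derive (fun x : R => v x) t = snd l) by (apply is_derive_unique, H2).
  rewrite E1, E2. unfold Cdiv, Cmult, Cinv. simpl fst. simpl snd. fold (u t) (v t).
  replace (u t * (u t * 1) + v t * (v t * 1))%R with (u t ^ 2 + v t ^ 2)%R by ring.
  set (q := (u t ^ 2 + v t ^ 2)%R) in *.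
  rewrite <- (sqrt_sqrt q) at 3 4 by lra. field. lra.
Qed.

Lemma Cmod_sq (z : C) : (Cmod z * Cmod z = fst z * fst z + snd z * snd z)%R.
Proof. unfold Cmod. rewrite sqrt_sqrt by nra. ring. Qed.

(** The comparison is multiplicative, with [N = |H| exp(P - h)] and [P = eps |z - c|^2], so that
    zeros of [H] give the value 0 and not minus infinity. A violation puts the maximum of [N] inside
    the disc and off the zeros of [H]; there [ln N] has Laplacian [4 eps > 0], which is impossible
    at a maximum. *)
Lemma max_principle_log (H : C -> C) (c : C) (r : R) (h : C -> R) :
  entire H -> 0 < r ->
  continuous_on (T := C_UniformSpace) (U := R_UniformSpace) (fun z => Cmod (z - c) <= r) h ->
  harmonic_on (fun z => Cmod (z - c) < r) h ->
  (forall z, Cmod (z - c) = r -> Cmod (H z) <= exp (h z)) ->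
  forall z, Cmod (z - c) <= r -> Cmod (H z) <= exp (h z).
Proof.
intros HH Hr Hcont (C1 & C2 & C3 & Hlap) Hbd z1 Hz1.
apply Rnot_lt_le. intros Hlt.
set (q := (Cmod (H z1) * exp (- h z1))%R).
assert (Hq : 1 < q).
{ unfold q. apply Rmult_lt_reg_r with (exp (h z1)); [apply exp_pos|].
  rewrite Rmult_assoc, <- exp_plus, Rplus_opp_l, exp_0. lra. }
(* This makes [exp(eps r^2)] the square root of [q], hence smaller than [q]: on the circle [N] stays
   below its value at [z1]. *)
set (eps := (ln q / (2 * (r * r)))%R).
assert (Hlnq : 0 < ln q). { rewrite <- ln_1. apply ln_increasing; lra. }
assert (Hrr : 0 < r * r) by nra.
assert (He : 0 < eps) by (apply Rdiv_lt_0_compat; lra).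
assert (Heq : exp (eps * (r * r)) < q).
{ rewrite <- (exp_ln q) by lra. apply exp_increasing. unfold eps.
  replace (ln q / (2 * (r * r)) * (r * r))%R with (ln q / 2)%R by (field; lra). lra. }
set (P := fun z => (eps * (Cmod (z - c) * Cmod (z - c)))%R).
set (N := fun z => (Cmod (H z) * exp (P z) * exp (- h z))%R).
assert (HPpos : forall z, 0 <= P z).
{ intros z. unfold P. assert (G := Cmod_ge_0 (z - c)). apply Rmult_le_pos; nra. }
assert (Hc1 : forall z, continuous (T := C_UniformSpace) (U := R_UniformSpace) (fun z => Cmod (z - c)) z).
{ intros z. apply (continuous_comp (U := C_UniformSpace) (V := C_UniformSpace) (W := R_UniformSpace) (fun z => z - c) Cmod).
  - apply entire_continuous, entire_minus_const.
  - apply (filterlim_norm (K := C_AbsRing) (V := C_NormedModule)). }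
assert (Hexpc : forall x, continuous (T := R_UniformSpace) (U := R_UniformSpace) exp x).
{ intros x. apply continuity_pt_filterlim, derivable_continuous_pt, derivable_pt_exp. }
assert (Hc2 : forall z, continuous (T := C_UniformSpace) (U := R_UniformSpace) (fun z => Cmod (H z) * exp (P z))%R z).
{ intros z. apply (continuous_mult (K := R_AbsRing) (fun z => Cmod (H z)) (fun z => exp (P z))).
  - apply (continuous_comp (U := C_UniformSpace) (V := C_UniformSpace) (W := R_UniformSpace) H Cmod).
    + now apply entire_continuous.
    + apply (filterlim_norm (K := C_AbsRing) (V := C_NormedModule)).
  - apply (continuous_comp (U := C_UniformSpace) (V := R_UniformSpace) (W := R_UniformSpace) P exp); [|apply Hexpc].
    apply (continuous_mult (K := R_AbsRing) (fun _ => eps)); [apply continuous_const|].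
    apply (continuous_mult (K := R_AbsRing) (fun z => Cmod (z - c)) (fun z => Cmod (z - c)));
      apply Hc1. }
destruct (usc_attains_max (fun z => Cmod (z - c) <= r) N z1 (fst c - r) (fst c + r) (snd c - r) (snd c + r))
  as (m & Hm & Hmax).
- exact Hz1.
- intros z Hz. assert (G1 := Rle_trans _ _ _ (Rmax_l _ _) (Rle_trans _ _ _ (Rmax_Cmod (z - c)) Hz)).
  assert (G2 := Rle_trans _ _ _ (Rmax_r _ _) (Rle_trans _ _ _ (Rmax_Cmod (z - c)) Hz)).
  apply Rabs_le_between in G1, G2. destruct z, c; simpl in *; lra.
- intros z Hz. apply locally_C_eps. exists (Cmod (z - c) - r)%R. split; [lra|].
  intros y Hy Hy2. assert (G := Cmod_triangle_inv (z - c) (y - c)).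
  replace (z - c - (y - c)) with (z - y) in G by ring. rewrite Cmod_minus_sym in Hy. lra.
- intros z M Hz HM.
  assert (Hh : filterlim N (within (fun z => Cmod (z - c) <= r) (locally (T := C_UniformSpace) z)) (locally (N z))).
  { unfold N. apply (filterlim_comp_2 (fun z => Cmod (H z) * exp (P z))%R (fun z => exp (- h z)) Rmult
      (G := locally (Cmod (H z) * exp (P z))%R) (H := locally (exp (- h z)))).
    - intros Q HQ. apply (filter_le_within (F := locally (T := C_UniformSpace) z)).
      exact (Hc2 z Q HQ).
    - apply filterlim_comp with (G := locally (- h z)%R) (g := exp) (f := fun z => (- h z)%R);
      [|apply Hexpc].
      apply filterlim_comp with (G := locally (h z)) (f := h) (g := Ropp); [now apply Hcont|].
      apply (filterlim_opp (K := R_AbsRing) (V := R_NormedModule)).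
    - apply (filterlim_mult (K := R_AbsRing)). }
  specialize (Hh (fun x => x < M)). unfold filtermap, within in Hh.
  apply filter_imp with (2 := Hh (open_lt M (N z) HM)). auto.
- assert (HNm : q <= N m).
  { apply Rle_trans with (N z1); [|now apply Hmax]. unfold N, q.
    assert (1 <= exp (P z1)). { rewrite <- exp_0. destruct (HPpos z1) as [G| <-]; [left;
      now apply exp_increasing|lra]. }
    assert (0 < exp (- h z1)) by apply exp_pos. assert (0 <= Cmod (H z1)) by apply Cmod_ge_0.
    apply Rmult_le_compat_r; [lra|]. nra. }
  assert (Hmr : Cmod (m - c) < r).
  { destruct Hm as [G|G]; [exact G|exfalso]. specialize (Hbd m G).
    assert (HP : P m = (eps * (r * r))%R) by (unfold P; now rewrite G).
    unfold N in HNm. rewrite HP in HNm.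
    assert (B : (Cmod (H m) * exp (- h m) <= 1)%R).
    { replace 1%R with (exp (h m) * exp (- h m))%R by (rewrite <- exp_plus, Rplus_opp_r;
      apply exp_0).
      apply Rmult_le_compat_r; [left; apply exp_pos|exact Hbd]. }
    assert (0 < exp (eps * (r * r))) by apply exp_pos. nra. }
  assert (Hm0 : H m <> 0).
  { intros E. unfold N in HNm. rewrite E, Cmod_0 in HNm. lra. }
  assert (Hnear : exists d, 0 < d /\ forall z, Cmod (z - m) < d -> H z <> 0 /\ Cmod (z - c) < r).
  { assert (G := entire_continuous H HH m). rewrite continuous_C_eps in G.
    specialize (G (Cmod (H m)) (Cmod_pos _ Hm0)). apply locally_C_eps in G.
    destruct G as (d & Hd & G).
    exists (Rmin d (r - Cmod (m - c))). split; [apply Rmin_glb_lt; lra|]. intros z Hz.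
    assert (Z1 := Rlt_le_trans _ _ _ Hz (Rmin_l _ _)).
    assert (Z2 := Rlt_le_trans _ _ _ Hz (Rmin_r _ _)). split.
    - intros E. specialize (G z Z1). rewrite E in G. replace (0 - H m) with (- H m) in G by ring.
      rewrite Cmod_opp in G. lra.
    - replace (z - c) with (z - m + (m - c)) by ring. eapply Rle_lt_trans;
      [apply Cmod_triangle|]. lra. }
  destruct Hnear as (d & Hd & Hnear).
  set (L := fun z => (ln (Cmod (H z)) + P z - h z)%R).
  assert (HL : forall z, Cmod (z - m) < d -> L z <= L m).
  { intros z Hz. destruct (Hnear z Hz) as [H1 H2]. specialize (Hmax z ltac:(lra)).
    assert (EN : forall z, H z <> 0 -> N z = exp (L z)).
    { intros u Hu. unfold N, L, Rminus. rewrite !exp_plus, exp_ln by now apply Cmod_pos.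
      reflexivity. }
    rewrite !EN in Hmax by auto. apply Rnot_lt_le. intros G. apply exp_increasing in G. lra. }
  set (H' := C_derive H). assert (HH' := entire_cder H HH).
  destruct (entire_derive H HH m) as [h2 Hh2].
  (* [ln |H|] has first derivatives [Re K] in [x] and [Re (i K)] in [y], hence second derivatives
     [Re k] and [- Re k] at [m], with [k] the derivative of [K]. They cancel in the sum of the two
     inequalities, as do those of [h]. *)
  set (K := fun z => H' z / H z).
  assert (HK : exists k, cder K m k).
  { eexists. apply (cder_mult H' (fun z => / H z)); [exact Hh2|]. apply (cder_inv H);
    [apply HH'|exact Hm0]. }
  destruct HK as [k HK].
  destruct m as [a b].
  assert (Ex : forall x, Cmod ((x, b) - (a, b)) = Rabs (x - a)).
  { intros x. rewrite <- Cmod_R. f_equal. unfold Cminus, Cplus, Copp, RtoC; simpl. f_equal; ring. }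
  assert (Ey : forall y, Cmod ((a, y) - (a, b)) = Rabs (y - b)).
  { intros y. transitivity (Cmod (RtoC (y - b) * Ci)); [|rewrite Cmod_mult, Cmod_R, Cmod_Ci; ring].
    f_equal. unfold Cminus, Cplus, Copp, Cmult, Ci, RtoC; simpl. f_equal; ring. }
  assert (Ix : fst k + 2 * eps - d_x (d_x h) (a, b) <= 0).
  { apply (second_derivative_test (fun x => L (x, b)) (fun x => fst (K (x,
    b)) + 2 * eps * (x - fst c) - d_x h (x, b))%R a d); auto.
    - intros x Hx. destruct (Hnear (x, b)) as [N1 N2]; [now rewrite Ex|].
      apply (is_derive_minus (K := R_AbsRing) (V := R_NormedModule) (fun x => ln (Cmod (H (x,
        b))) + P (x, b))%R (fun x => h (x, b))).
      + apply (is_derive_plus (K := R_AbsRing) (V := R_NormedModule) (fun x => ln (Cmod (H (x,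
        b)))) (fun x => P (x, b))).
        * exact (is_derive_ln_Cmod (fun x => H (x, b)) x _ (cder_h H x b _ (HH' (x, b))) N1).
        * apply (is_derive_ext (fun x => eps * ((x - fst c) * (x - fst c) + (b - snd c) * (b - snd c)))%R).
          { intros t. unfold P. rewrite Cmod_sq. simpl. ring. }
          auto_derive; [easy|ring].
      + destruct (C1 (x, b) N2) as (D1 & _). apply Derive_correct, D1.
    - intros x Hx. apply HL. now rewrite Ex.
    - apply (is_derive_minus (K := R_AbsRing) (V := R_NormedModule) (fun x => fst (K (x,
      b)) + 2 * eps * (x - fst c))%R (fun x => d_x h (x, b))).
      + apply (is_derive_plus (K := R_AbsRing) (V := R_NormedModule) (fun x => fst (K (x,
        b))) (fun x => 2 * eps * (x - fst c))%R).
        * exact (is_derive_Re (fun x => K (x, b)) a _ (cder_h K a b _ HK)).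
        * auto_derive; [easy|ring].
      + destruct (C2 (a, b) Hmr) as (D1 & _). apply Derive_correct, D1. }
  assert (Iy : - fst k + 2 * eps - d_y (d_y h) (a, b) <= 0).
  { apply (second_derivative_test (fun y => L (a, y)) (fun y => fst (Ci * K (a,
    y))%C + 2 * eps * (y - snd c) - d_y h (a, y))%R b d); auto.
    - intros y Hy. destruct (Hnear (a, y)) as [N1 N2]; [now rewrite Ey|].
      apply (is_derive_minus (K := R_AbsRing) (V := R_NormedModule) (fun y => ln (Cmod (H (a,
        y))) + P (a, y))%R (fun y => h (a, y))).
      + apply (is_derive_plus (K := R_AbsRing) (V := R_NormedModule) (fun y => ln (Cmod (H (a,
        y)))) (fun y => P (a, y))).
        * replace (Ci * K (a, y)) with (Ci * H' (a, y) / H (a, y)) by (unfold K, Cdiv; ring).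
          exact (is_derive_ln_Cmod (fun y => H (a, y)) y _ (cder_v H a y _ (HH' (a, y))) N1).
        * apply (is_derive_ext (fun y => eps * ((a - fst c) * (a - fst c) + (y - snd c) * (y - snd c)))%R).
          { intros t. unfold P. rewrite Cmod_sq. simpl. ring. }
          auto_derive; [easy|ring].
      + destruct (C1 (a, y) N2) as (_ & D1 & _). apply Derive_correct, D1.
    - intros y Hy. apply HL. now rewrite Ey.
    - apply (is_derive_minus (K := R_AbsRing) (V := R_NormedModule) (fun y => fst (Ci * K (a,
      y))%C + 2 * eps * (y - snd c))%R (fun y => d_y h (a, y))).
      + apply (is_derive_plus (K := R_AbsRing) (V := R_NormedModule) (fun y => fst (Ci * K (a,
        y))) (fun y => 2 * eps * (y - snd c))%R).
        * replace (- fst k)%R with (fst (Ci * (Ci * k))%C) by (simpl; ring).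
          apply (is_derive_Re (fun y => Ci * K (a, y)) b (Ci * (Ci * k))).
          apply (cder_v (fun z => Ci * K z) a b (Ci * k)). eapply cder_eq;
            [apply (cder_mult (fun _ => Ci) K); [apply cder_const|exact HK]|ring].
        * auto_derive; [easy|ring].
      + destruct (C3 (a, b) Hmr) as (_ & D1 & _). apply Derive_correct, D1. }
  specialize (Hlap (a, b) Hmr). lra.
Qed.

Definition log_abs (w : C) : Rbar := if Ceq_dec w 0 then m_infty else Finite (ln (Cmod w)).

Lemma log_abs_lt (w : C) (r : R) : Rbar_lt (log_abs w) r <-> Cmod w < exp r.
Proof.
unfold log_abs. destruct (Ceq_dec w 0) as [->|H]; simpl.
- rewrite Cmod_0. split; [intros; apply exp_pos|easy].
- apply Cmod_pos in H. split; intros G.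
  + rewrite <- (exp_ln (Cmod w)) by exact H. now apply exp_increasing.
  + rewrite <- (ln_exp r). now apply ln_increasing.
Qed.

Lemma log_abs_le (w : C) (r : R) : Rbar_le (log_abs w) r <-> Cmod w <= exp r.
Proof.
split; intros G.
- apply Rnot_lt_le. intros F. apply Rbar_le_not_lt in G. apply G.
  unfold log_abs. destruct (Ceq_dec w 0) as [->|H]; simpl.
  + rewrite Cmod_0 in F. assert (E := exp_pos r). lra.
  + rewrite <- (ln_exp r). apply ln_increasing; [apply exp_pos|exact F].
- apply Rbar_not_lt_le. unfold log_abs. destruct (Ceq_dec w 0) as [->|H]; simpl; [easy|].
  intros F. apply exp_increasing in F. rewrite exp_ln in F by now apply Cmod_pos. lra.
Qed.

Lemma log_abs_usc (T : UniformSpace) (f : T -> C) :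
  (forall x, continuous (U := C_UniformSpace) f x) -> upper_semicontinuous (fun x => log_abs (f x)).
Proof.
intros Hf p r Hr. apply log_abs_lt in Hr.
assert (Hc : continuous (U := R_UniformSpace) (fun x => Cmod (f x)) p).
{ apply (continuous_comp (V := C_UniformSpace) (W := R_UniformSpace) f Cmod); [apply Hf|].
  apply (filterlim_norm (K := C_AbsRing) (V := C_NormedModule)). }
specialize (Hc _ (open_lt (exp r) _ Hr)). unfold filtermap in Hc.
revert Hc. apply filter_imp. intros q Hq. now apply log_abs_lt.
Qed.

Lemma pluripolar_zero_set (H : C2 -> C) (p0 : C2) :
  hol2 H -> H p0 <> 0 -> pluripolar (fun p => H p = 0).
Proof.
intros HH Hp0. exists (fun p => log_abs (H p)).
assert (Hinf : forall w, log_abs w <> p_infty) by (intros w; unfold log_abs; destruct Ceq_dec;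
  discriminate).
split; [|split].
- split; [|split].
  + intros p. apply Hinf.
  + apply log_abs_usc. intros p. apply (filterdiff_continuous (K := C_AbsRing) (U := C2) (V := C_NormedModule)). apply HH.
  + intros p v. assert (Hl := hol2_line H p v HH). split; [|split].
    * intros z. apply Hinf.
    * apply (log_abs_usc C_UniformSpace (fun x => H (plus p (scal x v)))).
      now apply entire_continuous.
    * intros c r h Hr Hc Hh Hb z Hz. apply log_abs_le.
      apply (max_principle_log (fun x => H (plus p (scal x v))) c r h); auto.
      intros w Hw. apply log_abs_le. now apply Hb.
- exists p0. unfold log_abs. destruct Ceq_dec; [contradiction|discriminate].
- intros p ->. unfold log_abs. destruct Ceq_dec as [|n]; [reflexivity|now destruct n].
Qed.

(** * Straightening the graph *)

Lemma hol2_comp (f : C2 -> C) (F : C2 -> C2) :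
  hol2 f -> holomorphic2 (V := C2) F -> hol2 (fun p => f (F p)).
Proof.
intros Hf HF p. destruct (HF p) as [lF H1]. destruct (Hf (F p)) as [lf H2].
eexists. apply (filterdiff_comp' (K := C_AbsRing) (U := C2) (V := C2) (W := C_NormedModule) F f p lF lf H1 H2).
Qed.

Lemma solution_push (F X Y : C2 -> C2) (phi : C -> C2) :
  pushes_forward F X Y -> entire_solution X phi -> entire_solution Y (fun t => F (phi t)).
Proof.
intros H Hphi t. destruct (H (phi t)) as (dF & HdF & E). rewrite <- E.
apply (fdiff_curve C2 F phi t dF); [exact HdF|apply Hphi].
Qed.

Lemma C2_eq (a b c d : C) : a = c -> b = d -> ((a, b) : C2) = (c, d).
Proof. now intros -> ->. Qed.

Definition straighten (al be : C -> C) (p : C) : C2 -> C2 :=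
  fun q => (fst q - p, al (fst q) * snd q + be (fst q)).
Definition straighten_inv (al be : C -> C) (p : C) : C2 -> C2 :=
  fun q => (fst q + p, (snd q - be (fst q + p)) / al (fst q + p)).
(** This is the inverse of the differential of [straighten], applied to [Y] at the image point: the
    first row of that differential is [(1, 0)], the second [(al' w + be', al)]. *)
Definition straighten_pullback (al be : C -> C) (p : C) (Y : C2 -> C2) : C2 -> C2 :=
  fun q => (fst (Y (straighten al be p q)),
    (snd (Y (straighten al be p q)) -
      (C_derive al (fst q) * snd q + C_derive be (fst q)) * fst (Y (straighten al be p q))) / al (fst q)).

Section Straighten.
Variables (al be : C -> C) (p : C).
Hypotheses (Hal : entire al) (Hbe : entire be) (Hal0 : forall z, al z <> 0).
Let F := straighten al be p.
Let G := straighten_inv al be p.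

Lemma straighten_hol : holomorphic2 (V := C2) F.
Proof.
apply hol2_pair.
- apply (hol2_minus (fun q => fst q) (fun _ => p)); [apply hol2_fst|apply hol2_const].
- apply (hol2_plus (fun q => al (fst q) * snd q)).
  + apply (hol2_mult (fun q => al (fst q)) (fun q => snd q)); [|apply hol2_snd].
    apply (hol2_comp1 al (fun q => fst q)); [exact Hal|apply hol2_fst].
  + apply (hol2_comp1 be (fun q => fst q)); [exact Hbe|apply hol2_fst].
Qed.

Lemma straighten_inv_hol : holomorphic2 (V := C2) G.
Proof.
assert (H1 : hol2 (fun q => fst q + p)).
{ apply (hol2_plus (fun q => fst q) (fun _ => p)); [apply hol2_fst|apply hol2_const]. }
apply (hol2_pair (fun q => fst q + p)); [exact H1|].
apply (hol2_mult (fun q => snd q - be (fst q + p)) (fun q => / al (fst q + p))).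
- apply (hol2_minus (fun q => snd q)); [apply hol2_snd|].
  now apply (hol2_comp1 be (fun q => fst q + p)).
- apply (hol2_comp1 (fun z => / al z) (fun q => fst q + p)); [|exact H1]. now apply entire_inv.
Qed.

Lemma straightenK q : G (F q) = q.
Proof.
revert q. cut (forall z w : C, G (F (z, w)) = (z, w)); [intros H [z w]; apply H|]. intros z w.
unfold G, F, straighten, straighten_inv. simpl fst. simpl snd.
replace (z - p + p) with z by ring. apply C2_eq; [reflexivity|]. field. apply Hal0.
Qed.

Lemma straighten_invK q : F (G q) = q.
Proof.
revert q. cut (forall z w : C, F (G (z, w)) = (z, w)); [intros H [z w]; apply H|]. intros z w.
unfold G, F, straighten, straighten_inv. simpl fst. simpl snd.
apply C2_eq; [ring|]. field. apply Hal0.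
Qed.

Lemma straighten_automorphism : automorphism F.
Proof.
split; [exact straighten_hol|]. exists G. split; [exact straighten_inv_hol|].
split; [exact straightenK|exact straighten_invK].
Qed.

Lemma straighten_fiber_preserving : fiber_preserving F.
Proof.
intros c. exists (c - p). intros q. split.
- intros Hq. exists (G q). split; [|apply straighten_invK].
  change (fst q + p = c). rewrite Hq. change (c - p + p = c). ring.
- intros (q' & Hq' & <-). change (fst q' - p = c - p). now rewrite Hq'.
Qed.

Lemma pullback_hol (Y : C2 -> C2) :
  holomorphic2 (V := C2) Y -> holomorphic2 (V := C2) (straighten_pullback al be p Y).
Proof.
intros HY.
assert (HYF : holomorphic2 (V := C2) (fun q => Y (F q))).
{ intros q. destruct (straighten_hol q) as [lF H1]. destruct (HY (F q)) as [lY H2].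
  eexists. apply (filterdiff_comp' (K := C_AbsRing) (U := C2) (V := C2) (W := C2) F Y q lF lY H1 H2). }
assert (H1 : hol2 (fun q => fst (Y (F q)))) by (apply (hol2_comp (fun q => fst q));
  [apply hol2_fst|exact HYF]).
assert (H2 : hol2 (fun q => snd (Y (F q)))) by (apply (hol2_comp (fun q => snd q));
  [apply hol2_snd|exact HYF]).
apply hol2_pair; [exact H1|].
apply (hol2_mult (fun q => snd (Y (F q)) - (C_derive al (fst q) * snd q + C_derive be (fst q)) * fst (Y (F q)))
  (fun q => / al (fst q))).
2:{ apply (hol2_comp1 (fun z => / al z) (fun q => fst q)); [now apply entire_inv|apply hol2_fst]. }
apply hol2_minus; [exact H2|]. apply hol2_mult; [|exact H1].
apply (hol2_plus (fun q => C_derive al (fst q) * snd q)).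
- apply (hol2_mult (fun q => C_derive al (fst q)) (fun q => snd q)); [|apply hol2_snd].
  apply (hol2_comp1 (C_derive al) (fun q => fst q)); [now apply entire_derive|apply hol2_fst].
- apply (hol2_comp1 (C_derive be) (fun q => fst q)); [now apply entire_derive|apply hol2_fst].
Qed.

Lemma pullback_pushes_forward (Y : C2 -> C2) : pushes_forward F (straighten_pullback al be p Y) Y.
Proof.
intros q.
exists (fun d => (fst d - 0, (fst d * C_derive al (fst q) * snd q + al (fst q) * snd d) + fst d * C_derive be (fst q))).
split.
- apply filterdiff_pair; [apply filter_filter| |].
  + apply (filterdiff_minus_fct (K := C_AbsRing) (U := C2) (V := C_NormedModule) (fun q => fst q) (fun _ => p) (fun q => fst q) (fun _ => zero)).
    * apply (filterdiff_linear _ is_linear_fst2).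
    * apply filterdiff_const.
  + apply (fdiff_plus (fun q => al (fst q) * snd q) (fun q => be (fst q)) q
      (fun d => fst d * C_derive al (fst q) * snd q + al (fst q) * snd d) (fun d => fst d * C_derive be (fst q))).
    * apply (fdiff_mult (fun q => al (fst q)) (fun q => snd q) q (fun d => fst d * C_derive al (fst q)) (fun d => snd d)).
      -- apply (fdiff_comp al (fun q => fst q));
        [now apply entire_cder|apply (filterdiff_linear _ is_linear_fst2)].
      -- apply (filterdiff_linear _ is_linear_snd2).
    * apply (fdiff_comp be (fun q => fst q));
      [now apply entire_cder|apply (filterdiff_linear _ is_linear_fst2)].
- unfold straighten_pullback. fold F. destruct (Y (F q)) as [y1 y2]. simpl fst. simpl snd.
  apply C2_eq; [ring|]. field. apply Hal0.
Qed.

Lemma solution_pull (Y : C2 -> C2) (phi : C -> C2) :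
  entire_solution Y phi -> entire_solution (straighten_pullback al be p Y) (fun t => G (phi t)).
Proof.
intros Hphi t.
assert (D1 := is_derive2_fst _ _ _ (Hphi t)). assert (D2 := is_derive2_snd _ _ _ (Hphi t)).
unfold straighten_pullback. fold F. rewrite straighten_invK.
set (y1 := fst (Y (phi t))) in *. set (y2 := snd (Y (phi t))) in *.
unfold G at 1, straighten_inv.
assert (D1' : cder (fun t => fst (phi t) + p) t y1).
{ eapply cder_eq; [apply (cder_plus (fun t => fst (phi t)) (fun _ => p));
  [exact D1|apply cder_const]|ring]. }
apply is_derive2_pair; [exact D1'|].
assert (Da := cder_comp al (fun t => fst (phi t) + p) t _ _ (entire_cder al Hal _) D1').
assert (Db := cder_comp be (fun t => fst (phi t) + p) t _ _ (entire_cder be Hbe _) D1').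
eapply cder_eq.
- apply (cder_mult (fun t => snd (phi t) - be (fst (phi t) + p)) (fun t => / al (fst (phi t) + p))).
  + apply (cder_minus (fun t => snd (phi t)) (fun t => be (fst (phi t) + p))); [exact D2|exact Db].
  + apply (cder_inv (fun t => al (fst (phi t) + p))); [exact Da|apply Hal0].
- unfold G, straighten_inv. simpl fst. simpl snd. field. apply Hal0.
Qed.

Lemma pullback_complete (Y : C2 -> C2) : complete Y -> complete (straighten_pullback al be p Y).
Proof.
intros HY q. destruct (HY (F q)) as (phi & E & Hphi).
exists (fun t => G (phi t)). split; [rewrite E; apply straightenK|now apply solution_pull].
Qed.

End Straighten.

(* [lam t] and [lam t'] give the same point iff [t - t'] is a period, so the
   quotient of the time line is the punctured plane, with coordinate
   [exp (lam t)]. *)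
Lemma trajectory_Cstar (phi : C -> C2) (psi : C2 -> C) (lam : C) :
  lam <> 0 -> (forall t, psi (phi t) = Cexp (lam * t)) ->
  (forall t t', Cexp (lam * t) = Cexp (lam * t') -> phi t = phi t') ->
  trajectory_type_Cstar phi.
Proof.
intros Hl Hpsi Hper.
(* The condition on [x] is placed under the existential so that choice gives a total function. *)
assert (Hs : forall x : C, exists t, x <> 0 -> Cexp (lam * t) = x).
{ intros x. destruct (Ceq_dec x 0) as [->|Hx]; [exists 0; intros H; now destruct H|].
  destruct (Cexp_surjective x Hx) as [t Ht]. exists (t / lam). intros _. rewrite <- Ht. f_equal.
  field. exact Hl. }
pose (lg := fun x => proj1_sig (constructive_indefinite_description _ (Hs x))).
assert (Hlg : forall x : C, x <> 0 -> Cexp (lam * lg x) = x).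
{ intros x. exact (proj2_sig (constructive_indefinite_description _ (Hs x))). }
exists psi, (fun x => phi (lg x)). split; [|split; [|split]].
- intros t. rewrite Hpsi. split; [apply Cexp_neq_0|]. apply Hper. rewrite Hlg;
  [reflexivity|apply Cexp_neq_0].
- intros x Hx. split; [now exists (lg x)|]. now rewrite Hpsi, Hlg.
- intros t. exists (lam * Cexp (lam * t)).
  apply (cder_ext (fun t => Cexp (lam * t))); [intros; now rewrite Hpsi|].
  eapply cder_eq; [apply (cder_comp Cexp (fun t => lam * t)); [apply cder_Cexp|]|].
  + apply (cder_mult (fun _ => lam) (fun t => t)); [apply cder_const|apply cder_id].
  + ring.
- intros x Hx. destruct (local_log x Hx) as (L & HL & EL).
  (* The chosen logarithm [lg] need not be continuous. The lift uses a holomorphic branch [L]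
     instead; the two times differ by a period, so [phi] takes the same value at both. *)
  exists (fun y => L y / lam). split.
  + apply filter_imp with (2 := HL). intros y [l Hy]. eexists.
    apply (cder_mult L (fun _ => / lam)); [exact Hy|apply cder_const].
  + assert (Hne : locally (T := C_UniformSpace) x (fun y => (y : C) <> RtoC 0)).
    { apply locally_C_eps. exists (Cmod x). split; [now apply Cmod_pos|]. intros y Hy ->.
      replace (0 - x) with (- x) in Hy by ring. rewrite Cmod_opp in Hy. lra. }
    generalize (filter_and _ _ EL Hne). apply filter_imp. intros y [Hy1 Hy2].
    apply Hper. rewrite Hlg by exact Hy2. rewrite <- Hy1 at 1. f_equal. field. exact Hl.
Qed.

(** The product [f exp(-g)] has derivative 0. *)
Lemma linear_ode (f g g' : C -> C) :
  (forall t, cder f t (g' t * f t)) -> (forall t, cder g t (g' t)) ->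
  forall t, f t = f 0 * Cexp (g t - g 0).
Proof.
intros Hf Hg t.
assert (E : forall t, f t * Cexp (- g t) = f 0 * Cexp (- g 0)).
{ intros u. apply (cder_zero_const (fun t => f t * Cexp (- g t))). intros z.
  eapply cder_eq; [apply (cder_mult f (fun t => Cexp (- g t))); [apply Hf|]|].
  - apply (cder_comp Cexp (fun t => - g t)); [apply cder_Cexp|]. apply (cder_opp g), Hg.
  - ring. }
transitivity (f t * Cexp (- g t) * Cexp (g t)).
- rewrite <- Cmult_assoc, <- Cexp_plus. replace (- g t + g t) with (RtoC 0) by ring.
  rewrite Cexp_0. ring.
- rewrite E, <- Cmult_assoc, <- Cexp_plus. do 2 f_equal. ring.
Qed.

(** * The normal form of the two families *)

Definition vcoord (k : nat) (q : C2) : C := snd q * fst q ^ k - 1.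
Definition ycoord (k j n : nat) (q : C2) : C := fst q ^ S j * vcoord k q ^ n.

(* Family (iii) is [j = n = 0], [p0 = a], [B = - A0 / z^k]; family (iv) is
   [S j = m - nk], [p0 = n a / (m - nk)], [B = A0 / y^k], with [y] the argument
   of [A].  The division by [z^k] is carried out through
   [y^k = z^k z^(jk) v^(nk)], so that the formula is also valid on [z = 0]. *)
Definition normal_field (k j n : nat) (p0 : C) (B : C -> C) : C2 -> C2 :=
  fun q => let y := ycoord k j n q in
  (fst q * (p0 + INR n * (y ^ k * B y)),
   - (INR (S j) * fst q ^ (j * k) * vcoord k q ^ (n * k + 1) * B y)
   - INR k * snd q * (p0 + INR n * (y ^ k * B y))).

Lemma hol2_vcoord k : hol2 (vcoord k).
Proof.
apply (hol2_minus (fun q => snd q * fst q ^ k) (fun _ => 1)); [|apply hol2_const].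
apply (hol2_mult (fun q => snd q)); [apply hol2_snd|]. apply (hol2_pow (fun q => fst q)), hol2_fst.
Qed.

Lemma hol2_ycoord k j n : hol2 (ycoord k j n).
Proof.
apply (hol2_mult (fun q => fst q ^ S j) (fun q => vcoord k q ^ n)).
- apply (hol2_pow (fun q => fst q)), hol2_fst.
- apply hol2_pow, hol2_vcoord.
Qed.

Section NormalField.
Variables (k j n : nat) (p0 : C) (B : C -> C).
Hypothesis (HB : entire B).
Let Y := normal_field k j n p0 B.
Let c (y : C) := y ^ k * B y.
Let lam := INR (S j) * p0.

Lemma normal_field_hol : holomorphic2 (V := C2) Y.
Proof.
assert (Hc : hol2 (fun q => p0 + INR n * (ycoord k j n q ^ k * B (ycoord k j n q)))).
{ apply (hol2_plus (fun _ => p0)); [apply hol2_const|].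
  apply (hol2_mult (fun _ => RtoC (INR n))); [apply hol2_const|].
  apply (hol2_mult (fun q => ycoord k j n q ^ k) (fun q => B (ycoord k j n q))).
  - apply hol2_pow, hol2_ycoord.
  - apply hol2_comp1; [exact HB|apply hol2_ycoord]. }
apply hol2_pair.
- apply (hol2_mult (fun q => fst q)); [apply hol2_fst|exact Hc].
- apply hol2_minus.
  + apply hol2_opp. apply (hol2_mult (fun q => INR (S j) * fst q ^ (j * k) * vcoord k q ^ (n * k + 1)) (fun q => B (ycoord k j n q))).
    * apply (hol2_mult (fun q => INR (S j) * fst q ^ (j * k)) (fun q => vcoord k q ^ (n * k + 1))).
      -- apply (hol2_mult (fun _ => RtoC (INR (S j)))); [apply hol2_const|].
      apply (hol2_pow (fun q => fst q)), hol2_fst.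
      -- apply hol2_pow, hol2_vcoord.
    * apply hol2_comp1; [exact HB|apply hol2_ycoord].
  + apply (hol2_mult (fun q => INR k * snd q)); [|exact Hc].
    apply (hol2_mult (fun _ => RtoC (INR k))); [apply hol2_const|apply hol2_snd].
Qed.

(** Identifies the first term of the second component of [normal_field] with [- l v C(y) / z^k],
    without dividing. *)
Lemma ycoord_pow (z v : C) : z ^ (j * k) * v ^ (n * k + 1) * z ^ k = (z ^ S j * v ^ n) ^ k * v.
Proof.
rewrite Cpow_mult_l, <- !Cpow_mult_r, Cpow_add_r.
replace (S j * k)%nat with (j * k + k)%nat by lia. rewrite Cpow_add_r. simpl (v ^ 1). ring.
Qed.

Lemma pow_pred (z : C) (m : nat) : INR m * z ^ pred m * z = INR m * z ^ m.
Proof. destruct m; simpl pred; [simpl; ring|]. rewrite (Cpow_S z m). ring. Qed.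

(** In [v = w z^k - 1] the second term of the second component cancels the derivative of [z^k]. For
    [y = z^l v^n] the logarithmic derivative is [l (p0 + n c) - n l c = l p0]: the unknown function
    [c] drops out. *)
Lemma solution_coords (phi : C -> C2) : entire_solution Y phi ->
  (forall t, cder (fun t => fst (phi t)) t ((p0 + INR n * c (ycoord k j n (phi t))) * fst (phi t))) /\
  (forall t, cder (fun t => vcoord k (phi t)) t (- (INR (S j) * c (ycoord k j n (phi t))) * vcoord k (phi t))) /\
  (forall t, cder (fun t => ycoord k j n (phi t)) t (lam * ycoord k j n (phi t))).
Proof.
intros Hphi.
assert (Hz : forall t, cder (fun t => fst (phi t)) t ((p0 + INR n * c (ycoord k j n (phi t))) * fst (phi t))).
{ intros t. eapply cder_eq; [apply is_derive2_fst, Hphi|]. unfold Y, normal_field, c.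
  cbn [fst snd]. ring. }
assert (Hv : forall t, cder (fun t => vcoord k (phi t)) t (- (INR (S j) * c (ycoord k j n (phi t))) * vcoord k (phi t))).
{ intros t. assert (Hw := is_derive2_snd _ _ _ (Hphi t)). eapply cder_eq.
  - apply (cder_minus (fun t => snd (phi t) * fst (phi t) ^ k) (fun _ => 1)); [|apply cder_const].
    apply (cder_mult (fun t => snd (phi t)) (fun t => fst (phi t) ^ k)); [exact Hw|].
    apply (cder_pow (fun t => fst (phi t))), Hz.
  - unfold Y, normal_field, c. cbn [fst snd].
    set (z := fst (phi t)). set (w := snd (phi t)). set (v := vcoord k (phi t)).
    set (y := ycoord k j n (phi t)).
    transitivity (- (INR (S j) * B y * (z ^ (j * k) * v ^ (n * k + 1) * z ^ k)) +
      (p0 + INR n * (y ^ k * B y)) * w * (INR k * z ^ pred k * z - INR k * z ^ k)); [ring|].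
    rewrite pow_pred, ycoord_pow.
    change (z ^ S j * v ^ n) with y. ring. }
split; [exact Hz|split; [exact Hv|]].
intros t. eapply cder_eq.
- apply (cder_mult (fun t => fst (phi t) ^ S j) (fun t => vcoord k (phi t) ^ n)).
  + apply (cder_pow (fun t => fst (phi t))), Hz.
  + apply (cder_pow (fun t => vcoord k (phi t))), Hv.
- set (y := ycoord k j n (phi t)). unfold lam.
  transitivity ((INR (S j) * fst (phi t) ^ pred (S j) * fst (phi t)) * (p0 + INR n * c y) * vcoord k (phi t) ^ n -
    INR (S j) * c y * fst (phi t) ^ S j * (INR n * vcoord k (phi t) ^ pred n * vcoord k (phi t))); [ring|].
  rewrite !pow_pred. unfold y, ycoord. ring.
Qed.

(* [G] plays the role of an antiderivative of [c y] along the solution through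
   a point with [y = y0]. *)
Definition flow_primitive (y0 : C) (G : C -> C) : Prop :=
  G 0 = 0 /\ forall t, cder G t (c (y0 * Cexp (lam * t))).

Lemma cder_lin (a t : C) : cder (fun t => a * t) t a.
Proof.
eapply cder_eq; [apply (cder_mult (fun _ => a) (fun t => t));
  [apply cder_const|apply cder_id]|ring].
Qed.

Lemma solution_formula (phi : C -> C2) (G : C -> C) :
  entire_solution Y phi -> flow_primitive (ycoord k j n (phi 0)) G ->
  forall t,
    ycoord k j n (phi t) = ycoord k j n (phi 0) * Cexp (lam * t) /\
    fst (phi t) = fst (phi 0) * Cexp (p0 * t + INR n * G t) /\
    vcoord k (phi t) = vcoord k (phi 0) * Cexp (- (INR (S j) * G t)).
Proof.
intros Hphi [G0 HG]. destruct (solution_coords phi Hphi) as (Hz & Hv & Hy).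
assert (Ey : forall t, ycoord k j n (phi t) = ycoord k j n (phi 0) * Cexp (lam * t)).
{ intros t. rewrite (linear_ode (fun t => ycoord k j n (phi t)) (fun t => lam * t) (fun _ => lam) Hy (cder_lin lam) t).
  do 2 f_equal. ring. }
intros t. split; [apply Ey|split].
- rewrite (linear_ode (fun t => fst (phi t)) (fun t => p0 * t + INR n * G t)
    (fun t => p0 + INR n * c (ycoord k j n (phi t))) Hz).
  + rewrite G0. do 2 f_equal. ring.
  + intros u. rewrite Ey. apply (cder_plus (fun t => p0 * t)); [apply cder_lin|].
    eapply cder_eq; [apply (cder_mult (fun _ => RtoC (INR n)) G); [apply cder_const|apply HG]|ring].
- rewrite (linear_ode (fun t => vcoord k (phi t)) (fun t => - (INR (S j) * G t))
    (fun t => - (INR (S j) * c (ycoord k j n (phi t)))) Hv).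
  + rewrite G0. do 2 f_equal. ring.
  + intros u. rewrite Ey. apply (cder_opp (fun t => INR (S j) * G t)).
    eapply cder_eq; [apply (cder_mult (fun _ => RtoC (INR (S j))) G);
      [apply cder_const|apply HG]|ring].
Qed.

(** Starting off the axis, [z] is [z0] times an exponential and never vanishes, so
    [w = (1 + v) / z^k] is defined for all complex times. *)
Lemma normal_field_solution (z0 v0 : C) (G : C -> C) :
  z0 <> 0 -> flow_primitive (z0 ^ S j * v0 ^ n) G ->
  entire_solution Y (fun t =>
    (z0 * Cexp (p0 * t + INR n * G t),
     (1 + v0 * Cexp (- (INR (S j) * G t))) / (z0 * Cexp (p0 * t + INR n * G t)) ^ k)).
Proof.
intros Hz0 [G0 HG] t.
set (z := fun t => z0 * Cexp (p0 * t + INR n * G t)).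
set (v := fun t => v0 * Cexp (- (INR (S j) * G t))).
change (is_derive2 (fun t => (z t, (1 + v t) / z t ^ k)) t (Y (z t, (1 + v t) / z t ^ k))).
assert (Hzt : forall t, z t <> 0) by (intros u; apply Cmult_neq_0; [exact Hz0|apply Cexp_neq_0]).
assert (Ev : forall t, vcoord k (z t, (1 + v t) / z t ^ k) = v t).
{ intros u. unfold vcoord. simpl. field. now apply Cpow_nz. }
assert (Ey : forall t, ycoord k j n (z t,
  (1 + v t) / z t ^ k) = z0 ^ S j * v0 ^ n * Cexp (lam * t)).
{ intros u. unfold ycoord. rewrite Ev. cbn [fst snd]. unfold z, v. rewrite !Cpow_mult_l, !Cexp_pow.
  transitivity (z0 ^ S j * v0 ^ n * (Cexp (INR (S j) * (p0 * u + INR n * G u)) * Cexp (INR n * - (INR (S j) * G u)))); [ring|].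
  rewrite <- Cexp_plus. do 2 f_equal. unfold lam. ring. }
assert (Ec : c (z0 ^ S j * v0 ^ n * Cexp (lam * t)) = c (z t ^ S j * v t ^ n)).
{ rewrite <- Ey. unfold ycoord. now rewrite Ev. }
assert (Dz : cder z t (z t * (p0 + INR n * c (z t ^ S j * v t ^ n)))).
{ eapply cder_eq.
  - apply (cder_mult (fun _ => z0) (fun t => Cexp (p0 * t + INR n * G t))); [apply cder_const|].
    apply (cder_comp Cexp (fun t => p0 * t + INR n * G t)); [apply cder_Cexp|].
    apply (cder_plus (fun t => p0 * t)); [apply cder_lin|].
    apply (cder_mult (fun _ => RtoC (INR n)) G); [apply cder_const|apply HG].
  - rewrite Ec. unfold z. ring. }
assert (Dv : cder v t (- (INR (S j) * c (z t ^ S j * v t ^ n)) * v t)).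
{ eapply cder_eq.
  - apply (cder_mult (fun _ => v0) (fun t => Cexp (- (INR (S j) * G t)))); [apply cder_const|].
    apply (cder_comp Cexp (fun t => - (INR (S j) * G t))); [apply cder_Cexp|].
    apply (cder_opp (fun t => INR (S j) * G t)).
    apply (cder_mult (fun _ => RtoC (INR (S j))) G); [apply cder_const|apply HG].
  - rewrite Ec. unfold v. ring. }
assert (Yt : ycoord k j n (z t, (1 + v t) / z t ^ k) = z t ^ S j * v t ^ n).
{ unfold ycoord. now rewrite Ev. }
unfold Y, normal_field. rewrite Yt, Ev. cbn [fst snd].
apply is_derive2_pair; [exact Dz|].
eapply cder_eq.
- apply (cder_mult (fun t => 1 + v t) (fun t => / z t ^ k)).
  + apply (cder_plus (fun _ => 1) v); [apply cder_const|exact Dv].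
  + apply (cder_inv (fun t => z t ^ k)); [apply (cder_pow z), Dz|now apply Cpow_nz].
- assert (Hzk : z t ^ k <> 0) by now apply Cpow_nz.
  assert (P := ycoord_pow (z t) (v t)). assert (Q := pow_pred (z t) k).
  set (y := z t ^ S j * v t ^ n) in *. fold (c y).
  transitivity (- (INR (S j) * B y * (y ^ k * v t)) / z t ^ k -
    (1 + v t) / (z t ^ k) ^ 2 * (INR k * z t ^ pred k * z t) * (p0 + INR n * c y)).
  { unfold c. field. exact Hzk. }
  rewrite <- P, Q. field. exact Hzk.
Qed.

(** On [z = 0] the coordinates [z, v] no longer determine [w]. The axis is invariant, [y = 0] and
    [v = -1] there, and the field restricted to it is affine in [w]. *)
Lemma normal_field_solution_axis (w0 : C) : (0 < k)%nat ->
  exists phi : C -> C2, phi 0 = (RtoC 0, w0) /\ entire_solution Y phi.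
Proof.
intros Hk.
set (b := - (INR (S j) * 0 ^ (j * k) * (-1) ^ (n * k + 1) * B 0)). set (mu := - (INR k * p0)).
assert (HY : forall w : C, Y (RtoC 0, w) = (RtoC 0, b + mu * w)).
{ intros w. assert (Ev : vcoord k (RtoC 0, w) = -1).
  { unfold vcoord. simpl. destruct k; [lia|]. simpl. ring. }
  assert (Ey : ycoord k j n (RtoC 0, w) = 0) by (unfold ycoord; simpl; ring).
  unfold Y, normal_field. rewrite Ev, Ey. cbn [fst snd]. unfold b, mu.
  replace (0 ^ k) with (RtoC 0) by (destruct k; [lia|simpl; ring]).
  apply C2_eq; ring. }
assert (Hs : exists f : C -> C, f 0 = w0 /\ forall t, cder f t (b + mu * f t)).
{ destruct (Ceq_dec mu 0) as [->|Hmu].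
  - exists (fun t => w0 + b * t). split; [ring|]. intros t.
    eapply cder_eq; [apply (cder_plus (fun _ => w0) (fun t => b * t));
      [apply cder_const|apply cder_lin]|ring].
  - exists (fun t => - b / mu + (w0 + b / mu) * Cexp (mu * t)). split.
    + replace (mu * 0) with (RtoC 0) by ring. rewrite Cexp_0. field. exact Hmu.
    + intros t. eapply cder_eq.
      * apply (cder_plus (fun _ => - b / mu)); [apply cder_const|].
        apply (cder_mult (fun _ => w0 + b / mu) (fun t => Cexp (mu * t))); [apply cder_const|].
        apply (cder_comp Cexp (fun t => mu * t)); [apply cder_Cexp|apply cder_lin].
      * field. exact Hmu. }
destruct Hs as (f & Hf0 & Hf). exists (fun t => (RtoC 0, f t)). split; [now rewrite Hf0|].
intros t. rewrite HY. apply (is_derive2_pair (fun _ => 0) f); [apply cder_const|apply Hf].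
Qed.

Lemma normal_field_complete : (0 < k)%nat ->
  (forall y0, exists G, flow_primitive y0 G) -> complete Y.
Proof.
intros Hk HG. cut (forall z w : C, exists phi : C -> C2, phi 0 = (z, w) /\ entire_solution Y phi).
{ intros H [z w]. apply H. }
intros z w. destruct (Ceq_dec z 0) as [->|Hz]; [now apply normal_field_solution_axis|].
destruct (HG (z ^ S j * (w * z ^ k - 1) ^ n)) as [G HG'].
eexists. split; [|apply (normal_field_solution z (w * z ^ k - 1) G Hz HG')].
destruct HG' as [G0 _]. rewrite G0.
replace (p0 * 0 + INR n * 0) with (RtoC 0) by ring.
replace (- (INR (S j) * 0)) with (RtoC 0) by ring.
rewrite Cexp_0. apply C2_eq; [ring|]. rewrite !Cmult_1_r. field. now apply Cpow_nz.
Qed.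

Lemma graph_inv_pow_coords (q : C2) : graph (inv_pow k) q <-> fst q <> RtoC 0 /\ vcoord k q = 0.
Proof.
revert q. cut (forall z w : C, graph (inv_pow k) (z, w) <-> z <> 0 /\ vcoord k (z, w) = 0).
{ intros H [z w]. apply H. }
intros z w. unfold graph, inv_pow, vcoord. cbn [fst snd].
destruct (Ceq_dec z 0) as [->|Hz].
- split; [discriminate|]. intros [H _]. now destruct H.
- assert (Hzk : z ^ k <> 0) by now apply Cpow_nz. split.
  + intros E. injection E as <-. split; [exact Hz|]. field. exact Hzk.
  + intros [_ E]. apply (f_equal (@Some C)).
    transitivity ((w * z ^ k - (w * z ^ k - 1)) / z ^ k); [field; exact Hzk|].
    rewrite E. field. exact Hzk.
Qed.

Lemma graph_inv_pow_invariant (phi : C -> C2) :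
  (forall y0, exists G, flow_primitive y0 G) -> entire_solution Y phi ->
  graph (inv_pow k) (phi 0) -> forall t, graph (inv_pow k) (phi t).
Proof.
intros HG Hphi H t. destruct (HG (ycoord k j n (phi 0))) as [G HG'].
destruct (solution_formula phi G Hphi HG' t) as (_ & Ez & Ev).
apply graph_inv_pow_coords in H. destruct H as [H1 H2]. apply graph_inv_pow_coords.
rewrite Ez, Ev, H2. split; [|ring]. apply Cmult_neq_0; [exact H1|apply Cexp_neq_0].
Qed.

End NormalField.

(** * Reduction to the normal form and trajectories *)

Lemma entire_sum_n (f : nat -> C -> C) (N : nat) :
  (forall i, entire (f i)) -> entire (fun z => sum_n (fun i => f i z) N).
Proof.
intros Hf. induction N.
- apply (entire_ext (f O)); [intros; now rewrite sum_O|auto].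
- apply (entire_ext (fun z => sum_n (fun i => f i z) N + f (S N) z)); [intros; now rewrite sum_Sn|].
  apply entire_plus; auto.
Qed.

Lemma polynomial1_entire (f : C -> C) : polynomial1 f -> entire f.
Proof.
intros (N & c & E). apply (entire_ext (fun z => sum_n (fun i => c i * z ^ i) N)); [intros;
  now rewrite E|].
apply (entire_sum_n (fun i z => c i * z ^ i)). intros i.
apply (entire_mult (fun _ => c i)); [apply entire_const|]. apply entire_pow, entire_id.
Qed.

Lemma polynomial_primitive (f : C -> C) (m : nat) : polynomial1 f ->
  exists D : C -> C, forall z, cder D z (z ^ m * f z).
Proof.
intros (N & c & E).
assert (Hmono : forall i, exists D, forall z, cder D z (z ^ m * (c i * z ^ i))).
{ intros i. exists (fun z => c i / INR (S (m + i)) * z ^ S (m + i)). intros z.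
  eapply cder_eq; [apply (cder_mult (fun _ => c i / INR (S (m + i))) (fun z => z ^ S (m + i)));
    [apply cder_const|apply (cder_pow (fun z => z)), cder_id]|].
  cbn [pred]. rewrite Cpow_add_r. field. intros H. apply RtoC_inj in H.
  now apply (not_0_INR (S (m + i))). }
assert (Hsum : forall M, exists D, forall z, cder D z (z ^ m * sum_n (fun i => c i * z ^ i) M)).
{ induction M as [|M [D HD]].
  - destruct (Hmono O) as [D HD]. exists D. intros z. eapply cder_eq; [apply HD|].
    now rewrite sum_O.
  - destruct (Hmono (S M)) as [D' HD']. exists (fun z => D z + D' z). intros z.
    eapply cder_eq; [apply cder_plus; [apply HD|apply HD']|]. rewrite sum_Sn.
    change (plus ?a ?b) with (a + b). ring. }
destruct (Hsum N) as [D HD]. exists D. intros z. rewrite E. apply HD.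
Qed.

Lemma RtoC_INR_S (m : nat) : RtoC (INR (S m)) <> 0.
Proof. intros H. apply RtoC_inj in H. now apply (not_0_INR (S m)). Qed.

Lemma flow_primitive_const (k j : nat) (B : C -> C) (y0 : C) :
  flow_primitive k j 0 B y0 (fun t => y0 ^ k * B y0 * t).
Proof.
split; [ring|]. intros t. replace (INR (S j) * 0 * t) with (RtoC 0) by ring.
rewrite Cexp_0, Cmult_1_r. apply cder_lin.
Qed.

(** As [C(y) = y^k B(y)] with [k > 0], the quotient [C(y) / (lam y)] is a polynomial; [D] is a
    primitive of it. One [D] serves all [y0], which later allows [D(ycoord q)] to be used as a
    function on the plane. *)
Lemma flow_primitive_exp (k j : nat) (p0 : C) (B : C -> C) :
  (0 < k)%nat -> p0 <> 0 -> polynomial1 B -> exists D : C -> C, forall y0,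
    flow_primitive k j p0 B y0 (fun t => D (y0 * Cexp (INR (S j) * p0 * t)) - D y0).
Proof.
intros Hk Hp HB. destruct k as [|k]; [lia|].
destruct (polynomial_primitive B k HB) as [D HD].
set (lam := INR (S j) * p0). assert (Hlam : lam <> 0) by (apply Cmult_neq_0;
  [apply RtoC_INR_S|exact Hp]).
exists (fun y => D y / lam). intros y0. split.
- replace (lam * 0) with (RtoC 0) by ring. rewrite Cexp_0, Cmult_1_r. ring.
- intros t. fold lam. eapply cder_eq.
  + apply (cder_minus (fun t => D (y0 * Cexp (lam * t)) / lam) (fun _ => D y0 / lam));
    [|apply cder_const].
    apply (cder_mult (fun t => D (y0 * Cexp (lam * t))) (fun _ => / lam)); [|apply cder_const].
    apply (cder_comp D (fun t => y0 * Cexp (lam * t))); [apply HD|].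
    apply (cder_mult (fun _ => y0) (fun t => Cexp (lam * t))); [apply cder_const|].
    apply (cder_comp Cexp (fun t => lam * t)); [apply cder_Cexp|apply cder_lin].
  + rewrite (Cpow_S _ k). field. exact Hlam.
Qed.

Lemma flow_primitive_exists (k j : nat) (p0 : C) (B : C -> C) :
  (0 < k)%nat -> polynomial1 B -> forall y0, exists G, flow_primitive k j p0 B y0 G.
Proof.
intros Hk HB y0. destruct (Ceq_dec p0 0) as [->|Hp].
- eexists. apply flow_primitive_const.
- destruct (flow_primitive_exp k j p0 B Hk Hp HB) as [D HD]. eexists. apply HD.
Qed.

Lemma entire_eq_off_zero (f g : C -> C) :
  entire f -> entire g -> (forall z, z <> RtoC 0 -> f z = g z) -> forall z, f z = g z.
Proof.
intros Hf Hg H z. destruct (Ceq_dec z 0) as [->|Hz]; [|now apply H].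
apply NNPP. intros Hne.
assert (Hd : f 0 - g 0 <> 0) by now apply Cminus_eq_contra.
assert (Hc : Ccont (fun z => f z + - g z) (RtoC 0)).
{ apply (continuous_Cplus C_UniformSpace f (fun z => - g z)); [now apply entire_continuous|].
  apply entire_continuous. apply (entire_ext (fun z => (-1) * g z)); [intros; ring|].
  apply (entire_mult (fun _ => -1)); [apply entire_const|exact Hg]. }
rewrite continuous_C_eps in Hc. specialize (Hc _ (Cmod_pos _ Hd)).
apply locally_C_eps in Hc. destruct Hc as (d & Hd0 & Hc).
assert (Hx : RtoC (d / 2) <> 0) by (intros E; apply RtoC_inj in E; lra).
specialize (Hc (RtoC (d / 2))). rewrite (H _ Hx) in Hc.
replace (RtoC (d / 2) - 0) with (RtoC (d / 2)) in Hc by ring.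
rewrite Cmod_R, Rabs_pos_eq in Hc by lra. specialize (Hc ltac:(lra)).
replace (g (d / 2)%R + - g (d / 2)%R - (f 0 + - g 0)) with (- (f 0 - g 0)) in Hc by ring.
rewrite Cmod_opp in Hc. lra.
Qed.

Lemma polynomial2_entire (f : C2 -> C) (w : C) : polynomial2 f -> entire (fun z => f (z, w)).
Proof.
intros (N & c & E).
apply (entire_ext (fun z => sum_n (fun i => sum_n (fun j => c i j * z ^ i * w ^ j) N) N));
  [intros; now rewrite E|].
apply (entire_sum_n (fun i z => sum_n (fun j => c i j * z ^ i * w ^ j) N)). intros i.
apply (entire_sum_n (fun j z => c i j * z ^ i * w ^ j)). intros j.
apply (entire_mult (fun z => c i j * z ^ i) (fun _ => w ^ j)); [|apply entire_const].
apply (entire_mult (fun _ => c i j)); [apply entire_const|]. apply entire_pow, entire_id.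
Qed.

Lemma hol2_entire (f : C2 -> C) (w : C) : hol2 f -> entire (fun z => f (z, w)).
Proof.
intros Hf. apply (entire_ext (fun x => f (plus ((RtoC 0, w) : C2) (scal x ((RtoC 1,
  RtoC 0) : C2))))); [|now apply hol2_line].
intros z. f_equal. change ((0 + z * 1, w + z * 0) = (z, w)). f_equal; ring.
Qed.

(** The families are given by formulas off [z = 0] only; for fixed [w], continuity in [z] extends
    the equality to the axis. *)
Lemma polynomial_field_eq (Y Y' : C2 -> C2) :
  polynomial_field Y -> holomorphic2 (V := C2) Y' ->
  (forall z w : C, z <> RtoC 0 -> Y (z, w) = Y' (z, w)) -> forall q, Y q = Y' q.
Proof.
intros [P1 P2] HY' E. cut (forall z w : C, Y (z, w) = Y' (z, w)); [intros H [z w]; apply H|].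
intros z w.
assert (H1 : fst (Y (z, w)) = fst (Y' (z, w))).
{ apply (entire_eq_off_zero (fun z => fst (Y (z, w))) (fun z => fst (Y' (z, w)))).
  - apply (polynomial2_entire (fun q => fst (Y q))), P1.
  - apply (hol2_entire (fun q => fst (Y' q))). apply (hol2_comp (fun q => fst q));
    [apply hol2_fst|exact HY'].
  - intros u Hu. now rewrite E. }
assert (H2 : snd (Y (z, w)) = snd (Y' (z, w))).
{ apply (entire_eq_off_zero (fun z => snd (Y (z, w))) (fun z => snd (Y' (z, w)))).
  - apply (polynomial2_entire (fun q => snd (Y q))), P2.
  - apply (hol2_entire (fun q => snd (Y' q))). apply (hol2_comp (fun q => snd q));
    [apply hol2_snd|exact HY'].
  - intros u Hu. now rewrite E. }
rewrite (surjective_pairing (Y (z, w))), (surjective_pairing (Y' (z, w))). now rewrite H1, H2.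
Qed.

Lemma polynomial1_opp (f : C -> C) : polynomial1 f -> polynomial1 (fun z => - f z).
Proof.
intros (N & c & E). exists N, (fun i => - c i). intros z. rewrite E. clear E.
induction N.
- rewrite !sum_O. ring.
- rewrite !sum_Sn, <- IHN. change (plus ?a ?b) with (a + b). ring.
Qed.

Lemma vcoord_div (k : nat) (z w : C) : z <> 0 -> w = (vcoord k (z, w) + 1) / z ^ k.
Proof. intros Hz. unfold vcoord. cbn [fst snd]. field. now apply Cpow_nz. Qed.

Lemma normal_field_off_axis (k j n : nat) (p0 : C) (B : C -> C) (z w : C) : z <> 0 ->
  let y := ycoord k j n (z, w) in let cy := y ^ k * B y in
  normal_field k j n p0 B (z, w) =
    (z * (p0 + INR n * cy),
     - (INR (S j) * cy * vcoord k (z, w) / z ^ k) - INR k * w * (p0 + INR n * cy)).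
Proof.
intros Hz y cy. assert (Hzk : z ^ k <> 0) by now apply Cpow_nz.
assert (P := ycoord_pow k j n z (vcoord k (z, w))).
unfold normal_field. fold y. cbn [fst snd]. apply C2_eq; [reflexivity|].
unfold cy. change (z ^ S j * vcoord k (z, w) ^ n) with y in P.
transitivity (- (INR (S j) * B y * (y ^ k * vcoord k (z,
  w))) / z ^ k - INR k * w * (p0 + INR n * (y ^ k * B y))).
- rewrite <- P. field. exact Hzk.
- field. exact Hzk.
Qed.

(** The disjunction carries over [A] not identically 0. A point with [y <> 0] is requested because
    the rate on a trajectory with [p0 = 0] is [y^k B(y)]. *)
Definition has_normal_form (k : nat) (Y : C2 -> C2) : Prop :=
  exists (j n : nat) (p0 : C) (B : C -> C),
    Nat.gcd (S j) n = 1%nat /\ polynomial1 B /\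
    (p0 <> 0 \/ exists y : C, y <> 0 /\ B y <> 0) /\
    forall q, Y q = normal_field k j n p0 B q.

Lemma pow_mult_nonzero (k : nat) (y b : C) : (0 < k)%nat -> y ^ k * b <> 0 -> y <> 0 /\ b <> 0.
Proof.
intros Hk H. split; intros ->; apply H; [|ring]. destruct k; [lia|]. simpl. ring.
Qed.

(** Here [y = z] and [l = 1]. The constant term [- a k] of [A] cancels the contribution of
    [z' = a z] to [v'], which leaves [v' = A0(z) v], so [C = - A0]. *)
Lemma family_iii_normal_form (k : nat) (Y : C2 -> C2) :
  (0 < k)%nat -> family_iii k Y -> has_normal_form k Y.
Proof.
intros Hk (HY & a & A & A0 & (B & HB & EB) & EA & (z1 & Hz1) & E).
exists 0%nat, 0%nat, a, (fun z => - B z).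
assert (HB' := polynomial1_opp B HB).
split; [reflexivity|split; [exact HB'|split]].
- destruct (Ceq_dec a 0) as [->|Ha]; [right|left; exact Ha].
  rewrite EA, EB in Hz1. replace (- (0 * INR k) + z1 ^ k * B z1) with (z1 ^ k * B z1) in Hz1 by ring.
  destruct (pow_mult_nonzero k z1 (B z1) Hk Hz1) as [H1 H2]. exists z1. split; [exact H1|].
  intros F. apply H2. replace (B z1) with (- - B z1) by ring. rewrite F. ring.
- apply polynomial_field_eq; [exact HY|apply normal_field_hol; now apply polynomial1_entire|].
  intros z w Hz. rewrite E by exact Hz. rewrite normal_field_off_axis by exact Hz. cbv zeta.
  assert (Hzk : z ^ k <> 0) by now apply Cpow_nz.
  assert (Ey : ycoord k 0 0 (z, w) = z) by (unfold ycoord; cbn [fst snd]; simpl; ring).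
  rewrite Ey, EA, EB. unfold vcoord. cbn [fst snd].
  change (INR 1) with 1%R. change (INR 0) with 0%R.
  apply C2_eq; [ring|]. field. exact Hzk.
Qed.

(** A direct computation gives [v' = a v - l A(y) v], with [l = m - nk]. The constant term [a / l]
    of [A] removes [a v], so [C = A0], while in [z' = n z A(y)] it leaves [p0 = n a / l]. *)
Lemma family_iv_normal_form (k : nat) (Y : C2 -> C2) :
  (0 < k)%nat -> family_iv k Y -> has_normal_form k Y.
Proof.
intros Hk (HY & a & m & n & A & A0 & Hm & Hn & Hgcd & Hmn & (B & HB & EB) & EA & (y1 & Hy1) & E).
destruct (m - n * k)%nat as [|j] eqn:Ej; [lia|].
assert (Em : m = (S j + n * k)%nat) by lia.
assert (Hj := RtoC_INR_S j).
assert (Hn0 : RtoC (INR n) <> 0) by (destruct n; [lia|apply RtoC_INR_S]).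
exists j, n, (INR n * a / INR (S j)), B.
split; [|split; [exact HB|split]].
(* Since [m = l + nk], the pairs [(m, n)] and [(l, n)] have the same gcd. *)
- rewrite <- Hgcd, Em, Nat.gcd_comm, (Nat.gcd_comm (S j + n * k)).
  rewrite (Nat.mul_comm n k). now rewrite Nat.gcd_add_mult_diag_r.
- destruct (Ceq_dec a 0) as [->|Ha]; [right|left].
  + rewrite EA, EB in Hy1. replace (0 / INR (S j) + y1 ^ k * B y1) with (y1 ^ k * B y1) in Hy1 by (field; exact Hj).
    destruct (pow_mult_nonzero k y1 (B y1) Hk Hy1) as [H1 H2]. now exists y1.
  + apply Cmult_neq_0; [now apply Cmult_neq_0|].
    intros F. apply (f_equal (fun x => x * INR (S j))) in F.
    rewrite Cinv_l, Cmult_0_l in F by exact Hj.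
    injection F. lra.
- apply polynomial_field_eq; [exact HY|apply normal_field_hol; now apply polynomial1_entire|].
  intros z w Hz. rewrite E by exact Hz. rewrite normal_field_off_axis by exact Hz. cbv zeta.
  assert (Hzk : z ^ k <> 0) by now apply Cpow_nz.
  change (z ^ S j * (w * z ^ k - 1) ^ n) with (ycoord k j n (z, w)).
  set (y := ycoord k j n (z, w)). rewrite EA, EB. unfold vcoord. cbn [fst snd].
  rewrite Em, plus_INR, mult_INR, RtoC_plus, RtoC_mult.
  apply C2_eq; [field; exact Hj|]. field. split; assumption.
Qed.

Section TypeCstar.
Variables (k j n : nat) (p0 : C) (B : C -> C).
Hypotheses (Hk : (0 < k)%nat) (HB : polynomial1 B) (Hgcd : Nat.gcd (S j) n = 1%nat).
Let Y := normal_field k j n p0 B.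
Variables (X F G : C2 -> C2).
Hypotheses (HF : holomorphic2 (V := C2) F) (FK : forall q, G (F q) = q) (GK : forall q, F (G q) = q)
  (HX : pushes_forward F X Y).

Lemma coords_inj (q q' : C2) : fst (F q) <> RtoC 0 -> fst (F q) = fst (F q') ->
  vcoord k (F q) = vcoord k (F q') -> q = q'.
Proof.
intros H0 H1 H2. rewrite <- (FK q), <- (FK q'). f_equal.
destruct (F q) as [z w], (F q') as [z' w']. cbn [fst snd] in *. subst z'.
apply C2_eq; [reflexivity|]. rewrite (vcoord_div k z w), (vcoord_div k z w') by exact H0.
exact (f_equal (fun v : C => (v + 1) / z ^ k) H2).
Qed.

Lemma pluripolar_preimage (H : C2 -> C) (q0 : C2) :
  hol2 H -> H q0 <> 0 -> pluripolar (fun q => H (F q) = 0).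
Proof.
intros HH Hq. apply (pluripolar_zero_set (fun q => H (F q)) (G q0));
  [now apply hol2_comp|now rewrite GK].
Qed.

(* If [p0 <> 0], [y] and [z exp(-n D(y))] determine the point, and the latter
   is a multiple of [exp(p0 t)] along a trajectory. *)
Lemma type_Cstar_hyperbolic : p0 <> 0 -> type_Cstar X.
Proof.
intros Hp.
destruct (flow_primitive_exp k j p0 B Hk Hp HB) as [D HD].
exists (fun q => fst (F q) = RtoC 0). split; [|split].
- apply (pluripolar_preimage (fun q => fst q) (RtoC 1, RtoC 0)); [apply hol2_fst|].
  cbn [fst]. intros E. apply RtoC_inj in E. lra.
- intros phi Hphi t t' H.
  assert (Hs := solution_push F X Y phi HX Hphi).
  destruct (solution_formula k j n p0 B _ _ Hs (HD _) t) as (_ & E1 & _).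
  destruct (solution_formula k j n p0 B _ _ Hs (HD _) t') as (_ & E2 & _).
  rewrite E1 in H. rewrite E2.
  destruct (Ceq_dec (fst (F (phi 0))) 0) as [->|H0]; [apply Cmult_0_l|].
  exfalso. apply (Cmult_neq_0 _ _ H0 (Cexp_neq_0 _) H).
- intros phi Hphi t0 Ht0.
  assert (Hs := solution_push F X Y phi HX Hphi).
  set (y0 := ycoord k j n (F (phi 0))). set (g := fun y => D y - D y0).
  assert (Hf := fun t => solution_formula k j n p0 B _ _ Hs (HD y0) t). cbv beta in Hf.
  set (lam := INR (S j) * p0) in *.
  assert (Hz0 : fst (F (phi 0)) <> RtoC 0).
  { intros E. apply Ht0. destruct (Hf t0) as (_ & -> & _). rewrite E. apply Cmult_0_l. }
  apply (trajectory_Cstar phi (fun q => fst (F q) / fst (F (phi 0)) * Cexp (- (INR n * g (ycoord k j n (F q))))) p0 Hp).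
  + intros t. destruct (Hf t) as (E1 & E2 & _). rewrite E1, E2. fold y0.
    unfold g. rewrite Cexp_plus, Cexp_opp. field. split; [apply Cexp_neq_0|exact Hz0].
  + intros t t' E. destruct (Hf t) as (_ & E2 & E3). destruct (Hf t') as (_ & E2' & E3').
    (* Equality of [exp(p0 t)] passes to its [l]-th power [exp(lam t)], the only other quantity in
       the flow. *)
    assert (El : Cexp (lam * t) = Cexp (lam * t')).
    { unfold lam. rewrite <- !Cmult_assoc, <- !Cexp_pow. now rewrite E. }
    apply coords_inj.
    * rewrite E2. apply Cmult_neq_0; [exact Hz0|apply Cexp_neq_0].
    * rewrite E2, E2', !Cexp_plus, El, E. reflexivity.
    * rewrite E3, E3', El. reflexivity.
Qed.

(* If [p0 = 0], [y] is constant on a trajectory, [z] and [v] are multiples of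
   [exp(n c t)] and [exp(-(j+1) c t)], and Bezout recovers [exp(c t)]. *)
Lemma type_Cstar_resonant : p0 = 0 -> (exists y : C, y <> 0 /\ B y <> 0) -> type_Cstar X.
Proof.
intros Hp (y1 & Hy1 & HBy1).
assert (HD : forall y0, flow_primitive k j p0 B y0 (fun t => y0 ^ k * B y0 * t)).
{ intros y0. rewrite Hp. apply flow_primitive_const. }
assert (HBe := polynomial1_entire B HB).
assert (Hf : forall phi, entire_solution X phi -> forall t,
  let q := F (phi t) in let q0 := F (phi 0) in let y0 := ycoord k j n q0 in let c := y0 ^ k * B y0 in
  ycoord k j n q = y0 /\ fst q = fst q0 * Cexp (c * t) ^ n /\
    vcoord k q = vcoord k q0 * Cexp (- (c * t)) ^ S j).
{ intros phi Hphi t q q0 y0 c0.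
  assert (Hs := solution_push F X Y phi HX Hphi).
  destruct (solution_formula k j n p0 B _ _ Hs (HD _) t) as (E1 & E2 & E3).
  fold q in E1, E2, E3. fold q0 in E1, E2, E3. fold y0 in E1, E2, E3. fold c0 in E2, E3.
  rewrite !Cexp_pow. split; [|split].
  - rewrite E1, Hp. replace (INR (S j) * 0 * t) with (RtoC 0) by ring. rewrite Cexp_0. ring.
  - rewrite E2, Hp. do 2 f_equal. ring.
  - rewrite E3. do 2 f_equal. ring. }
(* Off this set [z], [v] and the rate [c] are all non-zero. Along a solution the product is
   multiplied by an exponential, since [y] is constant; hence the set is invariant. *)
exists (fun q => fst (F q) * vcoord k (F q) * B (ycoord k j n (F q)) = 0). split; [|split].
(* A point off the set: [v = 1], that is [w = 2 / z^k], and [z] an [l]-th root of [y1], so that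
   [y = y1]. *)
- destruct (Cexp_surjective y1 Hy1) as [tau Htau].
  set (z := Cexp (tau / INR (S j))).
  assert (Hz : z <> 0) by apply Cexp_neq_0.
  assert (Hzl : z ^ S j = y1).
  { unfold z. rewrite Cexp_pow, <- Htau. f_equal. field. apply RtoC_INR_S. }
  assert (Hv : vcoord k (z, 2 / z ^ k) = 1).
  { unfold vcoord. cbn [fst snd]. field. now apply Cpow_nz. }
  apply (pluripolar_preimage (fun q => fst q * vcoord k q * B (ycoord k j n q)) (z, 2 / z ^ k)).
  + apply (hol2_mult (fun q => fst q * vcoord k q) (fun q => B (ycoord k j n q))).
    * apply (hol2_mult (fun q => fst q)); [apply hol2_fst|apply hol2_vcoord].
    * apply hol2_comp1; [exact HBe|apply hol2_ycoord].
  + unfold ycoord. rewrite Hv. cbn [fst snd]. rewrite Hzl, Cpow_1_l, !Cmult_1_r.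
    now apply Cmult_neq_0.
- intros phi Hphi t t' H.
  destruct (Hf phi Hphi t) as (E1 & E2 & E3). destruct (Hf phi Hphi t') as (E1' & E2' & E3').
  cbv zeta in *. rewrite E1, E2, E3 in H. rewrite E1', E2', E3'.
  set (c := ycoord k j n (F (phi 0)) ^ k * B (ycoord k j n (F (phi 0)))) in *.
  set (P := fst (F (phi 0)) * vcoord k (F (phi 0)) * B (ycoord k j n (F (phi 0)))).
  destruct (Ceq_dec P 0) as [E|HP].
  + transitivity (P * (Cexp (c * t') ^ n * Cexp (- (c * t')) ^ S j)); [unfold P; ring|].
    rewrite E. ring.
  + exfalso. apply (Cmult_neq_0 P (Cexp (c * t) ^ n * Cexp (- (c * t)) ^ S j)); [exact HP| |].
    * apply Cmult_neq_0; apply Cpow_nz, Cexp_neq_0.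
    * rewrite <- H. unfold P. ring.
- intros phi Hphi t0 Ht0.
  assert (Hphi0 := Hf phi Hphi). cbv zeta in Hphi0.
  set (z0 := fst (F (phi 0)) : C) in *. set (v0 := vcoord k (F (phi 0))) in *.
  set (y0 := ycoord k j n (F (phi 0))) in *. set (c := y0 ^ k * B y0) in *.
  assert (H0 : z0 * v0 * B y0 <> 0).
  { intros E. apply Ht0. destruct (Hphi0 t0) as (-> & -> & ->).
    transitivity (z0 * v0 * B y0 * (Cexp (c * t0) ^ n * Cexp (- (c * t0)) ^ S j)); [ring|].
    rewrite E. ring. }
  assert (Hz0 : z0 <> 0) by (intros E; apply H0; rewrite E; ring).
  assert (Hv0 : v0 <> 0) by (intros E; apply H0; rewrite E; ring).
  assert (HB0 : B y0 <> 0) by (intros E; apply H0; rewrite E; ring).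
  assert (Hc : c <> 0).
  { apply Cmult_neq_0; [|exact HB0]. apply Cpow_nz. apply Cmult_neq_0; now apply Cpow_nz. }
  assert (Hinj : forall t t', Cexp (c * t) = Cexp (c * t') -> phi t = phi t').
  { intros t t' E. destruct (Hphi0 t) as (_ & E2 & E3). destruct (Hphi0 t') as (_ & E2' & E3').
    apply coords_inj.
    - rewrite E2. apply Cmult_neq_0; [exact Hz0|]. apply Cpow_nz, Cexp_neq_0.
    - now rewrite E2, E2', E.
    - now rewrite E3, E3', !Cexp_opp, E. }
  (* Bezout over the naturals has two forms, [u l = 1 + r n] and [u n = 1 + r l]. Combining the
     powers [exp(n c t)] and [exp(- l c t)] accordingly yields [exp(- c t)] or [exp(c t)], with no
     negative exponents. *)
  assert (Hbez := Nat.gcd_bezout (S j) n). rewrite Hgcd in Hbez.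
  destruct Hbez as [(u & r & Hb)|(u & r & Hb)].
  + apply (trajectory_Cstar phi (fun q => (fst (F q) / z0) ^ r * (vcoord k (F q) / v0) ^ u) (- c)).
    * intros E. apply Hc. replace c with (- - c) by ring. rewrite E. ring.
    * intros t. destruct (Hphi0 t) as (_ & -> & ->).
      replace (z0 * Cexp (c * t) ^ n / z0) with (Cexp (c * t) ^ n) by (field; exact Hz0).
      replace (v0 * Cexp (- (c * t)) ^ S j / v0) with (Cexp (- (c * t)) ^ S j) by (field;
        exact Hv0).
      rewrite <- !Cpow_mult_r, (Nat.mul_comm (S j) u), Hb, !Cexp_pow, <- Cexp_plus. f_equal.
      rewrite plus_INR, !mult_INR, RtoC_plus, !RtoC_mult. change (INR 1) with 1%R. ring.
    * intros t t' E. apply Hinj. replace (- c * t) with (- (c * t)) in E by ring.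
      replace (- c * t') with (- (c * t')) in E by ring. rewrite !Cexp_opp in E.
      transitivity (/ / Cexp (c * t)); [field; apply Cexp_neq_0|]. rewrite E. field.
      apply Cexp_neq_0.
  + apply (trajectory_Cstar phi (fun q => (fst (F q) / z0) ^ u * (vcoord k (F q) / v0) ^ r) c Hc); [|exact Hinj].
    intros t. destruct (Hphi0 t) as (_ & -> & ->).
    replace (z0 * Cexp (c * t) ^ n / z0) with (Cexp (c * t) ^ n) by (field; exact Hz0).
    replace (v0 * Cexp (- (c * t)) ^ S j / v0) with (Cexp (- (c * t)) ^ S j) by (field; exact Hv0).
    rewrite <- !Cpow_mult_r, (Nat.mul_comm n u), Hb, !Cexp_pow, <- Cexp_plus. f_equal.
    rewrite plus_INR, !mult_INR, RtoC_plus, !RtoC_mult. change (INR 1) with 1%R. ring.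
Qed.

End TypeCstar.

(** * The theorem *)

(** On the graph, [al w + be = (al g + be u^k) / u^k = 1 / u^k]; as [al] has no zero, the
    computation can be reversed. *)
Lemma straighten_graph (s : C -> P1) (al be g : C -> C) (p : C) (k : nat) :
  (forall z, al z <> 0) -> (forall z, al z * g z + be z * (z - p) ^ k = 1) ->
  s p = None -> (forall z, z <> p -> s z = Some (g z / (z - p) ^ k)) ->
  forall q, graph s q <-> graph (inv_pow k) (straighten al be p q).
Proof.
intros Hal E Hp Hs. cut (forall z w : C, graph s (z, w) <->
  graph (inv_pow k) (straighten al be p (z, w))).
{ intros H [z w]. apply H. }
intros z w. unfold graph, straighten, inv_pow. cbn [fst snd].
destruct (Ceq_dec z p) as [->|Hz].
- rewrite Hp. destruct (Ceq_dec (p - p) 0) as [_|H]; [easy|]. exfalso. apply H. ring.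
- assert (Hu : z - p <> 0) by now apply Cminus_eq_contra.
  assert (Huk : (z - p) ^ k <> 0) by now apply Cpow_nz.
  rewrite (Hs z Hz). destruct (Ceq_dec (z - p) 0) as [H|_]; [contradiction|].
  assert (Eg : g z = (1 - be z * (z - p) ^ k) / al z).
  { rewrite <- (E z). field. apply Hal. }
  assert (Some_inj : forall a b : C, Some a = Some b -> a = b) by (intros a b H; now injection H).
  split; intros H; apply Some_inj in H.
  + rewrite <- H. apply (f_equal (@Some C)). rewrite Eg. field. split; [apply Hal|exact Huk].
  + apply (f_equal (@Some C)).
    transitivity ((/ (z - p) ^ k - be z) / al z); [rewrite Eg; field; split;
      [exact Huk|apply Hal]|].
    rewrite H. field. apply Hal.
Qed.

(** A local equation [f] of [S] vanishes along a solution that stays in [S]; differentiating at time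
    0 gives [df (X q) = 0]. *)
Lemma invariant_tangent (X : C2 -> C2) (S : C2 -> Prop) :
  (forall q, S q -> exists phi : C -> C2, phi 0 = q /\ entire_solution X phi /\ forall t,
    S (phi t)) ->
  tangent_to X S.
Proof.
intros Hinv q f df Hq _ Hf Hdf _.
destruct (Hinv q Hq) as (phi & E & Hphi & HS). subst q.
assert (D := fdiff_curve C_NormedModule f phi 0 df _ Hdf (Hphi 0)).
apply (cder_unique (fun t => f (phi t)) 0 _ _ D).
apply (cder_ext_loc (fun _ => 0)); [|apply cder_const].
assert (Hc : continuous (T := AbsRing_UniformSpace C_AbsRing) (U := C2) phi (RtoC 0)).
{ apply (ex_derive_continuous (K := C_AbsRing) (V := C2)). exists (X (phi 0)). apply Hphi. }
apply locally_C. specialize (Hc _ Hf). unfold filtermap in Hc.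
revert Hc. apply filter_imp. intros t Ht. symmetry. now apply Ht.
Qed.

Theorem theorem3 :
  forall (s : C -> P1) (k : nat),
    (0 < k)%nat ->
    meromorphic s ->
    only_pole_of_order s k ->
    forall Y0 : C2 -> C2,
      family_iii k Y0 \/ family_iv k Y0 ->
      exists X : C2 -> C2,
        holomorphic2 X /\
        complete X /\
        type_Cstar X /\
        tangent_to X (graph s) /\
        exists F : C2 -> C2,
          automorphism F /\
          fiber_preserving F /\
          (forall p : C2, graph s p -> graph (inv_pow k) (F p)) /\
          pushes_forward F X Y0.
Proof.
intros s k Hk Hs (p & Hp & Honly) Y0 HY0.
destruct (pole_numerator s p k Hk Hs Hp Honly) as (g & Hg & Hgp & Es).
assert (Hnf : has_normal_form k Y0).
{ destruct HY0; [now apply family_iii_normal_form|now apply family_iv_normal_form]. }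
destruct Hnf as (j & n & p0 & B & Hgcd & HB & Hnz & EY).
assert (Hjet : exists al be : C -> C, entire al /\ entire be /\ (forall z, al z <> 0) /\
  forall z, al z * g z + be z * (z - p) ^ k = 1).
{ destruct k as [|k']; [lia|]. now apply jet_normalization. }
destruct Hjet as (al & be & Hal & Hbe & Hal0 & Eab).
(* The pull-back is taken from the normal form, which is given by one formula on the whole plane and
   equals [Y0] at every point. *)
set (Y := normal_field k j n p0 B) in *.
set (F := straighten al be p). set (X := straighten_pullback al be p Y).
assert (HBe := polynomial1_entire B HB).
assert (HG := flow_primitive_exists k j p0 B Hk HB).
assert (HXY : pushes_forward F X Y) by now apply pullback_pushes_forward.
assert (Hgr : forall q, graph s q <-> graph (inv_pow k) (F q)).
{ apply (straighten_graph s al be g p k); auto. apply Hp. }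
assert (Hcomp : complete X) by (apply pullback_complete; auto; now apply normal_field_complete).
exists X. split; [|split; [|split; [|split]]].
- apply pullback_hol; auto. now apply normal_field_hol.
- exact Hcomp.
- assert (HF : holomorphic2 (V := C2) F) by now apply straighten_hol.
  assert (FK := straightenK al be p Hal0). assert (GK := straighten_invK al be p Hal0).
  destruct (Ceq_dec p0 0) as [Hp0|Hp0].
  + destruct Hnz as [Hnz|Hnz]; [contradiction|].
    now apply (type_Cstar_resonant k j n p0 B HB Hgcd X F (straighten_inv al be p)).
  + now apply (type_Cstar_hyperbolic k j n p0 B Hk HB X F (straighten_inv al be p)).
- apply invariant_tangent. intros q Hq. destruct (Hcomp q) as (phi & E & Hphi).
  exists phi. split; [exact E|split; [exact Hphi|]]. intros t. apply Hgr.
  apply (graph_inv_pow_invariant k j n p0 B (fun t => F (phi t)) HG);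
    [now apply (solution_push F X)|].
  rewrite E. now apply Hgr.
- exists F. split; [now apply straighten_automorphism|split;
  [now apply straighten_fiber_preserving|split]].
  + intros q. apply Hgr.
  + intros q. destruct (HXY q) as (dF & H1 & H2). exists dF. split; [exact H1|]. now rewrite EY.
Qed.
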